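(* Two singular combinatorial 4-manifolds are piecewise-linearly homeomorphic if and only if they are bistellar equivalent.
   Context: A finite simplicial complex $K$ is a finite vertex set $K_0$ with a collection of (nonempty) subsets of $K_0$ (simplices) closed under passing to nonempty subsets and containing all singletons; $|K|$ is its geometric realization. A piecewise-linear map $K\to L$ is a map $|K|\to|L|$ that is linear on each simplex of some subdivision of $K$. A combinatorial $n$-ball is a simplicial complex piecewise-linearly homeomorphic to the standard $n$-simplex; a combinatorial $n$-sphere is one piecewise-linearly homeomorphic to the boundary $\partial\Delta^{n+1}$ of the standard $(n+1)$-simplex. A combinatorial $n$-manifold is a finite simplicial complex such that the link of every vertex is a combinatorial $(n-1)$-sphere. A singular combinatorial $n$-manifold is a finite simplicial complex such that the link of every vertex is a combinatorial $(n-1)$-manifold. (In particular there is no boundary.) Bistellar moves: for $p,q\ge 1$ with $p+q=n+2$, let $P$ be a codimension-zero combinatorial submanifold of $\partial\Delta^{n+1}$ consisting of $p$ of its $n$-simplices (together with their faces), and let $Q$ be the complementary codimension-zero combinatorial submanifold consisting of the remaining $q$ $n$-simplices, so $\partial P=\partial Q$. Two singular combinatorial $n$-manifolds $K$ and $K'$ are related by a $(p,q)$-bistellar move if the simplicial complex $K'$ is obtained from $K$ by removing a codimension-zero submanifold (subcomplex) isomorphic to $P$ and replacing it by one isomorphic to $Q$, glued along the common boundary. Two singular combinatorial manifolds are bistellar equivalent if they are related by a finite series of bistellar moves (combinatorial manifolds being considered up to simplicial isomorphism). *)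

(* Defs.v *)
From HB Require Import structures.
From mathcomp Require Import all_boot all_order all_algebra.
From mathcomp Require Import reals.

Set Implicit Arguments.
Unset Strict Implicit.
Unset Printing Implicit Defensive.

Import Order.TTheory GRing.Theory Num.Theory.
Local Open Scope ring_scope.

Record complex := Complex {
  vert : finType;
  simplices :> {set {set vert}};
  simplices_neq0 : forall s, s \in simplices -> s != set0;
  simplices_sub : forall s t : {set vert},
    s \in simplices -> t \subset s -> t != set0 -> t \in simplices;
  simplices1 : forall v, [set v] \in simplices }.

Definition subcomplex (U : finType) (X : {set {set U}}) : Prop :=
  (forall s, s \in X -> s != set0) /\
  (forall s t : {set U}, s \in X -> t \subset s -> t != set0 -> t \in X).

Definition im_simplices (U W : finType) (f : U -> W) (X : {set {set U}}) :
  {set {set W}} := [set f @: s | s : {set U} in X].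

Definition isomorphic (K L : complex) : Prop :=
  exists f : vert K -> vert L, bijective f /\ im_simplices f K = L.

(* Vertices of the link of v; the link is again a complex all of whose vertices
   are simplices, so its vertex type is a subtype of that of K. *)
Definition link_vert (K : complex) (v : vert K) : finType :=
  {u : vert K | (u != v) && ([set v; u] \in K)}.

Definition link_simplices (K : complex) (v : vert K) :
    {set {set link_vert v}} :=
  [set s : {set link_vert v} | (s != set0) && (v |: (val @: s) \in K)].

Lemma link_neq0 (K : complex) (v : vert K) s :
  s \in link_simplices v -> s != set0.
Proof. by rewrite inE => /andP[]. Qed.

Lemma link_sub (K : complex) (v : vert K) (s t : {set link_vert v}) :
  s \in link_simplices v -> t \subset s -> t != set0 ->
  t \in link_simplices v.
Proof.
rewrite !inE => /andP[_ sK] ts t0; rewrite t0 /=.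
apply: simplices_sub sK _ _; first by rewrite setUS // imsetS.
by apply/set0Pn; exists v; rewrite setU11.
Qed.

Lemma link_1 (K : complex) (v : vert K) (u : link_vert v) :
  [set u] \in link_simplices v.
Proof.
rewrite inE imset_set1; have /andP[_ ->] := valP u; rewrite andbT.
by apply/set0Pn; exists u; rewrite inE.
Qed.

Definition link (K : complex) (v : vert K) : complex :=
  Complex (@link_neq0 K v) (@link_sub K v) (@link_1 K v).

(* Nonempty proper subsets of the n + 2 vertices of the (n+1)-simplex. *)
Definition bd_simplices (n : nat) : {set {set 'I_n.+2}} :=
  [set s | (s != set0) && (s != setT)].

Lemma bd_neq0 n s : s \in bd_simplices n -> s != set0.
Proof. by rewrite inE => /andP[]. Qed.

Lemma bd_sub n (s t : {set 'I_n.+2}) :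
  s \in bd_simplices n -> t \subset s -> t != set0 -> t \in bd_simplices n.
Proof.
rewrite !inE => /andP[_ sT] ts ->; apply: contraNneq sT => tT.
by rewrite -subTset -tT.
Qed.

Lemma bd_1 n (v : 'I_n.+2) : [set v] \in bd_simplices n.
Proof.
rewrite inE; apply/andP; split; first by apply/set0Pn; exists v; rewrite inE.
by apply/eqP => /(congr1 (fun A : {set _} => #|A|)); rewrite cards1 cardsT card_ord.
Qed.

(* The boundary of the standard (n+1)-simplex, of dimension n. *)
Definition bd_simplex (n : nat) : complex :=
  Complex (@bd_neq0 n) (@bd_sub n) (@bd_1 n).

Section Realization.
Variable R : realType.

(* x, as a tuple of barycentric coordinates, lies in the closed simplex with
   vertex set s. *)
Definition in_simplex (V : finType) (s : {set V}) (x : {ffun V -> R}) : Prop :=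
  [/\ forall v, 0 <= x v, \sum_v x v = 1 & forall v, v \notin s -> x v = 0].

Definition realization (K : complex) (x : {ffun vert K -> R}) : Prop :=
  exists2 s, s \in K & in_simplex s x.

Definition combination (W V : finType) (t : {ffun W -> R})
    (pos : W -> {ffun V -> R}) : {ffun V -> R} :=
  [ffun v => \sum_w t w * pos w v].

Definition hull (W V : finType) (pos : W -> {ffun V -> R}) (a : {set W})
    (x : {ffun V -> R}) : Prop :=
  exists2 t, in_simplex a t & x = combination t pos.

Definition affinely_independent (W V : finType) (pos : W -> {ffun V -> R})
    (a : {set W}) : Prop :=
  forall c : {ffun W -> R}, (forall w, w \notin a -> c w = 0) ->
    \sum_w c w = 0 -> combination c pos = [ffun=> 0] -> c = [ffun=> 0].

(* A, with its vertices placed at the points pos w, is a geometric simplicial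
   complex in the space of functions vert K -> R, with |A| = |K| and every
   simplex of A contained in a simplex of K.  Since hull pos set0 is empty, the
   second clause also makes disjoint simplices of A disjoint as subspaces. *)
Definition subdivision (K A : complex) (pos : vert A -> {ffun vert K -> R}) :
    Prop :=
  [/\ forall a, a \in A -> affinely_independent pos a,
      forall a b, a \in A -> b \in A -> forall x,
        hull pos a x -> hull pos b x -> hull pos (a :&: b) x,
      forall a, a \in A -> exists2 s, s \in K &
        forall x, hull pos a x -> in_simplex s x
    & forall x, realization x <-> exists2 a, a \in A & hull pos a x].

(* Only the values of f on |K| are relevant.  Continuity on |K| is automatic:
   f is affine on each of finitely many closed simplices covering |K|. *)
Definition pl_map (K L : complex)
    (f : {ffun vert K -> R} -> {ffun vert L -> R}) : Prop :=
  (forall x, realization x -> realization (f x)) /\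
  exists (A : complex) (pos : vert A -> {ffun vert K -> R}),
    subdivision pos /\
    forall a t, a \in A -> in_simplex a t ->
      f (combination t pos) = combination t (fun w => f (pos w)).

Definition pl_homeomorphic (K L : complex) : Prop :=
  exists (f : {ffun vert K -> R} -> {ffun vert L -> R})
         (g : {ffun vert L -> R} -> {ffun vert K -> R}),
    [/\ pl_map f, pl_map g,
        forall x, realization x -> g (f x) = x
      & forall y, realization y -> f (g y) = y].

Definition combinatorial_sphere (n : nat) (K : complex) : Prop :=
  pl_homeomorphic K (bd_simplex n).

(* The sphere and the manifold of dimension -1 are empty. *)
Definition combinatorial_manifold (n : nat) (K : complex) : Prop :=
  forall v : vert K,
    if n is m.+1 then combinatorial_sphere m (link v)
    else link v = set0 :> {set {set _}}.

Definition singular_manifold (n : nat) (K : complex) : Prop :=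
  forall v : vert K,
    if n is m.+1 then combinatorial_manifold m (link v)
    else link v = set0 :> {set {set _}}.

(* The subcomplex of the boundary of the (n+1)-simplex made of the n-simplices
   opposite to the vertices in S, and their faces. *)
Definition facets_part (n : nat) (S : {set 'I_n.+2}) : {set {set 'I_n.+2}} :=
  [set s | (s != set0) && [exists i in S, s \subset [set~ i]]].

(* The faces of the (n-1)-simplices of X lying in exactly one n-simplex of X;
   a k-simplex has k + 1 vertices. *)
Definition boundary (n : nat) (U : finType) (X : {set {set U}}) :
    {set {set U}} :=
  [set s | (s != set0) &&
    [exists t in X, [&& s \subset t, #|t| == n &
      #|[set u in X | (t \subset u) && (#|u| == n.+1)]| == 1%N]]].

(* K and K' are placed, by f and f', in a common set U of vertices, where
   K = L \cup P and K' = L \cup Q; here P and Q, copies of complementary parts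
   of the boundary of an (n+1)-simplex, each meet L exactly in their common
   boundary.  In particular a simplex of Q outside the boundary (such as a
   newly introduced vertex) was not in K. *)
Definition bistellar_move (n p q : nat) (K K' : complex) : Prop :=
  [/\ (0 < p)%N, (0 < q)%N & (p + q = n + 2)%N] /\
  exists (S : {set 'I_n.+2}) (U : finType) (L : {set {set U}})
         (h : 'I_n.+2 -> U) (f : vert K -> U) (f' : vert K' -> U),
    let P := facets_part S in
    let Q := facets_part (~: S) in
    [/\ #|S| = p, subcomplex L, injective h, injective f & injective f'] /\
    [/\ L :&: im_simplices h P = im_simplices h (boundary n P),
        L :&: im_simplices h Q = im_simplices h (boundary n Q),
        im_simplices f K = L :|: im_simplices h P
      & im_simplices f' K' = L :|: im_simplices h Q].

Inductive bistellar_equivalent (n : nat) : complex -> complex -> Prop :=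
| bistellar_iso K K' : isomorphic K K' -> bistellar_equivalent n K K'
| bistellar_step p q K K' K'' :
    singular_manifold n K -> singular_manifold n K' ->
    bistellar_move n p q K K' -> bistellar_equivalent n K' K'' ->
    bistellar_equivalent n K K''.

End Realization.

(* Main.v *)
From HB Require Import structures.
Require Import Defs.
From mathcomp Require Import all_boot all_order all_algebra.
From mathcomp Require Import finmap boolp reals.
From mathcomp Require Import zify ring lra.

(* A flip replaces A * dB * M by dA * B * M, where d is the boundary of a
   simplex, * the join, and A * dB * M the closed star of A; the bistellar moves
   are the flips with M = {set0}.  A flip is two stellar subdivisions, so flips
   are piecewise-linear homeomorphisms.

   Conversely, piecewise-linearly homeomorphic complexes have a common
   subdivision.  If A subdivides K, refine it by the arrangement of all the
   hyperplanes that cut out the simplices of A: a generic perturbation of the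
   convex heights sum_j |h_j| on the vertices of the arrangement induces a
   triangulation T which is regular over K and over A.  Lowering the heights
   from +oo to their final values one vertex at a time passes from K (or from A)
   to T by one flip for each circuit that is crossed.

   In a singular 4-manifold M is a sphere of dimension at most 2 for every flip
   with at least 3 vertices in A and B.  Such a flip is a chain of bistellar
   moves, by induction on 6 - |A| - |B|: M is obtained from the boundary dT of a
   simplex by a sequence of flips.  Each of these extends to a flip of the whole
   complex with more vertices, which commutes with the given flip; and
   A * dB * dT is flipped by inserting the vertices of T one at a time.  Before
   each extension M is moved to fresh vertices, so
   that no new simplex is already present. *)

Set Implicit Arguments.
Unset Strict Implicit.
Unset Printing Implicit Defensive.

Import Order.TTheory GRing.Theory Num.Theory.

Local Open Scope fset_scope.

(** The bound 3 marks how far sphere links reach. The factor M of a flip is the link of A together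
    with all but one vertex of B; it is known to be a sphere as soon as this simplex contains an
    edge, whereas the link of a vertex is just some combinatorial 3-manifold. A flip of one vertex
    against one vertex merely renames a vertex, and no circuit of a sweep has this form, because
    distinct vertices lie at distinct points.

    The sequence of flips from dT to M comes from the sweeps themselves: the links are
    piecewise-linearly homeomorphic to the boundary of a simplex, and the sweeps turn this into
    flips of arbitrary type. The flip of D against C in M extends to that of A + D against C, which
    by itself may have few vertices; but its link has the factor dB, along which it splits into
    flips with |A| + |B| + |C| + |D| - 1 vertices, more than |A| + |B|.

    Faces of regular triangulations are certified by linear functionals, so that their uniqueness,
    their covering property and their behaviour under a change of heights are all forms of linear
    programming duality. *)

Notation fs := {fset nat}.

(** * Flips of complexes on nat *)

Lemma fdisj (A B : fs) : [disjoint A & B] -> forall x, (x \in A) ==> (x \notin B).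
Proof. by move=> /fdisjointP H x; apply/implyP/H. Qed.

Lemma fsubx (A B : fs) : A `<=` B -> forall x, (x \in A) ==> (x \in B).
Proof. by move=> /fsubsetP H x; apply/implyP/H. Qed.

Lemma notin_eq (A : fs) a x : a \notin A -> (x == a) ==> (x \notin A).
Proof. by move=> H; apply/implyP => /eqP->. Qed.

Lemma in_eq (A : fs) a x : a \in A -> (x == a) ==> (x \in A).
Proof. by move=> H; apply/implyP => /eqP->. Qed.

Ltac fpush x :=
  repeat match goal with
  | H : is_true (fsubset _ _) |- _ => move: (fsubx H x); clear H
  | H : is_true (fdisjoint _ _) |- _ => move: (fdisj H x); clear H
  | H : is_true (?a \notin ?A) |- _ =>
     lazymatch type of A with finset_of _ => idtac | _ => idtac end;
     first [constr_eq a x; move: H; clear H | move: (notin_eq x H); clear H]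
  | H : is_true (?a \in ?A) |- _ =>
     first [constr_eq a x; move: H; clear H | move: (in_eq x H); clear H]
  | H : ?A = ?B :> finset_of _ |- _ => move: (congr1 (fun S : fs => x \in S) H); clear H
  end.

Ltac fcase := rewrite ?inE; repeat (
  match goal with |- context [?a \in ?A] =>
     lazymatch A with context [_ \in _] => fail | _ => idtac end;
     case: (a \in A) end; rewrite ?orbT ?andbT ?orbF ?andbF /=);
  repeat (match goal with |- context [?a == ?b] => case: (a == b) end; rewrite ?orbT ?andbT ?orbF ?andbF /=); by [].

(* Pointwise truth tables for inclusions, disjointness and equalities of finite
   sets, from the hypotheses of the same kinds. *)
Ltac fsd :=
  let x := fresh "x" in
  match goal with
  | |- is_true (fsubset _ _) => apply/fsubsetP => x; apply/implyP
  | |- is_true (fdisjoint _ _) => apply/fdisjointP => x; apply/implyP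
  | |- @eq _ _ _ => apply/fsetP => x
  end; fpush x; fcase.

(* Unlike in [complex], the empty simplex is a simplex. *)
Definition cpx := fs -> Prop.

Lemma cpx_ext (K L : cpx) : (forall s, K s <-> L s) -> K = L.
Proof. by move=> H; apply/predeqP. Qed.

Record iscpx (K : cpx) : Prop := IsCpx {
  cpx0 : K fset0;
  cpx_sub : forall s t, K s -> t `<=` s -> K t;
  cpx_fin : exists n, forall s x, K s -> x \in s -> (x < n)%N }.

Definition flip (A B : fs) (K : cpx) : cpx := fun s =>
  (K s /\ ~~ (A `<=` s)) \/ [/\ B `<=` s, ~~ (A `<=` s) & K (s `\` B `|` A)].

(* By flip_link, the link of A is dB * M for some M. *)
Record flip_ok (A B : fs) (K : cpx) : Prop := FlipOk {
  flip_A0 : A != fset0;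
  flip_B0 : B != fset0;
  flip_dis : [disjoint A & B];
  flip_A : K A;
  flip_B : ~ K B;
  flip_link : forall s b, K s -> A `<=` s -> b \in B -> K ((s `|` B) `\ b) }.

Lemma nsubP (A s : fs) : ~~ (A `<=` s) -> exists2 a, a \in A & a \notin s.
Proof. by move/fsubsetPn. Qed.

Lemma nsub_in (A s : fs) a : a \in A -> a \notin s -> ~~ (A `<=` s).
Proof. by move=> aA; apply: contra => /fsubsetP/(_ a aA). Qed.

Lemma nsub_dis (A s : fs) : A != fset0 -> [disjoint A & s] -> ~~ (A `<=` s).
Proof. by move=> /fset0Pn[a aA] /fdisjointP/(_ a aA); apply: nsub_in. Qed.

Section Flip.
Variables (A B : fs) (K : cpx).
Hypotheses (cK : iscpx K) (ok : flip_ok A B K).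

Lemma flip_nB s : K s -> ~~ (B `<=` s).
Proof.
by move=> Ks; apply/negP => Bs; apply: (flip_B ok); apply: cpx_sub Ks Bs.
Qed.

(** Since the link of A is dB * M, the vertices of B in s can be put back as long as s lacks some
    b. *)
Lemma flip_up s b : b \in B -> b \notin s -> K (s `\` B `|` A) -> K (s `|` A).
Proof.
move=> bB bs Ks.
have := flip_link ok Ks _ bB; rewrite fsubsetUr => /(_ isT) H.
apply: (cpx_sub cK H); have dAB := flip_dis ok; fsd.
Qed.

Lemma flip_okC : flip_ok B A (flip A B K).
Proof.
have dAB := flip_dis ok; have dBA : [disjoint B & A] by rewrite fdisjoint_sym.
split; [exact: flip_B0 ok | exact: flip_A0 ok | by [] | | |].
- right; split; [by []| exact: nsub_dis (flip_A0 ok) dAB |].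
  by rewrite fsetDv fset0U; apply: flip_A ok.
- by case=> [[_ ]|[_]]; rewrite fsubset_refl.
- move=> s a Ks Bs aA; right; split; first by fsd.
    by apply: (@nsub_in _ _ a) => //; rewrite !inE eqxx.
  case: Ks => [[Ks _]|[_ _ Ks]]; first by rewrite (negbTE (flip_nB Ks)) in Bs.
  by congr (K _): Ks; fsd.
Qed.

Lemma flipK : flip B A (flip A B K) = K.
Proof.
have dAB := flip_dis ok; have dBA : [disjoint B & A] by rewrite fdisjoint_sym.
apply: cpx_ext => s; split.
  case=> [[[[//]|[Bs]]]|[As nB]]; first by rewrite Bs.
  case=> [[Ks _]|[_ nA Ks]].
    by have := flip_nB Ks; rewrite fsubsetUr.
  have [b bB bs] := nsubP nB.
  have /(cpx_sub cK) : K (s `|` A) by apply: (flip_up bB bs); congr (K _): Ks; fsd.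
  by apply; apply: fsubsetUl.
move=> Ks; have nB := flip_nB Ks; have [As|nA] := boolP (A `<=` s); last first.
  by left; split=> //; left.
right; split=> //; right; split; first by apply: fsubsetUr.
  apply: (nsub_dis (flip_A0 ok)); fsd.
apply: (cpx_sub cK Ks); fsd.
Qed.

Lemma iscpx_flip : iscpx (flip A B K).
Proof.
have dAB := flip_dis ok; have dBA : [disjoint B & A] by rewrite fdisjoint_sym.
split.
- left; split; first exact: cpx0 cK.
  by rewrite fsubset0 (flip_A0 ok).
- move=> s t Ks ts.
  have nAt : ~~ (A `<=` s) -> ~~ (A `<=` t).
    by apply: contra => /fsubset_trans; apply.
  case: Ks => [[Ks nA]|[Bs nA Ks]]; first by left; split; [apply: cpx_sub Ks ts|auto].
  have [Bt|nB] := boolP (B `<=` t); last first.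
    left; split; last by auto.
    have [b bB bt] := nsubP nB.
    have /(cpx_sub cK) : K (t `|` A); last by apply; apply: fsubsetUl.
    by apply: (flip_up bB bt); apply: (cpx_sub cK Ks); fsd.
  by right; split; [|auto|apply: (cpx_sub cK Ks); fsd].
- have [n Hn] := cpx_fin cK.
  have [m Hm] : exists m, forall x, x \in B -> (x < m)%N.
    exists (\max_(x <- B) x).+1 => x xB.
    by rewrite ltnS; apply: leq_bigmax_seq.
  exists (maxn n m) => s x [[Ks _]|[_ _ Ks]] xs.
    by rewrite leq_max (Hn _ _ Ks xs).
  have [xB|nB] := boolP (x \in B); first by rewrite leq_max (Hm _ xB) orbT.
  by rewrite leq_max (Hn _ x Ks) // !inE nB xs.
Qed.

End Flip.

(** * Links in a flipped complex *)

Definition lk (e : fs) (K : cpx) : cpx := fun s => [disjoint s & e] /\ K (s `|` e).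

Lemma lk_lk e f K : [disjoint e & f] -> lk f (lk e K) = lk (e `|` f) K.
Proof.
move=> d; apply: cpx_ext => s; rewrite /lk; split.
  move=> [d1 [d2 Ks]]; split; first by fsd.
  by congr (K _): Ks; fsd.
move=> [d1 Ks]; do ?split; try by fsd.
by congr (K _): Ks; fsd.
Qed.

Definition bd (t : fs) : cpx := fun s => s `<=` t /\ ~~ (t `<=` s).
(* The join of bd A with M. *)
Definition jbd (A : fs) (M : cpx) : cpx := fun s => ~~ (A `<=` s) /\ M (s `\` A).

Section LinkFlip.
Variables (A B : fs) (K : cpx).
Hypotheses (cK : iscpx K) (ok : flip_ok A B K).
Variable e : fs.
Hypothesis Ke : flip A B K e.

Let nAe : ~~ (A `<=` e).
Proof. by case: Ke => [[]|[]]. Qed.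

Lemma flip_old : ~~ (B `<=` e) -> K e.
Proof. by move=> nB; case: Ke => [[]|[Be]] //; rewrite Be in nB. Qed.

(** A flip only changes the closed star of A; here e spans no simplex with A. *)
Lemma lk_flip_far : ~~ (B `<=` e) -> ~ K (A `|` e) -> lk e (flip A B K) = lk e K.
Proof.
move=> nB nK; apply: cpx_ext => s; split=> -[d Ks]; split=> //.
  case: Ks => [[]|[Bs nA Ks]] //; case: nK.
  have [b bB be] := nsubP nB.
  rewrite fsetUC; apply: (flip_up cK ok bB be); apply: (cpx_sub cK Ks); fsd.
left; split=> //; apply/negP => As; apply: nK; apply: (cpx_sub cK Ks); fsd.
Qed.

(** Here e is an old simplex that is joinable with A, and the flip induces one in its link, between
    the parts of A and B outside e. *)
Lemma lk_flip_near : ~~ (B `<=` e) -> K (A `|` e) ->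
  flip_ok (A `\` e) (B `\` e) (lk e K) /\
  lk e (flip A B K) = flip (A `\` e) (B `\` e) (lk e K).
Proof.
move=> nB KAe; have dAB := flip_dis ok; split.
  split.
  - by rewrite fsetD_eq0.
  - by rewrite fsetD_eq0.
  - fsd.
  - split; first by fsd.
    apply: (cpx_sub cK KAe); fsd.
  - case=> _ KB; apply: (flip_B ok); apply: (cpx_sub cK KB); fsd.
  - move=> s b [d Ks] As bB; split; first by fsd.
    have bB' : b \in B by move: bB; rewrite inE => /andP[].
    have be : b \notin e by move: bB; rewrite inE => /andP[].
    have As' : A `<=` s `|` e by fsd.
    by apply: (cpx_sub cK (flip_link ok Ks As' bB')); fsd.
have eA s : (A `<=` s `|` e) = (A `\` e `<=` s) by rewrite fsetUC -fsubDset.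
have eB s : (B `<=` s `|` e) = (B `\` e `<=` s) by rewrite fsetUC -fsubDset.
apply: cpx_ext => s; split.
  move=> [d [[Ks nA]|[Bs nA Ks]]]; first by left; rewrite -eA.
  right; split; rewrite -?eA -?eB //; split; first by fsd.
  have [b bB be] := nsubP nB.
  have /(cpx_sub cK) : K (((s `|` e) `\` B `|` A `|` B) `\ b).
    by apply: (flip_link ok) => //; apply: fsubsetUr.
  apply.
  have bA : b \notin A by move/fdisjointP_sym: dAB; apply.
  have bs : ~~ (b \in s `\` (B `\` e)) by rewrite !inE (negbTE be) bB.
  fsd.
case=> [[[d Ks] nA]|[Bs nA [d Ks]]].
  by split=> //; left; rewrite eA.
have d' : [disjoint s & e].
  have [b bB be] := nsubP nB; fsd.
split=> //; right; rewrite eA eB; split=> //.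
apply: (cpx_sub cK Ks); fsd.
Qed.

(** A simplex e containing B is new and has its star in dA * B * M, so its link is the join of d(A -
    e) with the link in M of the part of e outside A and B. The latter is read off in the old
    complex as the link of A + e - b, since A + (B - b) has link M. *)
Lemma lk_flip_new b : B `<=` e -> b \in B ->
  K ((A `|` e) `\ b) /\
  lk e (flip A B K) = jbd (A `\` e) (lk ((A `|` e) `\ b) K).
Proof.
move=> Be bB; have dAB := flip_dis ok.
have be : b \in e by exact: (fsubsetP Be).
have bA : b \notin A by move/fdisjointP_sym: dAB; apply.
have KA : K (e `\` B `|` A).
  case: Ke => [[K1 _]|[]] //; by have := flip_nB cK ok K1; rewrite Be.
split.
  have := flip_link ok KA (fsubsetUr _ _) bB; congr (K _); fsd.
apply: cpx_ext => s; split.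
  move=> [d Ks]; case: Ks => [[Ks nA]|[Bs nA Ks]].
    have /negP := flip_nB cK ok Ks; case; fsd.
  split; first by rewrite fsubDset fsetUC.
  split; first by fsd.
  have H := flip_link ok Ks (fsubsetUr _ _) bB.
  apply: (cpx_sub cK H); fsd.
move=> [nA [d Ks]].
have bs : b \notin s.
  apply/negP => bs; have /negP := flip_nB cK ok Ks; case; fsd.
have ds : [disjoint s & e] by fsd.
split=> //; right; split; first by fsd.
  by rewrite fsetUC -fsubDset.
apply: (cpx_sub cK Ks); fsd.
Qed.

End LinkFlip.

(** * Renaming vertices *)

Definition mapc (f : nat -> nat) (K : cpx) : cpx := fun s => exists2 t, K t & s = f @` t.

Lemma fimset_comp (f g : nat -> nat) (s : fs) : f @` (g @` s) = (f \o g) @` s.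
Proof.
apply/fsetP => x; apply/imfsetP/imfsetP => [[y /imfsetP[z zs ->] ->]|[y ys ->]].
  by exists z.
by exists (g y) => //; apply/imfsetP; exists y.
Qed.

Lemma mapc_comp f g K : mapc f (mapc g K) = mapc (f \o g) K.
Proof.
apply: cpx_ext => s; split.
  by case=> _ [t Kt ->] ->; exists t; rewrite ?fimset_comp.
by case=> t Kt ->; exists (g @` t); rewrite ?fimset_comp //; exists t.
Qed.

Lemma fimset_eq_in (f g : nat -> nat) (s : fs) : {in s, f =1 g} -> f @` s = g @` s.
Proof. by move=> H; apply: eq_in_imfset. Qed.

Lemma mapc_eq f g K : (forall s x, K s -> x \in s -> f x = g x) -> mapc f K = mapc g K.
Proof.
move=> H; apply: cpx_ext => s; split=> -[t Kt ->]; exists t => //;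
  by apply: fimset_eq_in => x xt; rewrite (H t).
Qed.

Lemma mapc_id K : mapc id K = K.
Proof.
apply: cpx_ext => s; split; first by case=> t Kt ->; rewrite imfset_id.
by exists s; rewrite ?imfset_id.
Qed.

Section Inj.
Variable f : nat -> nat.
Hypothesis fI : injective f.

Lemma im_in (s : fs) x : (f x \in f @` s) = (x \in s).
Proof. by apply: mem_imfset. Qed.

Lemma im_sub (s t : fs) : (f @` s `<=` f @` t) = (s `<=` t).
Proof.
apply/fsubsetP/fsubsetP => H x.
  by move=> xs; rewrite -im_in; apply: H; rewrite im_in.
by case/imfsetP => y /H ty ->; rewrite im_in.
Qed.

Lemma im_inj : injective (fun s : fs => f @` s).
Proof. by move=> s t /fsetP E; apply/fsetP => x; rewrite -im_in E im_in. Qed.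

Lemma im_D (s t : fs) : f @` (s `\` t) = f @` s `\` f @` t.
Proof.
apply/fsetP => x; rewrite !inE; apply/imfsetP/andP.
  by case=> y; rewrite !inE => /andP[y1 y2] ->; rewrite !im_in.
case=> n /imfsetP[y ys E]; exists y => //; rewrite !inE ys andbT.
by move: n; rewrite E im_in.
Qed.

Lemma im_D1 (s : fs) x : f @` (s `\ x) = f @` s `\ f x.
Proof. by rewrite im_D imfset_fset1. Qed.

Lemma im_dis (s t : fs) : [disjoint f @` s & f @` t] = [disjoint s & t].
Proof.
apply/fdisjointP/fdisjointP => H x; first by move=> xs; rewrite -im_in H // im_in.
by case/imfsetP=> y /H yt ->; rewrite im_in.
Qed.

Lemma im_neq0 (s : fs) : (f @` s != fset0) = (s != fset0).
Proof. by rewrite -!cardfs_gt0 card_imfset. Qed.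

Lemma im_preim (s t : fs) : s `<=` f @` t -> exists2 u, u `<=` t & s = f @` u.
Proof.
move=> H; exists [fset x in t | f x \in s].
  by apply/fsubsetP=> x; rewrite !inE => /andP[].
apply/fsetP => x; apply/idP/imfsetP => [xs|[y]]; last first.
  by rewrite !inE => /andP[_ ?] ->.
have /imfsetP[y yt E] := fsubsetP H _ xs.
by exists y => //; rewrite !inE yt -E.
Qed.

Lemma mapc_in K s : mapc f K (f @` s) <-> K s.
Proof.
by split=> [[t Kt /im_inj->]|Ks] //; exists s.
Qed.

Lemma mapc_bd t : mapc f (bd t) = bd (f @` t).
Proof.
apply: cpx_ext => s; split.
  by case=> u [u1 u2] ->; rewrite /bd !im_sub.
by case=> /im_preim[u ut ->]; rewrite im_sub => nt; exists u.
Qed.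

Lemma mapc_flip A B K : mapc f (flip A B K) = flip (f @` A) (f @` B) (mapc f K).
Proof.
apply: cpx_ext => s; split.
  case=> t H ->; case: H => [[Kt nA]|[Bt nA Kt]].
    by left; rewrite im_sub; split=> //; exists t.
  by right; rewrite !im_sub -im_D // -imfsetU; split=> //; exists (t `\` B `|` A).
case=> [[[t Kt ->]]|[Bs nA [t Kt E]]].
  by rewrite im_sub => nA; exists t => //; left.
have [u ut Eu] : exists2 u, u `<=` t `|` B & s = f @` u.
  apply: im_preim; rewrite imfsetU; apply/fsubsetP=> x xs.
  move/fsetP/(_ x): E; rewrite !inE xs andbT; case: (x \in f @` B) => //=.
    by rewrite orbT.
  by rewrite orbF => <-.
exists u => //; right; split.
- by rewrite -im_sub -Eu.
- by rewrite -im_sub -Eu.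
- have -> // : u `\` B `|` A = t.
  by apply: im_inj; rewrite imfsetU im_D -Eu.
Qed.

Lemma flip_ok_map A B K : flip_ok A B K -> flip_ok (f @` A) (f @` B) (mapc f K).
Proof.
case=> A0 B0 d KA KB kl; split; rewrite ?im_neq0 ?im_dis //.
- by exists A.
- by move/mapc_in.
- move=> s b [t Kt ->]; rewrite im_sub => At /imfsetP[c cB ->].
  rewrite -imfsetU -im_D1; exists ((t `|` B) `\ c) => //; exact: kl.
Qed.
End Inj.

Lemma iscpx_map f K : iscpx K -> iscpx (mapc f K).
Proof.
move=> cK; split.
- by exists fset0; rewrite ?imfset0 //; apply: cpx0 cK.
- move=> s t [u Ku ->] ts; exists [fset x in u | f x \in t].
    apply: (cpx_sub cK Ku); by apply/fsubsetP=> x; rewrite !inE => /andP[].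
  apply/fsetP => x; apply/idP/imfsetP => [xs|[y]]; last first.
    by rewrite !inE => /andP[_ ?] ->.
  have /imfsetP[y yt E] := fsubsetP ts _ xs.
  by exists y => //; rewrite !inE yt -E.
- have [n Hn] := cpx_fin cK.
  exists (\max_(i < n) f i).+1 => s x [t Kt ->] /imfsetP[y yt ->].
  by rewrite ltnS (leq_bigmax (Ordinal (Hn _ _ Kt yt))).
Qed.

(* The combinatorial (j-1)-spheres: j is the number of vertices of a facet. *)
Inductive Sph : nat -> cpx -> Prop :=
| Sph_bd j t : #|` t| = j.+1 -> Sph j (bd t)
| Sph_flip j A B K : Sph j K -> flip_ok A B K -> Sph j (flip A B K).

Lemma iscpx_bd t : t != fset0 -> iscpx (bd t).
Proof.
move=> t0; split.
- by split; [apply: fsub0set|rewrite fsubset0].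
- move=> s u [st nt] us; split; first by apply: fsubset_trans st.
  by apply: contra nt => /fsubset_trans; apply.
- exists (\max_(x <- t) x).+1 => s x [st _] xs.
  by rewrite ltnS; apply: leq_bigmax_seq => //; apply: (fsubsetP st).
Qed.

Lemma Sph_cpx j K : Sph j K -> iscpx K.
Proof.
elim=> {j K} [j t Et|j A B K _ cK ok]; last exact: iscpx_flip.
by apply: iscpx_bd; rewrite -cardfs_gt0 Et.
Qed.

Lemma Sph_map f j K : injective f -> Sph j K -> Sph j (mapc f K).
Proof.
move=> fI; elim=> {j K} [j t Et|j A B K _ IH ok].
  by rewrite mapc_bd //; apply: Sph_bd; rewrite card_imfset.
by rewrite mapc_flip //; apply: Sph_flip => //; apply: flip_ok_map.
Qed.

Lemma Sph0 K : Sph 0 K -> K = (fun s => s = fset0).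
Proof.
move E: 0%N => j H; elim: H E => {j K} [j t Et|j A B K _ IH ok] E.
  move: Et; rewrite -E => /eqP/cardfs1P[x ->]; apply: cpx_ext => s; split.
    case; rewrite fsubset1 => /orP[/eqP->|/eqP->] //; by rewrite fsubset_refl.
  by move=> ->; split; [apply: fsub0set|rewrite fsubset0; apply/fset0Pn; exists x; rewrite inE].
have KA := flip_A ok; have := flip_A0 ok.
by rewrite IH // in KA; rewrite KA eqxx.
Qed.

Lemma jbd_flip P A B K : P != fset0 -> [disjoint P & A `|` B] ->
  jbd P (flip A B K) = flip A B (jbd P K).
Proof.
move=> P0 d; have sA s : (A `<=` s `\` P) = (A `<=` s).
  by apply/idP/idP => H; fsd.
have sB s : (B `<=` s `\` P) = (B `<=` s) by apply/idP/idP => H; fsd.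
have sP s : (P `<=` s `\` B `|` A) = (P `<=` s) by apply/idP/idP => H; fsd.
have E s : (s `\` B `|` A) `\` P = (s `\` P) `\` B `|` A by fsd.
apply: cpx_ext => s; rewrite /jbd /flip sA sB sP E.
split=> [[a [[b c]|[b c e]]]|[[[a b] c]|[a b [c e]]]].
- by left.
- by right.
- by split=> //; left.
- by split=> //; right.
Qed.

Lemma jbd_flip_ok P A B K : P != fset0 -> [disjoint P & A `|` B] ->
  flip_ok A B K -> flip_ok A B (jbd P K).
Proof.
move=> P0 d [A0 B0 dAB KA KB kl].
have PA : ~~ (P `<=` A) by apply: nsub_dis => //; fsd.
have EA : A `\` P = A by fsd.
have EB : B `\` P = B by fsd.
split=> //; first by split; rewrite ?EA.
  by case; rewrite EB.
move=> s b [nP Ks] As bB; split.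
  apply: contra nP => H; fsd.
have As' : A `<=` s `\` P by fsd.
have := kl _ _ Ks As' bB; congr (K _); fsd.
Qed.

(** Starring the face P of the boundary of the simplex P + (t - x) at the new vertex x gives dP *
    dt, because the link of P there is d(t - x). *)
Lemma jbd_bd (P t : fs) x : P != fset0 -> [disjoint P & t] -> x \in t -> t `\ x != fset0 ->
  flip_ok P [fset x] (bd (P `|` (t `\ x))) /\
  jbd P (bd t) = flip P [fset x] (bd (P `|` (t `\ x))).
Proof.
move=> P0 d xt t0.
have xP : x \notin P by move/fdisjointP_sym: d; apply.
have nP : ~~ (P `|` (t `\ x) `<=` P).
  case/fset0Pn: t0 => y yt; apply/negP => H.
  have yP : y \in P by apply: (fsubsetP H); rewrite inE yt orbT.
  by move: yt; rewrite !inE; move/fdisjointP/(_ _ yP): d => /negbTE->; rewrite andbF.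
split.
  split=> //; first by apply/fset0Pn; exists x; rewrite inE.
  - fsd.
  - by split=> //; apply: fsubsetUl.
  - by case; rewrite fsub1set !inE eqxx /= (negbTE xP).
  - move=> s b [sP nPs] Ps; rewrite inE => /eqP ->.
    have -> : (s `|` [fset x]) `\ x = s by fsd.
    by split.
apply: cpx_ext => s; split.
  case=> nPs [s1 s2]; have [xs|xs] := boolP (x \in s); [right|left]; split=> //.
  - by rewrite fsub1set.
  - split; first by fsd.
    apply: contra s2 => H; fsd.
  - split; first by fsd.
    by apply: contra nPs => H; fsd.
case=> [[[s1 s2] nPs]|[xs nPs [s1 s2]]]; split=> //; split.
- fsd.
- apply/negP => H; have : x \in s `\` P by apply: (fsubsetP H).
  rewrite inE => /andP[_ xs]; have := fsubsetP s1 _ xs.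
  by rewrite !inE eqxx /= (negbTE xP).
- rewrite fsub1set in xs; fsd.
- apply: contra s2 => H; fsd.
Qed.

Lemma jbd_0 (P t : fs) x : t = [fset x] -> jbd P (bd t) = bd P.
Proof.
move=> ->; apply: cpx_ext => s; split.
  case=> nP [s1]; rewrite fsub1set => s2; split=> //; fsd.
case=> s1 nP; split=> //; have -> : s `\` P = fset0 by fsd.
by split; rewrite ?fsub0set // fsub1set.
Qed.

(** The induction runs along the flips that produce M, and intermediate spheres may use vertices of
    P even if M does not. Shifting all of them beyond N keeps every stage disjoint from P. *)
Lemma Sph_join_far j M P N : Sph j M -> P != fset0 -> (forall x, x \in P -> x < N)%N ->
  Sph (#|` P|.-1 + j) (jbd P (mapc (addn^~ N) M)).
Proof.
move=> SM P0 PN; have fI : injective (addn^~ N) by move=> x y /addIn.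
have dP (t : fs) : [disjoint P & (addn^~ N) @` t].
  apply/fdisjointP => x /PN xN; apply/negP => /imfsetP[y _ E].
  by move: xN; rewrite E; lia.
elim: SM => {j M} [j t Et|j A B K _ IH ok].
  rewrite mapc_bd //; set u := _ @` t.
  have Eu : #|` u| = j.+1 by rewrite card_imfset.
  have [x xu] : exists x, x \in u by apply/fset0Pn; rewrite -cardfs_gt0 Eu.
  case: j Et Eu => [|j] Et Eu.
    have /cardfs1P[y Ey] : #|` u| == 1 by rewrite Eu.
    rewrite (jbd_0 _ Ey) addn0; apply: Sph_bd.
    by rewrite prednK // cardfs_gt0.
  have u0 : u `\ x != fset0.
    by rewrite -cardfs_gt0; move: Eu; rewrite (cardfsD1 x) xu; lia.
  have [ok ->] := jbd_bd P0 (dP t) xu u0.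
  apply: Sph_flip => //; apply: Sph_bd.
  have dPu : [disjoint P & u `\ x] by have := dP t; rewrite -/u => ?; fsd.
  rewrite cardfsU; move: dPu; rewrite /fdisjoint => /eqP->; rewrite cardfs0 subn0.
  have Eu1 : #|` u `\ x| = j.+1 by move: Eu; rewrite (cardfsD1 x u) xu => -[].
  rewrite Eu1; have : (0 < #|` P|)%N by rewrite cardfs_gt0.
  by case: #|` P| => // p _; rewrite /= addSn.
rewrite mapc_flip // jbd_flip //; last by rewrite -imfsetU.
apply: Sph_flip => //; apply: jbd_flip_ok => //; first by rewrite -imfsetU.
exact: flip_ok_map.
Qed.

Lemma mapc_jbd f P M : injective f -> mapc f (jbd P M) = jbd (f @` P) (mapc f M).
Proof.
move=> fI; apply: cpx_ext => s; split.
  case=> t [nP Mt] ->; rewrite /jbd im_sub // -im_D //; split=> //.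
  by exists (t `\` P).
case=> nP [u Mu E].
have [w wu Ew] : exists2 w, w `<=` u `|` P & s = f @` w.
  apply: im_preim; rewrite imfsetU -E; fsd.
exists w => //; split; first by rewrite -(im_sub fI) -Ew.
by have -> : w `\` P = u by apply: (im_inj fI); rewrite im_D // -Ew.
Qed.

Lemma fs_bound (P : fs) : exists n, forall x, x \in P -> (x < n)%N.
Proof.
by exists (\max_(x <- P) x).+1 => x xP; rewrite ltnS; apply: leq_bigmax_seq.
Qed.

Lemma cpx_vert K s x : iscpx K -> K s -> x \in s -> K [fset x].
Proof. by move=> cK Ks xs; apply: (cpx_sub cK Ks); rewrite fsub1set. Qed.

Lemma Sph_join j M P : Sph j M -> P != fset0 -> (forall s, M s -> [disjoint P & s]) ->
  Sph (#|` P|.-1 + j) (jbd P M).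
Proof.
move=> SM P0 dP; have cM := Sph_cpx SM.
have [n1 Hn1] := cpx_fin cM; have [n2 Hn2] := fs_bound P.
pose N := (n1 + n2)%N.
have HM s x : M s -> x \in s -> (x < N)%N by move=> Ms xs; have := Hn1 _ _ Ms xs; rewrite /N; lia.
have HP x : x \in P -> (x < N)%N by move=> /Hn2; rewrite /N; lia.
pose M1 y := `[< M [fset y] >].
have M1N y : M1 y -> (y < N)%N by move/asboolP => My; apply: (HM _ _ My); rewrite inE.
(* The involution exchanging y with y + N for the vertices y of M: it undoes the shift of
   [Sph_join_far] and fixes P, which lies below N and avoids M. *)
pose g y := if M1 y then (y + N)%N else if (N <= y)%N && M1 (y - N)%N then (y - N)%N else y.
have gK : involutive g.
  move=> y; have [My|My] := boolP (M1 y).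
    have -> : g y = (y + N)%N by rewrite /g My.
    rewrite /g; have -> : M1 (y + N)%N = false by apply/negP => /M1N; lia.
    by rewrite leq_addl addnK My.
  have [/andP[Ny My']|nM] := boolP ((N <= y)%N && M1 (y - N)%N).
    have -> : g y = (y - N)%N by rewrite /g (negbTE My) Ny My'.
    by rewrite /g My' subnK.
  have E : g y = y by rewrite /g (negbTE My) (negbTE nM).
  by rewrite !E.
have gI := inv_inj gK.
have := Sph_map gI (Sph_join_far SM P0 HP).
rewrite mapc_jbd // mapc_comp.
have -> : g @` P = P.
  rewrite -[RHS]imfset_id; apply: fimset_eq_in => x xP; rewrite /g.
  have -> : M1 x = false.
    apply/negP => /asboolP Mx; have /fdisjointP/(_ x xP) := dP _ Mx.
    by rewrite inE eqxx.
  by case: ifP => // /andP[Nx _]; have := HP _ xP; lia.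
rewrite (@mapc_eq _ id) ?mapc_id // => s x Ms xs /=; rewrite /g.
have -> : M1 (x + N)%N = false by apply/negP => /M1N; lia.
rewrite leq_addl addnK.
by have -> : M1 x by apply/asboolP; apply: cpx_vert xs.
Qed.

Lemma lk0 K : lk fset0 K = K.
Proof.
by apply: cpx_ext => s; rewrite /lk fsetU0; split=> [[]|] //; split=> //; apply: fdisjointX0.
Qed.

Lemma Sph_link j K e : Sph j K -> K e -> (#|` e| <= j)%N /\ Sph (j - #|` e|) (lk e K).
Proof.
elim/ltn_ind: j K e => j IHj K e SK Ke.
have [->|e0] := eqVneq e fset0; first by rewrite cardfs0 lk0 subn0.
case: j IHj SK => [|j] IHj SK.
  by move: Ke e0; rewrite (Sph0 SK) => ->; rewrite eqxx.
(* Vertex links suffice: the link of e is the link of e - x in the link of x, a sphere of lower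
   dimension. *)
suff VL : forall x, K [fset x] -> Sph j (lk [fset x] K).
  have /fset0Pn[x xe] := e0; have Ex : e = [fset x] `|` (e `\ x) by fsd.
  have cK := Sph_cpx SK.
  have d : [disjoint [fset x] & e `\ x] by fsd.
  have Kx : K [fset x] by apply: cpx_vert xe.
  have le : lk [fset x] K (e `\ x).
    by split; [fsd | rewrite fsetUC -Ex].
  have [c1 c2] := IHj j (ltnSn _) _ _ (VL _ Kx) le.
  have ce : #|` e| = (#|` e `\ x|).+1 by rewrite (cardfsD1 x e) xe.
  by rewrite ce ltnS subSS; split=> //; have -> : lk e K = lk (e `\ x) (lk [fset x] K) by rewrite lk_lk // -Ex.
clear Ke e0 e; move Ek: j.+1 SK => k SK.
elim: SK Ek => {k K} [k t Et|k A B K SK IH ok] Ek x.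
  case; rewrite fsub1set => xt nt.
  have -> : lk [fset x] (bd t) = bd (t `\ x).
    apply: cpx_ext => s; split.
      case=> d [s1 s2]; split; first by fsd.
      apply: contra s2 => H; fsd.
    case=> s1 s2; split; first by fsd.
    split; first by fsd.
    by apply: contra s2 => H; fsd.
  by apply: Sph_bd; move: Et; rewrite (cardfsD1 x t) xt -Ek => -[].
move=> K'x; subst k; have cK := Sph_cpx SK.
have [Bx|nB] := boolP (B `<=` [fset x]); last first.
  have Kx := flip_old K'x nB.
  case: (pselect (K (A `|` [fset x]))) => KA; last by rewrite lk_flip_far //; apply: IH.
  have [ok' ->] := lk_flip_near cK ok K'x nB KA.
  by apply: Sph_flip => //; apply: IH.
(* Here x is the vertex created by the flip. Its link is the join of dA with the link of A, and the
   latter is a sphere by the outer induction, applied to the link of a vertex of A. *)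
have BE : B = [fset x].
  have /fset0Pn[y yB] := flip_B0 ok; apply/eqP; rewrite eqEfsubset Bx fsub1set /=.
  by have := fsubsetP Bx _ yB; rewrite inE => /eqP <-.
have xB : x \in B by rewrite BE inE.
have [_ ->] := lk_flip_new cK ok K'x Bx xB.
have dAB := flip_dis ok.
have -> : A `\` [fset x] = A by fsd.
have -> : (A `|` [fset x]) `\ x = A by fsd.
have /fset0Pn[a aA] := flip_A0 ok; have KA := flip_A ok.
have Ea : A = [fset a] `|` (A `\ a) by fsd.
have da : [disjoint [fset a] & A `\ a] by fsd.
have Ka : K [fset a] by apply: cpx_vert aA.
have le : lk [fset a] K (A `\ a) by split; [fsd|rewrite fsetUC -Ea].
have [c1 c2] := IHj j (ltnSn _) _ _ (IH (erefl _) _ Ka) le.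
have -> : j = (#|` A|.-1 + (j - #|` A `\ a|))%N.
  by rewrite (cardfsD1 a A) aA add1n /= subnKC.
apply: Sph_join; [|exact: flip_A0 ok|by move=> s []; rewrite fdisjoint_sym].
by have -> : lk A K = lk (A `\ a) (lk [fset a] K) by rewrite lk_lk // -Ea.
Qed.

(* The singular combinatorial 4-manifolds: the link of an edge is a 2-sphere
   (see sing4_manifold). *)
Definition sing4 (K : cpx) := iscpx K /\ forall e, #|` e| = 2 -> K e -> Sph 3 (lk e K).

Lemma sub2 (e : fs) : (2 <= #|` e|)%N -> exists f, f `<=` e /\ #|` f| = 2.
Proof.
move=> c; have /fset0Pn[x xe] : e != fset0 by rewrite -cardfs_gt0; lia.
have /fset0Pn[y] : e `\ x != fset0.
  by rewrite -cardfs_gt0; move: c; rewrite (cardfsD1 x e) xe; lia.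
rewrite !inE => /andP[yx ye]; exists [fset x; y]; rewrite cardfs2 eq_sym yx; split=> //.
by apply/fsubsetP => z; rewrite !inE => /orP[/eqP->|/eqP->].
Qed.

Lemma sing4_link K e : sing4 K -> K e -> (2 <= #|` e|)%N ->
  (#|` e| <= 5)%N /\ Sph (5 - #|` e|) (lk e K).
Proof.
move=> [cK H] Ke c; have [f [fe cf]] := sub2 c.
have Kf := cpx_sub cK Ke fe.
have E : e = f `|` (e `\` f) by fsd.
have d : [disjoint f & e `\` f] by fsd.
have le : lk f K (e `\` f) by split; [fsd|rewrite fsetUC -E].
have [c1 c2] := Sph_link (H _ cf Kf) le.
have ce := cardfsDS fe; rewrite lk_lk // -E ce cf in c2; rewrite ce cf in c1.
by split; [lia|move: c2; have -> : (3 - (#|` e| - 2) = 5 - #|` e|)%N by lia].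
Qed.

(** An edge of the flipped complex is old, with link unchanged or flipped, or it contains B. In the
    last case [lk_flip_new] makes its link the join of d(A - e) with the link of an old simplex that
    has at least two vertices. *)
Lemma sing4_flip A B K : sing4 K -> flip_ok A B K -> (3 <= #|` A| + #|` B|)%N -> sing4 (flip A B K).
Proof.
move=> cmK ok c3; have [cK H] := cmK; split; first exact: iscpx_flip.
move=> e ce K'e; have [Be|nB] := boolP (B `<=` e); last first.
  have Ke := flip_old K'e nB.
  case: (pselect (K (A `|` e))) => KA; last by rewrite lk_flip_far //; apply: H.
  have [ok' ->] := lk_flip_near cK ok K'e nB KA.
  by apply: Sph_flip => //; apply: H.
have /fset0Pn[b bB] := flip_B0 ok.
have [Kg ->] := lk_flip_new cK ok K'e Be bB.
have nA : ~~ (A `<=` e) by case: K'e => [[]|[]].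
have A0 : A `\` e != fset0 by rewrite fsetD_eq0.
have be : b \in e by apply: (fsubsetP Be).
have cg : #|` (A `|` e) `\ b| = (#|` A `\` e|).+1.
  have -> : (A `|` e) `\ b = (A `\` e) `|` (e `\ b).
    by have /fdisjointP_sym/(_ _ bB) := flip_dis ok; move=> bA; fsd.
  rewrite cardfsU; have -> : (A `\` e) `&` (e `\ b) = fset0 by fsd.
  by rewrite cardfs0 subn0; move: ce; rewrite (cardfsD1 b e) be; lia.
have A1 : (0 < #|` A `\` e|)%N by rewrite cardfs_gt0.
have [d1 d2] := sing4_link cmK Kg (ltac:(rewrite cg; lia)).
have {1}-> : 3 = (#|` A `\` e|.-1 + (5 - #|` (A `|` e) `\ b|))%N by rewrite cg in d1 *; lia.
apply: Sph_join => // s [d _]; have /fdisjointP_sym/(_ _ bB) := flip_dis ok; move=> bA; fsd.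
Qed.

(** * Splitting a flip along a boundary factor of the link *)

Section Split.
Variables (A B T : fs) (x : nat) (K : cpx).
Hypotheses (cK : iscpx K) (ok : flip_ok A B K) (T0 : T != fset0) (xT : x \notin T).
Hypotheses (dxT : [disjoint x |` T & A `|` B]).
Hypothesis (F1 : forall s y, K s -> A `<=` s -> y \in x |` T -> K ((s `|` (x |` T)) `\ y)).
Hypothesis (F2 : ~ K (A `|` (x |` T))).

Let xAB : x \notin A `|` B.
Proof. by move/fdisjointP: dxT; apply; rewrite !inE eqxx. Qed.
Let dT : [disjoint T & A `|` B].
Proof. fsd. Qed.
Let xin : x \in x |` T. Proof. by rewrite !inE eqxx. Qed.
Let Tin y : y \in T -> y \in x |` T. Proof. by move=> yT; rewrite !inE yT orbT. Qed.

Lemma split_ok1 : flip_ok (A `|` T) B K.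
Proof.
have dAB := flip_dis ok; split.
- by have /fset0Pn[a aA] := flip_A0 ok; apply/fset0Pn; exists a; rewrite inE aA.
- exact: flip_B0 ok.
- fsd.
- apply: (cpx_sub cK (F1 (flip_A ok) (fsubset_refl _) xin)); fsd.
- exact: flip_B ok.
- move=> s b Ks As bB; apply: (flip_link ok) => //; fsd.
Qed.

Let K1 := flip (A `|` T) B K.

Let nATs (s : fs) : ~~ (A `|` T `<=` s) -> A `<=` s -> exists2 y, y \in T & y \notin s.
Proof. by rewrite fsubUset negb_and => /orP[/negP //|/nsubP]. Qed.

Lemma split_ok2 : flip_ok A (x |` B) K1.
Proof.
have dAB := flip_dis ok; split.
- exact: flip_A0 ok.
- by apply/fset0Pn; exists x; rewrite !inE eqxx.
- fsd.
- left; split; first exact: flip_A ok.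
  have /fset0Pn[y yT] := T0; apply: (@nsub_in _ _ y); first by rewrite inE yT orbT.
  by have /fdisjointP/(_ _ yT) := dT; rewrite inE negb_or => /andP[].
- case=> [[KB _]|[_ _ KT]].
    by apply: (flip_B ok); apply: (cpx_sub cK KB); fsd.
  by apply: F2; apply: (cpx_sub cK KT); fsd.
- move=> s b K1s As; rewrite inE => bxB.
  case: K1s => [[Ks nAT]|[Bs nAT Ks]]; have [y yT ys] := nATs nAT As;
  have yAB : y \notin A `|` B by (move/fdisjointP: dT; apply).
  all: have yB : y \notin B by move: yAB; rewrite inE negb_or => /andP[].
  + move: bxB; rewrite inE => /orP[/eqP->|bB].
      right; split; first by fsd.
        apply: (@nsub_in _ _ y); first by rewrite inE yT orbT.
        have yx : y != x by apply: contraNneq xT => <-.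
        by rewrite !inE (negbTE ys) (negbTE yx) (negbTE yB).
      apply: (cpx_sub cK (F1 Ks As xin)); fsd.
    have H := F1 Ks As (Tin yT).
    have As' : A `<=` (s `|` (x |` T)) `\ y by fsd.
    left; split.
      apply: (cpx_sub cK (flip_link ok H As' bB)).
      have yx : y != x by apply: contraNneq xT => <-.
      have yx' : y \notin [fset x] by rewrite inE.
      clear - ys yx' yB; fsd.
    apply: (@nsub_in _ _ y); first by rewrite inE yT orbT.
    have yx : y != x by apply: contraNneq xT => <-.
    by rewrite !inE (negbTE ys) (negbTE yx) (negbTE yB) andbF.
  + have yx : y != x by apply: contraNneq xT => <-.
    have xs : x \notin s.
      apply/negP => xs; apply: F2; apply: (cpx_sub cK Ks); fsd.
    move: bxB; rewrite inE => /orP[/eqP->|bB].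
      have -> : (s `|` (x |` B)) `\ x = s by fsd.
      by right.
    have As' : A `<=` s `\` B `|` (A `|` T) by fsd.
    have H := F1 Ks As' (Tin yT).
    have As2 : A `<=` ((s `\` B `|` (A `|` T)) `|` (x |` T)) `\ y by fsd.
    left; split.
      apply: (cpx_sub cK (flip_link ok H As2 bB)).
      have yx' : y \notin [fset x] by rewrite inE.
      clear - ys yx' yB; fsd.
    apply: (@nsub_in _ _ y); first by rewrite inE yT orbT.
    by rewrite !inE (negbTE ys) (negbTE yx) (negbTE yB) andbF.
Qed.

(* When the link of A contains the factor bd (x |` T), the flip of A against B
   can be done in two steps, first against B with A enlarged by T. *)
Lemma flip_split : flip A (x |` B) K1 = flip A B K.
Proof.
have dAB := flip_dis ok; apply: cpx_ext => s; split.
  case=> [[[[Ks _]|[Bs _ Ks]] nA]|[xBs nA [[Ks nAT]|[Bs _ _]]]].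
  - by left.
  - by right; split=> //; apply: (cpx_sub cK Ks); fsd.
  - have As : A `<=` s `\` (x |` B) `|` A by fsd.
    have [y yT ys] := nATs nAT As.
    right; split=> //; first by fsd.
    apply: (cpx_sub cK (F1 Ks As (Tin yT))).
    have yAB : y \notin A `|` B by (move/fdisjointP: dT; apply).
    have yx : y != x by apply: contraNneq xT => <-.
    have ys' : y \notin s.
      move: ys yAB; rewrite !inE !negb_or !negb_and => /andP[h _] /andP[_ h2].
      by move: h; rewrite (negbTE yx) (negbTE h2).
    have yA : y \notin A by move: yAB; rewrite inE negb_or => /andP[].
    fsd.
  - have /fset0Pn[b bB] := flip_B0 ok.
    have := fsubsetP Bs _ bB; rewrite !inE bB orbT /= => bA.
    by have /fdisjointP/(_ _ bA) := dAB; rewrite bB.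
have ATA : ~~ (A `<=` s) -> ~~ (A `|` T `<=` s).
  by apply: contra => H; fsd.
case=> [[Ks nA]|[Bs nA Ks]].
  by left; split=> //; left; split=> //; apply: ATA.
have As : A `<=` s `\` B `|` A by fsd.
have [xs|xs] := boolP (x \in s).
  right; split=> //; first by fsd.
  left; split; first by apply: (cpx_sub cK Ks); fsd.
  apply/negP => H; apply: F2; apply: (cpx_sub cK Ks); fsd.
left; split=> //; right; split=> //; first exact: ATA.
apply: (cpx_sub cK (F1 Ks As xin)); fsd.
Qed.

(** Together with [split_factor2]: after the first of the two flips, the link of A retains the
    factor dT for the second, so that splitting can be iterated. *)
Lemma split_factor1 s y : K1 s -> A `<=` s -> y \in T -> K1 ((s `|` T) `\ y).
Proof.
move=> K1s As yT; have dAB := flip_dis ok.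
have yA : ~~ (A `|` T `<=` (s `|` T) `\ y).
  by apply: (@nsub_in _ _ y); rewrite !inE ?yT ?orbT // eqxx.
case: K1s => [[Ks nAT]|[Bs nAT Ks]].
  left; split=> //; apply: (cpx_sub cK (F1 Ks As (Tin yT))); fsd.
right; split=> //.
  have yAB : y \notin A `|` B by (move/fdisjointP: dT; apply).
  fsd.
apply: (cpx_sub cK Ks); fsd.
Qed.

Lemma split_factor2 : ~ K1 (A `|` T).
Proof.
case=> [[_]|[Bs _ _]]; first by rewrite fsubset_refl.
have /fset0Pn[b bB] := flip_B0 ok; have := fsubsetP Bs _ bB.
have dAB := flip_dis ok; rewrite inE => /orP[bA|bT].
  by have /fdisjointP/(_ _ bA) := dAB; rewrite bB.
by have /fdisjointP/(_ _ bT) := dT; rewrite inE bB orbT.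
Qed.

End Split.

(** * Flips as chains of bistellar moves *)

(* The last hypothesis of bst_step says that the factor M of the link is trivial. *)
Inductive bst : cpx -> cpx -> Prop :=
| bst_refl K : bst K K
| bst_step A B K L : sing4 K -> sing4 (flip A B K) -> flip_ok A B K ->
    (#|` A| + #|` B|)%N = 6 -> (forall s, K s -> A `<=` s -> s `<=` A `|` B) ->
    bst (flip A B K) L -> bst K L.

Lemma bst_trans K L M : bst K L -> bst L M -> bst K M.
Proof.
move=> H; elim: H M => {K L} [//|A B K L c1 c2 ok c6 lks _ IH] M LM.
by apply: (bst_step c1 c2 ok c6 lks); apply: IH.
Qed.

Lemma bst_sym K L : bst K L -> bst L K.
Proof.
elim=> {K L} [K|A B K L c1 c2 ok c6 lks _ IH]; first exact: bst_refl.
apply: bst_trans IH _; have cK := c1.1; have ok' := flip_okC cK ok.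
have E := flipK cK ok; rewrite -{2}E; apply: (@bst_step B A) => //.
- by rewrite E.
- by rewrite addnC.
- move=> s [[Ks _]|[_ _ Ks]] Bs; first by have := flip_nB cK ok Ks; rewrite Bs.
  have := lks _ Ks (fsubsetUr _ _) => H; fsd.
- exact: bst_refl.
Qed.

Lemma card_disU (A B : fs) : [disjoint A & B] -> #|` A `|` B| = (#|` A| + #|` B|)%N.
Proof. by rewrite /fdisjoint => /eqP E; rewrite cardfsU E cardfs0 subn0. Qed.

(* The factor M in lk A = dB * M. *)
Definition lkf (A B : fs) (K : cpx) : cpx := fun r => [disjoint r & A `|` B] /\ K (r `|` A).

Lemma lkfE A B K b : iscpx K -> flip_ok A B K -> b \in B ->
  lkf A B K = lk (A `|` (B `\ b)) K.
Proof.
move=> cK ok bB; have dAB := flip_dis ok; apply: cpx_ext => r; split=> -[d Kr].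
  split; first by fsd.
  have := flip_link ok Kr (fsubsetUr _ _) bB => H; apply: (cpx_sub cK H).
  have /fdisjointP_sym/(_ _ bB) := dAB => bA; fsd.
have br : b \notin r.
  apply/negP => br; apply: (flip_B ok); apply: (cpx_sub cK Kr).
  fsd.
split; first by fsd.
apply: (cpx_sub cK Kr); fsd.
Qed.

(** By [lkfE] the factor is the link of a simplex with |A| + |B| - 1 vertices. These are at least
    two, so [sing4_link] applies. *)
Lemma flip_card A B K : sing4 K -> flip_ok A B K -> (3 <= #|` A| + #|` B|)%N ->
  (#|` A| + #|` B| <= 6)%N /\ Sph (6 - (#|` A| + #|` B|)) (lkf A B K).
Proof.
move=> cmK ok c3; have cK := cmK.1; have /fset0Pn[b bB] := flip_B0 ok.
have dAB := flip_dis ok.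
have Kg : K (A `|` (B `\ b)).
  apply: (cpx_sub cK (flip_link ok (flip_A ok) (fsubset_refl _) bB)).
  by have /fdisjointP_sym/(_ _ bB) := dAB => bA; fsd.
have cg : (#|` A| + #|` B|)%N = (#|` A `|` (B `\ b)|).+1.
  by rewrite card_disU; [rewrite (cardfsD1 b B) bB addnS|fsd].
rewrite (lkfE cK ok bB) cg; rewrite cg in c3.
have [c1 c2] := sing4_link cmK Kg c3.
by split.
Qed.

Lemma bst_flip0 A B K : sing4 K -> flip_ok A B K -> (#|` A| + #|` B|)%N = 6 -> bst K (flip A B K).
Proof.
move=> cmK ok c6; apply: (bst_step cmK _ ok c6 _ (bst_refl _)).
  by apply: sing4_flip => //; rewrite c6.
move=> s Ks As; have [_] := flip_card cmK ok (ltac:(by rewrite c6)).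
rewrite c6 subnn => /Sph0 E.
have /(_ (s `\` (A `|` B))) : forall r, lkf A B K r -> r = fset0 by rewrite E.
rewrite -fsetD_eq0 => -> //; split; first by fsd.
apply: (cpx_sub cmK.1 Ks); fsd.
Qed.

(* M contains the factor bd T. *)
Definition bd_factor (T A : fs) (K : cpx) :=
  (forall s y, K s -> A `<=` s -> y \in T -> K ((s `|` T) `\ y)) /\ ~ K (A `|` T).

(** With T = x + T', [flip_split] gives a flip of A + T' against B and then one of A against x + B,
    whose link still has the factor dT'. The first has m vertices; in the second, B has gained the
    vertex that T has lost. So the vertices of T are used up one by one and every flip performed has
    m vertices. *)
Lemma bst_factor m : (3 <= m)%N ->
  (forall K A B, sing4 K -> flip_ok A B K -> (#|` A| + #|` B|)%N = m -> bst K (flip A B K)) ->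
  forall T K A B, sing4 K -> flip_ok A B K -> T != fset0 -> [disjoint T & A `|` B] ->
    (#|` A| + #|` B| + #|` T| = m.+1)%N -> bd_factor T A K -> bst K (flip A B K).
Proof.
move=> m3 H T; move E: #|` T| => n.
elim: n T E => [|n IH] T ET K A B cmK ok T0 dT cm [F1 F2].
  by move: T0; rewrite -cardfs_gt0 ET.
have [x xT] : exists x, x \in T by apply/fset0Pn.
have [T1|T1] := eqVneq (T `\ x) fset0.
  apply: H => //; have : #|` T `\ x| = 0%N by rewrite T1 cardfs0.
  by move: cm; rewrite -ET (cardfsD1 x T) xT => cm c0; move: cm; rewrite c0; lia.
have ETx : T = x |` (T `\ x) by fsd.
have xTx : x \notin T `\ x by rewrite !inE eqxx.
have cn : #|` T `\ x| = n by move: ET; rewrite (cardfsD1 x T) xT => -[].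
have cK := cmK.1.
have d' : [disjoint x |` (T `\ x) & A `|` B] by rewrite -ETx.
have F1' : forall s y, K s -> A `<=` s -> y \in x |` (T `\ x) -> K ((s `|` (x |` (T `\ x))) `\ y).
  by rewrite -ETx.
have F2' : ~ K (A `|` (x |` (T `\ x))) by rewrite -ETx.
have ok1 := split_ok1 cK ok xTx d' F1'.
have ok2 := split_ok2 cK ok T1 xTx d' F1' F2'.
have E := flip_split cK ok xTx d' F1' F2'.
have dAT : [disjoint A & T `\ x] by fsd.
have c1 : (#|` A `|` (T `\ x)| + #|` B|)%N = m.
  by rewrite card_disU // cn; move: cm; lia.
apply: (bst_trans (H _ _ _ cmK ok1 c1)).
rewrite -E; apply: (IH (T `\ x)) => //.
- by apply: sing4_flip => //; rewrite c1.
- have := flip_dis ok2 => ?; fsd.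
- have xB : x \notin B by have /fdisjointP/(_ _ xT) := dT; rewrite inE negb_or => /andP[].
  by rewrite cardfsU1 xB; move: cm; lia.
- by split; [move=> s y; apply: (@split_factor1 _ _ _ x)|apply: (@split_factor2 _ _ _ x)].
Qed.

(** * Commutation of a flip with a flip of its factor *)

Section Comm.
Variables (A B C D : fs) (K : cpx).
Hypotheses (cK : iscpx K) (ok : flip_ok A B K) (D0 : D != fset0) (C0 : C != fset0).
Hypotheses (dD : [disjoint D & A `|` B]) (dC : [disjoint C & A `|` B]) (dCD : [disjoint C & D]).
Hypotheses (nKC : ~ K C) (KAD : K (A `|` D)).
Hypothesis (lnk : forall s c, K s -> A `|` D `<=` s -> c \in C -> K ((s `|` C) `\ c)).

Let dAB := flip_dis ok.

Lemma comm_ok1 : flip_ok (A `|` D) C K.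
Proof.
split=> //; last by fsd.
by have /fset0Pn[a aA] := flip_A0 ok; apply/fset0Pn; exists a; rewrite inE aA.
Qed.

Let nD (s : fs) : ~~ (D `<=` s) -> ~~ (A `|` D `<=` s).
Proof. by rewrite fsubUset negb_and orbC => ->. Qed.
Let nA (s : fs) : ~~ (A `<=` s) -> ~~ (A `|` D `<=` s).
Proof. by rewrite fsubUset negb_and => ->. Qed.
Let nDA : ~~ (D `<=` A).
Proof. apply: nsub_dis => //; fsd. Qed.
Let nCB : ~~ (C `<=` B).
Proof. apply: nsub_dis => //; fsd. Qed.
Let nBC : ~~ (B `<=` C).
Proof. apply: nsub_dis => //; [exact: flip_B0 ok|fsd]. Qed.
Let nKnC s : K s -> ~~ (C `<=` s).
Proof. by move=> Ks; apply/negP => Cs; apply: nKC; apply: cpx_sub Ks Cs. Qed.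

Lemma comm_ok2 : flip_ok A B (flip (A `|` D) C K).
Proof.
have [A0 B0 _ KA KB kl] := ok; split=> //.
- by left; split=> //; apply: nD.
- by case=> [[]|[]] //; rewrite (negbTE nCB).
- move=> s b K1s As bB.
  have nn : ~~ (A `|` D `<=` s) -> ~~ (A `|` D `<=` (s `|` B) `\ b).
    move=> /nsubP[y]; rewrite inE => /orP[yA|yD] ys.
      by have := fsubsetP As _ yA; rewrite (negbTE ys).
    apply: (@nsub_in _ _ y); first by rewrite inE yD orbT.
    have /fdisjointP/(_ _ yD) := dD; rewrite !inE !negb_or (negbTE ys) => /andP[_ /negbTE->].
    by rewrite andbF.
  case: K1s => [[Ks nAD]|[Cs nAD Ks]]; first by left; split; [apply: kl|apply: nn].
  right; split; [|exact: nn|].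
    have /fdisjointP_sym := dC => H; have bC : b \notin C by apply: H; rewrite inE bB orbT.
    fsd.
  have As' : A `<=` s `\` C `|` (A `|` D) by fsd.
  apply: (cpx_sub cK (kl _ _ Ks As' bB)).
  have bAD : b \notin A `|` D.
    rewrite inE negb_or; have /fdisjointP_sym/(_ _ bB) := dAB => -> /=.
    by have /fdisjointP_sym := dD; apply; rewrite inE bB orbT.
  fsd.
Qed.

Lemma comm_ok3 : flip_ok (B `|` D) C (flip A B K).
Proof.
have [A0 B0 _ KA KB kl] := ok; split=> //.
- by have /fset0Pn[a aA] := B0; apply/fset0Pn; exists a; rewrite inE aA.
- fsd.
- right; split; first by apply: fsubsetUl.
    apply: nsub_dis => //; fsd.
  apply: (cpx_sub cK KAD); fsd.
- by case=> [[]|[]] //; rewrite (negbTE nBC).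
- move=> s c [[Ks _]|[Bs nAs Ks]] BDs cC.
    by have := flip_nB cK ok Ks; rewrite (_ : B `<=` s) //; fsd.
  have cAB : c \notin A `|` B by (move/fdisjointP: dC; apply).
  right; split; first by fsd.
    apply: contra nAs => H; fsd.
  have ADs : A `|` D `<=` s `\` B `|` A by fsd.
  apply: (cpx_sub cK (lnk Ks ADs cC)).
  fsd.
Qed.

(** The flip of D against C happens inside M. Before the flip of A against B, the factor M is joined
    to A, afterwards to B; hence D is completed by A on one side of the square and by B on the
    other. *)
Lemma comm_eq : flip A B (flip (A `|` D) C K) = flip (B `|` D) C (flip A B K).
Proof.
have [A0 B0 _ KA KB kl] := ok; have KnB s : K s -> ~~ (B `<=` s) by apply: (flip_nB cK ok).
have nB s : ~~ (B `<=` s) -> ~~ (B `|` D `<=` s) by rewrite fsubUset negb_and => ->.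
have nBD s : ~~ (D `<=` s) -> ~~ (B `|` D `<=` s) by rewrite fsubUset negb_and orbC => ->.
apply: cpx_ext => s; split.
  case=> [[[[Ks nAD]|[Cs nAD Ks]] nAs]|[Bs nAs [[Ks nAD]|[Cs nAD Ks]]]].
  - by left; split; [left|apply: nB; apply: KnB].
  - right; split=> //.
      apply: nB; apply: contra (KnB _ Ks) => H; fsd.
    right; split; first by fsd.
      apply: contra nAs => H; fsd.
    apply: (cpx_sub cK Ks); fsd.
  - have nDs : ~~ (D `<=` s).
      apply: contra nAD => H; fsd.
    by left; split; [right|apply: nBD].
  - have Cs' : C `<=` s by fsd.
    right; split=> //.
      apply: nBD; apply: contra nAD => H; fsd.
    right; split; first by fsd.
      apply: contra nAs => H; fsd.
    apply: (cpx_sub cK Ks); fsd.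
case=> [[[[Ks nAs]|[Bs nAs Ks]] nBDs]|[Cs nBDs [[Ks nAs]|[Bs nAs Ks]]]].
- by left; split=> //; left; split=> //; apply: nA.
- have nDs : ~~ (D `<=` s).
    apply: contra nBDs => H; fsd.
  right; split=> //; left; split=> //; apply: nD.
  apply: contra nDs => H; fsd.
- by have := KnB _ Ks; rewrite (_ : B `<=` _) //; fsd.
- have nAs' : ~~ (A `<=` s).
    apply: contra nAs => H; fsd.
  have [Bs'|nBs] := boolP (B `<=` s).
    have nDs : ~~ (D `<=` s).
      apply: contra nBDs => H; fsd.
    right; split=> //; right; split; first by fsd.
      apply: nD; apply: contra nDs => H; fsd.
    apply: (cpx_sub cK Ks); fsd.
  left; split=> //; right; split=> //; first exact: nA.
  have [b bB bs] := nsubP nBs.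
  have As2 : A `<=` (s `\` C `|` (B `|` D)) `\` B `|` A by fsd.
  apply: (cpx_sub cK (kl _ _ Ks As2 bB)).
  have bAD : b \notin A `|` D.
    rewrite inE negb_or; have /fdisjointP_sym/(_ _ bB) := dAB => -> /=.
    by have /fdisjointP_sym := dD; apply; rewrite inE bB orbT.
  clear - bs bAD dAB dC dD dCD; fsd.
Qed.

Lemma lkf_comm : lkf A B (flip (A `|` D) C K) = flip D C (lkf A B K).
Proof.
apply: cpx_ext => r; split.
  case=> d [[Kr nAD]|[Cr nAD Kr]].
    left; split; first by split.
    apply: contra nAD => H; fsd.
  right; split; first by fsd.
    apply: contra nAD => H; fsd.
  split; first by fsd.
  apply: (cpx_sub cK Kr); fsd.
case=> [[[d Kr] nDr]|[Cr nDr [d Kr]]].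
  split=> //; left; split=> //; apply: nD; apply: contra nDr => H; fsd.
split; first by fsd.
right; split; first by fsd.
  apply: nD; apply: contra nDr => H; fsd.
apply: (cpx_sub cK Kr); fsd.
Qed.
End Comm.

(** The part of s outside A and B is a simplex of M containing D, to which the flip of M adds C - c.
    The part of s in B is then restored by the link condition of A, as s misses some b. *)
Lemma lkf_link A B C D K : iscpx K -> flip_ok A B K -> [disjoint C & A `|` B] ->
  flip_ok D C (lkf A B K) ->
  forall s c, K s -> A `|` D `<=` s -> c \in C -> K ((s `|` C) `\ c).
Proof.
move=> cK ok dC ok' s c Ks ADs cC; have dAB := flip_dis ok.
have [dD KD] := flip_A ok'.
have Lr : lkf A B K (s `\` (A `|` B)).
  by split; [fsd|apply: (cpx_sub cK Ks); fsd].
have Dr : D `<=` s `\` (A `|` B) by fsd.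
have [_ H] := flip_link ok' Lr Dr cC.
have [b bB bs] := nsubP (flip_nB cK ok Ks).
have := flip_link ok H (fsubsetUr _ _) bB => H2.
apply: (cpx_sub cK H2).
have bC : b \notin C by have /fdisjointP_sym := dC; apply; rewrite inE bB orbT.
clear - bs bC ADs dAB dC; fsd.
Qed.

(* Extending a flip of M to the whole complex commutes with flipping A against B,
   and both extensions are flips with more vertices than A and B. *)
Section Refresh.
Variable m : nat.
Hypothesis m3 : (3 <= m)%N.
Hypothesis real : forall K A B, sing4 K -> flip_ok A B K ->
  (m < #|` A| + #|` B|)%N -> bst K (flip A B K).

(** The link of A + D has the factor dB and, after the flip of A against B, the link of B + D has
    the factor dA. So [bst_factor] realizes both extensions of the flip of M, with T = B and T = A
    respectively. *)
Lemma comm_step A B C D K : sing4 K -> flip_ok A B K -> (#|` A| + #|` B|)%N = m ->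
  [disjoint C & A `|` B] -> ~ K C -> flip_ok D C (lkf A B K) ->
  let K' := flip (A `|` D) C K in
  [/\ bst K K', sing4 K', flip_ok A B K', bst (flip A B K) (flip A B K') &
      lkf A B K' = flip D C (lkf A B K)].
Proof.
move=> cmK ok cm dC nKC ok' K'; have cK := cmK.1.
have lnk := lkf_link cK ok dC ok'.
have [D0 C0 dDC [dD KDA] _ _] := ok'.
have dCD : [disjoint C & D] by rewrite fdisjoint_sym.
have KAD : K (A `|` D) by rewrite fsetUC.
have ok1 : flip_ok (A `|` D) C K by apply: (@comm_ok1 A B).
have ok2 : flip_ok A B K' by apply: comm_ok2.
have ok3 : flip_ok (B `|` D) C (flip A B K) by apply: comm_ok3.
have E : flip A B K' = flip (B `|` D) C (flip A B K) by apply: comm_eq.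
have A1 : (0 < #|` A|)%N by rewrite cardfs_gt0; apply: flip_A0 ok.
have B1 : (0 < #|` B|)%N by rewrite cardfs_gt0; apply: flip_B0 ok.
have C1 : (0 < #|` C|)%N by rewrite cardfs_gt0.
have D1 : (0 < #|` D|)%N by rewrite cardfs_gt0.
have dAD : [disjoint A & D] by fsd.
have dBD : [disjoint B & D] by fsd.
have dAB := flip_dis ok.
have ckA : (3 <= #|` A `|` D| + #|` C|)%N by rewrite card_disU //; move: m3 cm; lia.
have cm2 : sing4 (flip A B K) by apply: sing4_flip; rewrite ?cm.
have okC := flip_okC cK ok; have cK2 := cm2.1.
(* The number of vertices of each flip performed by [bst_factor]. It exceeds m because C and D are
   nonempty. *)
pose mm := (#|` A| + #|` B| + #|` C| + #|` D|).-1.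
have [mmm e3 eA eB] : [/\ (m < mm)%N, (3 <= mm)%N,
    (#|` B| + #|` D| + #|` C| + #|` A|)%N = mm.+1 &
    (#|` A| + #|` D| + #|` C| + #|` B|)%N = mm.+1].
  clear - cm m3 A1 B1 C1 D1; rewrite /mm; move: #|` A| #|` B| #|` C| #|` D| cm A1 B1 C1 D1.
  by move=> a b c d h1 h2 h3 h4 h5; split; lia.
have real' K1 A' B' : sing4 K1 -> flip_ok A' B' K1 -> (#|` A'| + #|` B'|)%N = mm -> bst K1 (flip A' B' K1).
  by move=> h1 h2 h3; apply: real; rewrite ?h3.
split=> //.
- have H := @bst_factor mm.
  apply: (H e3 real' B) => //; [exact: flip_B0 ok|fsd|by rewrite card_disU // eB|].
  split.
    by move=> s y Ks ADs; apply: (flip_link ok) => //; fsd.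
  move=> KB; apply: (flip_B ok); apply: (cpx_sub cK KB); fsd.
- exact: sing4_flip.
- rewrite E; have H := @bst_factor mm.
  apply: (H e3 real' A) => //; [exact: flip_A0 ok|fsd|by rewrite card_disU // eA|].
  split.
    by move=> s y Ks ADs; apply: (flip_link okC) => //; fsd.
  move=> KB; apply: (flip_B okC); apply: (cpx_sub cK2 KB); fsd.
- exact: lkf_comm.
Qed.

Section One.
Variables (A B : fs) (K : cpx) (N : nat).
Hypotheses (cmK : sing4 K) (ok : flip_ok A B K) (cm : (#|` A| + #|` B|)%N = m).
Hypotheses (KN : forall s x, K s -> x \in s -> (x < N)%N) (BN : forall x, x \in B -> (x < N)%N).

Definition shl (xs : seq nat) y := if y \in xs then (y + N)%N else y.

Let AN x : x \in A -> (x < N)%N.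
Proof. by apply: KN; apply: flip_A ok. Qed.

Let LN r x : lkf A B K r -> x \in r -> (x < N)%N.
Proof. by case=> _ Kr xr; apply: (KN Kr); rewrite inE xr. Qed.

Lemma shl_lt xs y x : (x < N)%N -> x \notin xs -> (shl xs y == x) = (y == x).
Proof.
move=> xN xxs; rewrite /shl; case: ifP => // yx.
have -> : (y == x) = false by apply: contraNF xxs => /eqP <-.
apply/negbTE; lia.
Qed.

Lemma shl_cons xs x (t : fs) : (x < N)%N -> x \notin xs -> (forall y, y \in t -> (y < N)%N) ->
  shl (x :: xs) @` t = if x \in t then (x + N)%N |` (shl xs @` t `\ x) else shl xs @` t.
Proof.
move=> xN xxs tN; case: ifP => xt; last first.
  apply: fimset_eq_in => y yt; rewrite /shl inE; case: eqP => // E.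
  by rewrite -E yt in xt.
apply/fsetP => z; rewrite !inE; apply/imfsetP/idP.
  case=> y yt ->; have [->|yx] := eqVneq y x.
    by rewrite /shl inE eqxx eqxx.
  have -> : shl (x :: xs) y = shl xs y by rewrite /shl inE (negbTE yx).
  by rewrite (shl_lt y xN xxs) yx /=; apply/orP; right; apply: in_imfset.
case/orP=> [/eqP->|/andP[zx /imfsetP[y yt E]]].
  by exists x => //; rewrite /shl inE eqxx.
by exists y => //; rewrite E /shl inE; move: zx; rewrite E (shl_lt y xN xxs) => /negbTE ->.
Qed.

Lemma shl_im_x xs x (t : fs) : (x < N)%N -> x \notin xs -> (x \in shl xs @` t) = (x \in t).
Proof.
move=> xN xxs; apply/imfsetP/idP => [[y yt /eqP]|xt].
  by rewrite eq_sym shl_lt // => /eqP <-.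
by exists x => //; rewrite /shl (negbTE xxs).
Qed.

Lemma mapc_shl_cons xs x : (x < N)%N -> x \notin xs ->
  (forall s, mapc (shl xs) (lkf A B K) s -> (x + N)%N \notin s) ->
  flip [fset x] [fset (x + N)%N] (mapc (shl xs) (lkf A B K)) = mapc (shl (x :: xs)) (lkf A B K).
Proof.
move=> xN xxs new; apply: cpx_ext => s; split.
  case=> [[[t Lt ->]]|[]].
    rewrite fsub1set shl_im_x // => xt; exists t => //.
    rewrite shl_cons //; first by rewrite (negbTE xt).
    by move=> y; apply: LN.
  rewrite !fsub1set => xs1 xs2 [t Lt E]; exists t => //.
  have xt : x \in t by rewrite -(shl_im_x t xN xxs) -E !inE eqxx orbT.
  rewrite shl_cons //; last by move=> y; apply: LN.
  rewrite xt -E; fsd.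
case=> t Lt ->; rewrite shl_cons //; last by move=> y; apply: LN.
case: ifP => xt; last first.
  by left; split; [exists t|rewrite fsub1set shl_im_x // xt].
have n1 := new _ (ex_intro2 _ _ t Lt (erefl _)).
right; rewrite !fsub1set; split; [by rewrite !inE eqxx| |].
  rewrite !inE eqxx /= ?andbF ?orbF; apply/eqP => E.
  by move: n1; rewrite -E shl_im_x // xt.
exists t => //; have x1 : x \in shl xs @` t by rewrite shl_im_x.
fsd.
Qed.

Lemma refresh xs : (forall x, x \in xs -> (x < N)%N) -> exists K',
  [/\ bst K K', sing4 K', flip_ok A B K', bst (flip A B K) (flip A B K') &
      lkf A B K' = mapc (shl xs) (lkf A B K)] /\
  (forall s, K' s -> (forall y, y \in s -> (N <= y)%N) -> K' (s `|` A)) /\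
  (forall s y, K' s -> y \in s -> (y < N)%N \/ exists2 x, x \in xs & y = (x + N)%N).
Proof.
elim: xs => [_|x xs IH xsN].
  exists K; split; first split=> //; try exact: bst_refl.
    by rewrite (@mapc_eq _ id) ?mapc_id.
  split; last by move=> s y Ks ys; left; apply: KN ys.
  move=> s Ks sN; suff -> : s = fset0 by rewrite fset0U; apply: flip_A ok.
  apply/eqP/fset0Pn => -[y ys]; have := KN Ks ys; have := sN _ ys; lia.
have xN : (x < N)%N by apply: xsN; rewrite inE eqxx.
have [|K' [[b1 cm' ok' b2 EL] [inv bnd]]] := IH.
  by move=> y yxs; apply: xsN; rewrite inE yxs orbT.
have [xxs|xxs] := boolP (x \in xs).
  exists K'; split; last first.
    split=> // s y Ks ys; have [|[z zx ->]] := bnd _ _ Ks ys; first by left.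
    by right; exists z => //; rewrite inE zx orbT.
  split=> //; rewrite EL; apply: mapc_eq => s y _ _.
  by rewrite /shl inE; case: eqP => // ->; rewrite xxs.
have [Lx|nLx] := pselect (lkf A B K' [fset x]); last first.
  exists K'; split; last first.
    split=> // s y Ks ys; have [|[z zx ->]] := bnd _ _ Ks ys; first by left.
    by right; exists z => //; rewrite inE zx orbT.
  split=> //; rewrite EL; apply: mapc_eq => s y Ls ys.
  rewrite /shl inE; case: eqP => // E; subst y.
  case: nLx; rewrite EL; exists [fset x]; last by rewrite imfset_fset1 /shl (negbTE xxs).
  case: Ls => d Ls; split; first by fsd.
  by apply: (cpx_sub cmK.1 Ls); fsd.
set x' := (x + N)%N.
have nK' s : K' s -> x' \notin s.
  move=> Ks; apply/negP => xs'; have [|[z zx E]] := bnd _ _ Ks xs'; first by rewrite /x'; lia.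
  have zxE : z = x by move: E; rewrite /x'; lia.
  by rewrite zxE (negbTE xxs) in zx.
have xAB : x \notin A `|` B by case: Lx => /fdisjointP/(_ x); rewrite inE eqxx => /(_ isT).
have xA : x \notin A by apply: contra xAB => ?; rewrite inE; apply/orP; left.
have x'AB : x' \notin A `|` B.
  by apply/negP; rewrite inE => /orP[/AN|/BN]; rewrite /x'; lia.
have dC : [disjoint [fset x'] & A `|` B] by fsd.
have nKC : ~ K' [fset x'] by move=> /nK'; rewrite inE eqxx.
have xx' : x != x' by rewrite /x'; lia.
have okL : flip_ok [fset x] [fset x'] (lkf A B K').
  split=> //.
  - by apply/fset0Pn; exists x; rewrite inE.
  - by apply/fset0Pn; exists x'; rewrite inE.
  - by rewrite fdisjoint1X inE.
  - by case=> _ H; apply: nKC; apply: (cpx_sub cm'.1 H); apply: fsubsetUl.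
  - move=> s b [d Ks] _; rewrite inE => /eqP ->.
    have x's : x' \notin s by have := nK' _ Ks; rewrite inE negb_or => /andP[].
    by have -> : (s `|` [fset x']) `\ x' = s by fsd.
have [c1 c2 c3 c4 c5] := comm_step cm' ok' cm dC nKC okL.
exists (flip (A `|` [fset x]) [fset x'] K'); split.
  split=> //; [exact: bst_trans c1|exact: bst_trans c4|].
  rewrite c5 EL mapc_shl_cons // => s; rewrite -EL => -[_ Ks].
  by have := nK' _ Ks; rewrite inE negb_or => /andP[].
split.
  move=> s H sN; have xs' : x \notin s by apply/negP => /sN; lia.
  have nAx : ~~ (A `|` [fset x] `<=` s `|` A).
    by apply: (@nsub_in _ _ x); rewrite !inE ?eqxx ?orbT // negb_or xs'.
  case: H => [[Ks _]|[x's _ Ks]]; first by left; split=> //; apply: inv.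
  right; split=> //; first by fsd.
  by apply: (cpx_sub cm'.1 Ks); fsd.
move=> s y [[Ks _]|[_ _ Ks]] ys.
  have [|[z zx ->]] := bnd _ _ Ks ys; first by left.
  by right; exists z => //; rewrite inE zx orbT.
have [->|yx'] := eqVneq y x'; first by right; exists x; rewrite ?inE ?eqxx.
have [||[z zx ->]] := bnd _ y Ks; first by rewrite !inE ys yx'.
  by left.
by right; exists z => //; rewrite inE zx orbT.
Qed.
End One.
End Refresh.

Lemma bst_flip A B K : sing4 K -> flip_ok A B K -> (3 <= #|` A| + #|` B|)%N -> bst K (flip A B K).
Proof.
move Ek: (6 - (#|` A| + #|` B|))%N => k.
elim/ltn_ind: k A B K Ek => k IHk A B K Ek cmK ok c3.
have [c6 SL] := flip_card cmK ok c3; rewrite Ek in SL.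
have [k0|k0] := posnP k.
  by apply: bst_flip0 => //; move: Ek c6; rewrite k0; lia.
have real K1 A1 B1 : sing4 K1 -> flip_ok A1 B1 K1 -> (6 - k < #|` A1| + #|` B1|)%N ->
    bst K1 (flip A1 B1 K1).
  move=> cm1 ok1 ck; have c31 : (3 <= #|` A1| + #|` B1|)%N by lia.
  have [c61 _] := flip_card cm1 ok1 c31.
  by apply: (IHk (6 - (#|` A1| + #|` B1|))%N) => //; lia.
have m3 : (3 <= 6 - k)%N by lia.
(* The factor is prescribed only up to a shift, since every round of the induction moves it to fresh
   vertices. *)
suff H j M : Sph j M -> j = k -> forall N A B K, sing4 K -> flip_ok A B K ->
    (#|` A| + #|` B|)%N = (6 - k)%N -> lkf A B K = mapc (addn^~ N) M -> bst K (flip A B K).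
  apply: (H k (lkf A B K) SL _ 0%N) => //; first by lia.
  by rewrite (@mapc_eq _ id) ?mapc_id // => s x _ _; rewrite addn0.
elim=> {j M SL Ek cmK ok c3 c6 A B K} [j t Et|j D0 C0 M SM IH ok0] Ej N A B K cmK ok cm EL.
  have aI : injective (addn^~ N) by move=> x y /addIn.
  subst j; rewrite mapc_bd // in EL; set T := _ @` t in EL.
  have ET : #|` T| = k.+1 by rewrite card_imfset.
  have cK := cmK.1.
  have Tx y : y \in T -> lkf A B K (T `\ y).
    move=> yT; rewrite EL; split; first by fsd.
    by apply: (@nsub_in _ _ y); rewrite // !inE eqxx.
  have dT : [disjoint T & A `|` B].
    apply/fdisjointP => x xT.
    have /fset0Pn[y] : T `\ x != fset0.
      by rewrite -cardfs_gt0; move: ET; rewrite (cardfsD1 x T) xT; lia.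
    rewrite !inE => /andP[yx yT]; have [/fdisjointP d _] := Tx _ yT.
    by have := d x; rewrite !inE eq_sym yx xT => /(_ isT).
  (* Here |A| + |B| + |T| = 7, so the splitting consists of flips with 6 vertices, which are
     bistellar moves. *)
  apply: (@bst_factor 6 _ _ T) => //.
  - by move=> *; apply: bst_flip0.
  - by rewrite -cardfs_gt0 ET.
  - by rewrite ET cm; lia.
  split; last first.
    move=> KT; have : lkf A B K T by split=> //; rewrite fsetUC.
    by rewrite EL => -[_]; rewrite fsubset_refl.
  move=> s y Ks As yT; have [_ Ky] := Tx _ yT.
  have [sT _] : bd T (s `\` (A `|` B)).
    by rewrite -EL; split; [fsd|apply: (cpx_sub cK Ks); fsd].
  have [b bB bs] := nsubP (flip_nB cK ok Ks).
  have H := flip_link ok Ky (fsubsetUr _ _) bB.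
  apply: (cpx_sub cK H).
  have bT : b \notin T by have /fdisjointP_sym := dT; apply; rewrite inE bB orbT.
  clear - bs bT sT dT yT; fsd.
subst j; have cK := cmK.1.
have [n1 Hn1] := cpx_fin cK; have [n2 Hn2] := fs_bound B.
pose N2 := (n1 + n2)%N.
have KN s x : K s -> x \in s -> (x < N2)%N by move=> h1 h2; have := Hn1 _ _ h1 h2; rewrite /N2; lia.
have BN x : x \in B -> (x < N2)%N by move=> /Hn2; rewrite /N2; lia.
have [|K1 [[b1 cm1 ok1 b2 EL1] [inv bnd]]] := refresh m3 real cmK ok cm KN BN (xs := iota 0 N2).
  by move=> x; rewrite mem_iota.
have E1 : lkf A B K1 = mapc (addn^~ (N + N2)%N) (flip D0 C0 M).
  rewrite EL1; have -> : mapc (shl N2 (iota 0 N2)) (lkf A B K) = mapc (addn^~ N2) (lkf A B K).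
    apply: mapc_eq => s x [_ Ks] xs; rewrite /shl mem_iota /= add0n.
    by rewrite (KN _ _ Ks) // inE xs.
  rewrite EL mapc_comp; apply: mapc_eq => s x _ _ /=; by rewrite addnA.
have aI : injective (addn^~ (N + N2)%N) by move=> x y /addIn.
have cM := Sph_cpx SM.
(* The present factor is the result of the last flip of the sequence, and it is this flip that has
   to be undone; hence the exchange of [C0] and [D0]. *)
have ok2 := flip_ok_map aI (flip_okC cM ok0).
rewrite -E1 in ok2; set C := _ @` D0 in ok2; set D := _ @` C0 in ok2.
have CN y : y \in C -> (N2 <= y)%N by case/imfsetP => z _ ->; rewrite /=; lia.
have dC : [disjoint C & A `|` B].
  apply/fdisjointP => x /CN xN; rewrite inE negb_or; apply/andP; split; apply/negP.
    by move=> /(KN _ _ (flip_A ok)); lia.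
  by move=> /BN; lia.
(* A simplex on fresh vertices would be joinable with A and thus lie in the factor, where [C] is
   missing. *)
have nKC : ~ K1 C.
  by move=> KC; apply: (flip_B ok2); split=> //; apply: inv.
have [c1 c2 c3 c4 c5] := comm_step m3 real cm1 ok1 cm dC nKC ok2.
(* The path refreshes the factor, undoes its last flip, flips A against B by induction, and returns
   through the flipped complexes. *)
apply: (bst_trans b1); apply: (bst_trans c1).
apply: (@bst_trans _ (flip A B (flip (A `|` D) C K1))).
  apply: (IH (erefl _) (N + N2)%N) => //.
  by rewrite c5 E1 -mapc_flip // flipK.
by apply: bst_sym; apply: bst_trans c4.
Qed.

Local Close Scope fset_scope.
Local Open Scope ring_scope.

(** * Linear inequalities *)

Section Farkas.
Variable R : realFieldType.

Definition dot (N : finType) (a x : N -> R) : R := \sum_n a n * x n.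

Section Dot.
Variable N : finType.
Implicit Types a b x y : N -> R.

Lemma dotDZl a b c x : dot (fun n => a n + c * b n) x = dot a x + c * dot b x.
Proof.
rewrite /dot mulr_sumr -big_split /=; apply: eq_bigr => n _; ring.
Qed.

Lemma dotDZr a c x y : dot a (fun n => x n + c * y n) = dot a x + c * dot a y.
Proof.
rewrite /dot mulr_sumr -big_split /=; apply: eq_bigr => n _; ring.
Qed.

Lemma dotC a x : dot a x = dot x a.
Proof. by apply: eq_bigr => n _; rewrite mulrC. Qed.

Lemma dot_suml (I : finType) (t : I -> R) (a : I -> N -> R) x :
  dot (fun n => \sum_i t i * a i n) x = \sum_i t i * dot (a i) x.
Proof.
rewrite /dot; under eq_bigr do rewrite mulr_suml.
rewrite exchange_big /=; apply: eq_bigr => i _; rewrite mulr_sumr.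
by apply: eq_bigr => n _; rewrite mulrA.
Qed.

Lemma dot_sumr (I : finType) (t : I -> R) (a : I -> N -> R) x :
  dot x (fun n => \sum_i t i * a i n) = \sum_i t i * dot x (a i).
Proof. by rewrite dotC dot_suml; under eq_bigr do rewrite dotC. Qed.
End Dot.

(* D. Bartl's induction on the number of inequalities: if the last one is
   needed, a violating x for the others is used to eliminate it. *)
Lemma farkas (I N : finType) (S : {set I}) (a : I -> N -> R) (g : N -> R) :
  (forall x, (forall i, i \in S -> dot (a i) x <= 0) -> dot g x <= 0) ->
  exists l : I -> R, [/\ forall i, 0 <= l i, forall i, i \notin S -> l i = 0 &
    forall n, g n = \sum_i l i * a i n].
Proof.
elim: {S}#|S| {-2}S (erefl #|S|) a g => [|k IH] S cS a g H.
  have S0 : S = set0 by apply/eqP; rewrite -cards_eq0 cS.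
  exists (fun=> 0); split=> // n; rewrite big1; last by move=> i _; rewrite mul0r.
  have /H : forall i, i \in S -> dot (a i) (fun n => g n) <= 0 by move=> i; rewrite S0 inE.
  rewrite /dot => le0; have /eqP : \sum_n g n * g n = 0.
    by apply/eqP; rewrite eq_le le0 sumr_ge0 // => m _; rewrite -expr2 sqr_ge0.
  rewrite psumr_eq0; last by move=> m _; rewrite -expr2 sqr_ge0.
  by move=> /allP/(_ n); rewrite mem_index_enum mulf_eq0 orbb => /(_ isT)/eqP.
have [i0 i0S] : exists i0, i0 \in S by apply/set0Pn; rewrite -card_gt0 cS.
pose S' := S :\ i0.
have cS' : #|S'| = k by move: cS; rewrite (cardsD1 i0 S) i0S => -[].
have S'S i : i \in S' -> i \in S by rewrite !inE => /andP[].
have [H'|] := pselect (forall x, (forall i, i \in S' -> dot (a i) x <= 0) -> dot g x <= 0).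
  have [l [l0 lS lE]] := IH S' cS' a g H'; exists l; split=> // i iS; apply: lS.
  by apply: contra iS; apply: S'S.
move=> /existsNP[x0] /not_implyP[x0S /negP]; rewrite -ltNge => gx0.
have ax0 : 0 < dot (a i0) x0.
  rewrite ltNge; apply/negP => le0; move: gx0; rewrite ltNge => /negP; apply.
  apply: H => i iS; have [->//|ne] := eqVneq i i0.
  by apply: x0S; rewrite !inE ne.
set c := dot (a i0) x0 in ax0.
have c0 : c != 0 by rewrite gt_eqF.
pose a' i n := a i n + (- (dot (a i) x0 / c)) * a i0 n.
pose g' n := g n + (- (dot g x0 / c)) * a i0 n.
have [|l [l0 lS lE]] := IH S' cS' a' g'.
  move=> x Hx; pose y n := x n + (- (dot (a i0) x / c)) * x0 n.
  have yE b : dot b y = dot (fun n => b n + (- (dot b x0 / c)) * a i0 n) x.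
    rewrite dotDZl dotDZr; ring.
  rewrite -[dot g' x]/(dot (fun n => g n + (- (dot g x0 / c)) * a i0 n) x) -yE.
  apply: H => i iS; have [->|ne] := eqVneq i i0.
    by rewrite /y dotDZr -/c mulNr divfK // subrr.
  by rewrite yE; apply: Hx; rewrite !inE ne.
pose c1 := (dot g x0 - \sum_i l i * dot (a i) x0) / c.
have li0 : l i0 = 0 by apply: lS; rewrite !inE eqxx.
exists (fun i => if i == i0 then c1 else l i); split.
- move=> i; case: ifP => // _; apply: divr_ge0 (ltW ax0).
  rewrite subr_ge0; apply: le_trans (ltW gx0).
  apply: sumr_le0 => j _; have [jS|jS] := boolP (j \in S').
    by rewrite mulr_ge0_le0 // x0S.
  by rewrite lS // mul0r.
- move=> i iS; case: eqP => [E|_]; first by rewrite E i0S in iS.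
  by apply: lS; apply: contra iS; apply: S'S.
- move=> n; rewrite (bigD1 i0) //= eqxx.
  have -> : \sum_(i | i != i0) (if i == i0 then c1 else l i) * a i n = \sum_i l i * a i n.
    rewrite [RHS](bigD1 i0) //= li0 mul0r add0r.
    by apply: eq_bigr => i /negbTE ->.
  have := lE n; rewrite /g' /a'.
  under eq_bigr do rewrite mulrDr.
  rewrite big_split /=.
  have -> : \sum_i l i * (- (dot (a i) x0 / c) * a i0 n) =
            - ((\sum_i l i * dot (a i) x0) / c) * a i0 n.
    rewrite !mulr_suml -sumrN mulr_suml; apply: eq_bigr => i _; ring.
  move=> E; rewrite /c1 mulrBl; move: E; set s1 := \sum_i _; set s2 := \sum_i _ => E.
  have -> : g n = s1 + - (s2 / c) * a i0 n + dot g x0 / c * a i0 n by rewrite -E; ring.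
  ring.
Qed.

Lemma farkas_eq (I N : finType) (S E : {set I}) (a : I -> N -> R) (g : N -> R) :
  (forall x, (forall i, i \in S -> dot (a i) x <= 0) ->
     (forall i, i \in E -> dot (a i) x = 0) -> dot g x <= 0) ->
  exists l : I -> R, [/\ forall i, i \notin E -> 0 <= l i,
    forall i, i \notin S :|: E -> l i = 0 & forall n, g n = \sum_i l i * a i n].
Proof.
move=> H; pose a2 (i : I + I) n := match i with inl i => a i n | inr i => - a i n end.
pose S2 : {set I + I} := [set i | match i with inl i => i \in S :|: E | inr i => i \in E end].
have [|l [l0 lS lE]] := @farkas _ _ S2 a2 g.
  move=> x Hx; apply: H => [i iS|i iE].
    by apply: (Hx (inl i)); rewrite !inE iS.
  apply/eqP; rewrite eq_le; apply/andP; split.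
    by apply: (Hx (inl i)); rewrite !inE iE orbT.
  have := Hx (inr i); rewrite inE iE => /(_ isT); rewrite /dot /a2.
  by under eq_bigr do rewrite mulNr; rewrite sumrN oppr_le0.
exists (fun i => l (inl i) - l (inr i)); split.
- by move=> i iE; rewrite (lS (inr i)) ?subr0 // inE.
- move=> i; rewrite inE negb_or => /andP[iS iE].
  by rewrite !lS ?subr0 // !inE ?negb_or ?iS.
- move=> n; rewrite lE big_sumType /= -big_split /=; apply: eq_bigr => i _.
  by rewrite mulrBl mulrN.
Qed.

(** A transposition theorem, to be applied to a face F whose heights change at rate y. The first
    alternative is a direction in which the supporting functional can be tilted so that, among the
    points of F, exactly those of s stay tight; the second is a linear dependence that obstructs
    this. *)
Lemma motzkin (V N : finType) (p : V -> N -> R) (F s : {set V}) (y : V -> R) :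
  s \subset F ->
  (exists m, (forall v, v \in s -> dot m (p v) = y v) /\
             (forall v, v \in F :\: s -> dot m (p v) < y v)) \/
  (exists d : V -> R, [/\ forall v, v \notin F -> d v = 0, forall v, v \notin s -> 0 <= d v,
     forall n, \sum_v d v * p v n = 0, \sum_v d v * y v <= 0 &
     \sum_v d v * y v < 0 \/ exists2 v, v \in F :\: s & 0 < d v]).
Proof.
move=> sF; set P := (X in _ \/ X); have [HP|nP] := pselect P; first by right.
left.
(* The extra coordinate homogenizes the system: it multiplies y, and a solution in which it is
   positive is divided by it at the end. *)
pose a (i : V + 'I_1) (n : N + 'I_1) : R :=
  match i, n with inl v, inl n => p v n | inl v, inr _ => - y v
    | inr _, inl _ => 0 | inr _, inr _ => -1 end.
pose S : {set V + 'I_1} := [set i | match i with inl v => v \in F | _ => true end].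
pose E : {set V + 'I_1} := [set i | match i with inl v => v \in s | _ => false end].
have dotE x v : dot (a (inl v)) x = dot (fun n => x (inl n)) (p v) - x (inr ord0) * y v.
  rewrite /dot big_sumType big_ord1 /= mulNr [y v * _]mulrC; congr (_ - _).
  by apply: eq_bigr => n _; rewrite mulrC.
have dotT x : dot (a (inr ord0)) x = - x (inr ord0).
  rewrite /dot big_sumType big_ord1 /= mulN1r big1 ?add0r // => n _; by rewrite mul0r.
pose ok x := [/\ 0 <= x (inr ord0), forall v, v \in F -> dot (a (inl v)) x <= 0 &
  forall v, v \in s -> dot (a (inl v)) x = 0].
have cert (g : N + 'I_1 -> R) : (forall x, ok x -> dot g x <= 0) ->
    exists d : V -> R, [/\ forall v, v \notin F -> d v = 0, forall v, v \notin s -> 0 <= d v,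
      forall n, g (inl n) = \sum_v d v * p v n &
      g (inr ord0) <= - \sum_v d v * y v].
  move=> Hg; have [|l [l0 lS lE]] := @farkas_eq _ _ S E a g.
    move=> x xS xE; apply: Hg; split.
    - by have := xS (inr ord0); rewrite dotT inE oppr_le0 => ->.
    - by move=> v vF; apply: xS; rewrite inE.
    - by move=> v vs; apply: xE; rewrite inE.
  exists (fun v => l (inl v)); split.
  - move=> v vF; apply: lS; rewrite !inE negb_or vF /=; apply: contra vF; exact: (subsetP sF).
  - by move=> v vs; apply: l0; rewrite inE.
  - move=> n; rewrite lE big_sumType big_ord1 /= mulr0 addr0; by [].
  - rewrite lE big_sumType big_ord1 /= mulrN1 -sumrN.
    under eq_bigr do rewrite mulrN.
    by rewrite gerBl; apply: l0; rewrite inE.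
have base : exists2 x, ok x & 0 < x (inr ord0).
  apply: contrapT => nb; apply: nP.
  have [|d [d1 d2 d3 d4]] := cert (fun n => if n is inr _ then 1 else 0).
    move=> x okx; rewrite /dot big_sumType big_ord1 /= mul1r big1 ?add0r; last by move=> n _; rewrite mul0r.
    by rewrite leNgt; apply/negP => x0; apply: nb; exists x.
  have lt0 : \sum_v d v * y v < 0 by lra.
  by exists d; split=> //; [exact: ltW|left].
have strict v : v \in F :\: s -> exists2 x, ok x & dot (a (inl v)) x < 0.
  move=> vFs; apply: contrapT => nb; apply: nP.
  have [|d [d1 d2 d3 d4]] := cert (fun n => - a (inl v) n).
    move=> x okx; rewrite (_ : dot _ x = - dot (a (inl v)) x); last first.
      by rewrite /dot -sumrN; apply: eq_bigr => n _; rewrite mulNr.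
    by rewrite oppr_le0 leNgt; apply/negP => x0; apply: nb; exists x.
  move: vFs; rewrite inE => /andP[vs vF].
  have sumE (f : V -> R) : \sum_u (d u + (u == v)%:R) * f u = \sum_u d u * f u + f v.
    under eq_bigr do rewrite mulrDl; rewrite big_split /=; congr (_ + _).
    rewrite (bigD1 v) //= eqxx mul1r big1 ?addr0 // => u /negbTE ->; by rewrite mul0r.
  exists (fun u => d u + (u == v)%:R); split.
  - move=> u uF; rewrite d1 // add0r; case: eqP => // E'; by rewrite -E' (negbTE uF) in vF.
  - by move=> u us; rewrite addr_ge0 ?d2.
  - by move=> n; rewrite sumE -d3 /= addNr.
  - by rewrite sumE; move: d4; rewrite /= /a opprK; lra.
  - right; exists v; first by rewrite inE vs.
    by rewrite eqxx; apply: ltr_wpDl (d2 _ vs) ltr01.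
have /choice[xs Hxs] : forall v, exists x, v \in F :\: s -> ok x /\ dot (a (inl v)) x < 0.
  move=> v; have [/strict[x x1 x2]|] := boolP (v \in F :\: s); last by exists (fun=> 0).
  by exists x.
have [x0 ok0 x00] := base.
(* The sum of one solution for each strict inequality satisfies all of them strictly. *)
pose x n := x0 n + \sum_(v in F :\: s) xs v n.
have dx b : dot b x = dot b x0 + \sum_(v in F :\: s) dot b (xs v).
  rewrite /dot exchange_big /= -big_split /=; apply: eq_bigr => n _.
  by rewrite mulrDr mulr_sumr.
have xp : 0 < x (inr ord0).
  apply: ltr_wpDr x00; apply: sumr_ge0 => v vs; by have [[x1 _ _] _] := Hxs _ vs.
have [_ ok01 ok02] := ok0.
exists (fun n => x (inl n) / x (inr ord0)).
have dm v : dot (fun n => x (inl n) / x (inr ord0)) (p v) =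
    y v + dot (a (inl v)) x / x (inr ord0).
  rewrite dotE mulrBl mulrAC divff ?gt_eqF // mul1r addrC subrK.
  by rewrite /dot mulr_suml; apply: eq_bigr => n _; rewrite mulrAC.
split=> v vs; rewrite dm.
  rewrite dx ok02 // add0r big1 ?mul0r ?addr0 // => u us; by have [[_ _ x1] _] := Hxs _ us; rewrite x1.
rewrite gtrDl pmulr_llt0 ?invr_gt0 // dx.
have [vF v_s] : v \in F /\ v \notin s by move: vs; rewrite inE => /andP[].
rewrite (bigD1 v) //=.
have h1 : dot (a (inl v)) (xs v) < 0 by have [_] := Hxs _ vs.
have h2 := ok01 _ vF.
have h3 : \sum_(i in F :\: s | i != v) dot (a (inl v)) (xs i) <= 0.
  by apply: sumr_le0 => u /andP[us _]; have [[_ x1 _] _] := Hxs _ us; apply: x1.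
lra.
Qed.
End Farkas.

Lemma eq_ler (R : numDomainType) (x y : R) : x = y -> x <= y.
Proof. by move=> ->. Qed.

(** * Regular triangulations and their flips *)

Section Faces.
Variables (R : realType) (N V : finType) (X : {set N} -> Prop).
Variables (p : V -> N -> R) (e : N -> V).
Hypotheses (X0 : X set0) (Xsub : forall s t : {set N}, X s -> t \subset s -> X t)
  (X1 : forall n, X [set n]).
Hypotheses (p_ge0 : forall v n, 0 <= p v n) (p_sum1 : forall v, \sum_n p v n = 1)
  (pe : forall n m, p (e n) m = (m == n)%:R)
  (p_inj : forall u v, (forall n, p u n = p v n) -> u = v).

Definition carr (s : {set V}) : {set N} := [set n | [exists v in s, p v n != 0]].

Lemma carrS (s t : {set V}) : s \subset t -> carr s \subset carr t.
Proof.
move=> st; apply/subsetP => n; rewrite !inE => /exists_inP[v vs pv].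
by apply/exists_inP; exists v => //; apply: (subsetP st).
Qed.

(* The lower faces of the points p v, v in U, lifted to the heights w v, inside
   the geometric complex X. *)
Definition face (U : {set V}) (w : V -> R) (s : {set V}) : Prop :=
  [/\ s \subset U, X (carr s) & exists l : N -> R,
    (forall v, v \in s -> dot l (p v) = w v) /\
    (forall v, v \in U :\: s -> dot l (p v) < w v)].

(** Complementary slackness: the supporting functional of s lies weakly below all heights, so a
    combination of points of s is lowest over its point, and one of equal height can only use points
    of s. *)
Lemma face_opt U w s (t t' : V -> R) : face U w s ->
  (forall v, v \notin s -> t v = 0) ->
  (forall v, 0 <= t' v) -> (forall v, v \notin U -> t' v = 0) ->
  (forall n, \sum_v t v * p v n = \sum_v t' v * p v n) ->
  \sum_v t v * w v <= \sum_v t' v * w v /\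
  (\sum_v t' v * w v <= \sum_v t v * w v -> forall v, v \notin s -> t' v = 0).
Proof.
move=> [sU _ [l [l1 l2]]] ts t'0 t'U E.
have Et : \sum_v t v * w v = \sum_v t' v * dot l (p v).
  transitivity (\sum_v t v * dot l (p v)).
    apply: eq_bigr => v _; have [vs|vs] := boolP (v \in s); first by rewrite l1.
    by rewrite ts // !mul0r.
  by rewrite -!dot_sumr; apply: eq_bigr => n _; rewrite E.
have le v : 0 <= t' v * w v - t' v * dot l (p v).
  rewrite -mulrBr; have [vU|vU] := boolP (v \in U); last by rewrite t'U // mul0r.
  rewrite mulr_ge0 // subr_ge0; have [vs|vs] := boolP (v \in s); first by rewrite l1.
  by rewrite ltW // l2 // inE vs.
split; first by rewrite Et -subr_ge0 -sumrB sumr_ge0.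
rewrite Et -subr_ge0 -sumrB => H v vs.
have [vU|vU] := boolP (v \in U); last exact: t'U.
have : \sum_v (t' v * w v - t' v * dot l (p v)) == 0.
  rewrite eq_le sumr_ge0 // andbT -oppr_ge0 -sumrN.
  by apply: le_trans H _; apply: ler_sum => u _; rewrite opprB.
rewrite psumr_eq0 // => /allP/(_ v); rewrite mem_index_enum => /(_ isT).
rewrite -mulrBr mulf_eq0 subr_eq0 => /orP[/eqP //|/eqP E1].
by have := l2 v; rewrite inE vs vU E1 ltxx => /(_ isT).
Qed.

Lemma face_uniq U w s s' (t t' : V -> R) : face U w s -> face U w s' ->
  (forall v, 0 <= t v) -> (forall v, v \notin s -> t v = 0) ->
  (forall v, 0 <= t' v) -> (forall v, v \notin s' -> t' v = 0) ->
  (forall n, \sum_v t v * p v n = \sum_v t' v * p v n) ->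
  forall v, v \notin s -> t' v = 0.
Proof.
move=> fs fs' t0 ts t'0 t's E; have [sU _ _] := fs; have [s'U _ _] := fs'.
have tU v : v \notin U -> t v = 0 by move=> vU; apply: ts; apply: contra vU; apply: (subsetP sU).
have t'U v : v \notin U -> t' v = 0 by move=> vU; apply: t's; apply: contra vU; apply: (subsetP s'U).
have [_ H1] := face_opt fs ts t'0 t'U E.
have [H2 _] := face_opt fs' t's t0 tU (fun n => esym (E n)).
exact: H1.
Qed.

(* Linear programming duality for the lowest lifted point above x. *)
Lemma face_cover (U : {set V}) (w : V -> R) (x : N -> R) : (forall n, e n \in U) -> (forall n, 0 <= x n) ->
  X [set n | x n != 0] -> exists s t, [/\ face U w s, forall v, 0 <= t v,
    forall v, v \notin s -> t v = 0 & forall n, x n = \sum_v t v * p v n].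
Proof.
move=> eU x0 Xx.
(* [W] consists of the points supported inside the support of x; a convex combination equal to x can
   use no others. The remaining points are dealt with at the end, by lowering l off the support of
   x. *)
have [W [WU Wx eW Wn]] : exists W : {set V}, [/\ forall v, v \in W -> v \in U,
    forall v n, v \in W -> x n = 0 -> p v n = 0, forall n, x n != 0 -> e n \in W &
    forall v, v \in U -> v \notin W -> exists2 n, p v n != 0 & x n = 0].
  exists [set v in U | [forall n, (p v n != 0) ==> (x n != 0)]]; split.
  - by move=> v; rewrite inE => /andP[].
  - move=> v n; rewrite inE => /andP[_ /forallP/(_ n)/implyP H] xn; apply/eqP.
    by apply: contraTT isT => /H; rewrite xn eqxx.
  - move=> n xn; rewrite inE eU /=; apply/forallP => m; rewrite pe.
    by case: (m =P n) => [->|]; rewrite ?xn ?implybT // eqxx.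
  - move=> v vU; rewrite inE vU /= negb_forall => /existsP[n].
    by rewrite negb_imply negbK => /andP[pv /eqP xn]; exists n.
(* The columns are a functional l, coefficients t and a homogenizing coordinate z. The rows state in
   turn l . p u <= z w u, t u >= 0, that t represents z x, that the height of t is at most l . x,
   and z >= 0. A solution with z > 0 is an optimal primal and dual pair. *)
pose a (i : (V + V) + (N + ('I_1 + 'I_1))) (j : N + (V + 'I_1)) : R :=
  match i, j with
  | inl (inl u), inl n => p u n | inl (inl u), inr (inr _) => - w u
  | inl (inr u), inr (inl v) => - (u == v)%:R
  | inr (inl n), inr (inl u) => if u \in W then p u n else 0
  | inr (inl n), inr (inr _) => - x n
  | inr (inr (inl _)), inl n => - x n
  | inr (inr (inl _)), inr (inl u) => if u \in W then w u else 0
  | inr (inr (inr _)), inr (inr _) => -1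
  | _, _ => 0 end.
pose S : {set (V + V) + (N + ('I_1 + 'I_1))} := [set i | match i with
  | inl (inl u) => u \in W | inr (inl _) => false | _ => true end].
pose E : {set (V + V) + (N + ('I_1 + 'I_1))} := [set i | if i is inr (inl _) then true else false].
pose g (j : N + (V + 'I_1)) : R := if j is inr (inr _) then 1 else 0.
have dotE (b y : N + (V + 'I_1) -> R) : dot b y = \sum_n b (inl n) * y (inl n) +
    (\sum_u b (inr (inl u)) * y (inr (inl u)) + b (inr (inr ord0)) * y (inr (inr ord0))).
  by rewrite /dot !big_sumType big_ord1.
have s0 (I : finType) (F : I -> R) : \sum_i 0 * F i = 0.
  by rewrite big1 // => i _; rewrite mul0r.
have [H|] := pselect (forall y, (forall i, i \in S -> dot (a i) y <= 0) ->
    (forall i, i \in E -> dot (a i) y = 0) -> dot g y <= 0).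
  have [c [c0 cS cE]] := farkas_eq H.
  have cge i : ~~ (if i is inr (inl _) then true else false) -> 0 <= c i.
    by move=> h; apply: c0; rewrite inE.
  have cW u : u \notin W -> c (inl (inl u)) = 0.
    by move=> uW; apply: cS; rewrite !inE negb_or uW.
  set dl := c (inr (inr (inl ord0))).
  have sE (F : (V + V) + (N + ('I_1 + 'I_1)) -> R) : \sum_i F i = \sum_u F (inl (inl u)) +
      \sum_u F (inl (inr u)) + (\sum_n F (inr (inl n)) + (F (inr (inr (inl ord0))) + F (inr (inr (inr ord0))))).
    by rewrite !big_sumType !big_ord1.
  have s1 (I : finType) (F : I -> R) : \sum_i F i * 0 = 0.
    by rewrite big1 // => i _; rewrite mulr0.
  have E1 n : \sum_u c (inl (inl u)) * p u n = dl * x n.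
    have := cE (inl n); rewrite sE /= !s1 !mulr0 !addr0 add0r mulrN => /eqP.
    by rewrite eq_sym subr_eq0 => /eqP.
  have E2 u : u \in W -> c (inl (inr u)) = \sum_n c (inr (inl n)) * p u n + dl * w u.
    move=> uW; have := cE (inr (inl u)); rewrite sE /= !s1 !mulr0 !addr0 add0r uW.
    rewrite (bigD1 u) //= eqxx mulrN1 big1 ?addr0; last first.
      by move=> v /negbTE ->; rewrite oppr0 mulr0.
    by move=> /eqP; rewrite eq_sym addrC subr_eq0 => /eqP.
  have E3 : 1 = - \sum_u c (inl (inl u)) * w u - \sum_n c (inr (inl n)) * x n - c (inr (inr (inr ord0))).
    have := cE (inr (inr ord0)); rewrite sE /= !s1 !mulr0 !addr0 add0r mulrN1 => ->.
    by rewrite -!sumrN addrA; congr (_ + _ + _); apply: eq_bigr => i _; rewrite mulrN.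
  have gz := cge (inr (inr (inr ord0))) isT.
  have gd : 0 <= dl := cge (inr (inr (inl ord0))) isT.
  pose ga n := c (inr (inl n)).
  have H2 : 0 <= \sum_u c (inl (inl u)) * (\sum_n ga n * p u n + dl * w u).
    apply: sumr_ge0 => u _; have [uW|uW] := boolP (u \in W).
      by rewrite -E2 //; apply: mulr_ge0; apply: cge.
    by rewrite cW // mul0r.
  have H3 : \sum_u c (inl (inl u)) * (\sum_n ga n * p u n + dl * w u) =
      dl * (\sum_n ga n * x n + \sum_u c (inl (inl u)) * w u).
    under eq_bigr do rewrite mulrDr.
    rewrite big_split /= mulrDr; congr (_ + _).
      rewrite mulr_sumr; under eq_bigr do rewrite mulr_sumr.
      rewrite exchange_big /=; apply: eq_bigr => n _.
      rewrite mulrCA -E1 mulr_sumr; apply: eq_bigr => u _; by rewrite mulrCA.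
    by rewrite mulr_sumr; apply: eq_bigr => u _; rewrite mulrCA.
  have neg : \sum_n ga n * x n + \sum_u c (inl (inl u)) * w u < 0.
    move: E3; rewrite /ga; lra.
  (* Otherwise there are Farkas multipliers. If [dl] is positive they violate weak duality; if it is
     0, only the [ga] remain, and the points [e n] force these to be nonnegative on the support of
     x. *)
  have [d0|dn] := eqVneq dl 0; last first.
    have dp : 0 < dl by rewrite lt_neqAle eq_sym dn.
    by move: H2; rewrite H3 pmulr_rge0 // leNgt neg.
  have c00 u : c (inl (inl u)) = 0.
    have : \sum_n \sum_u c (inl (inl u)) * p u n = 0.
      by apply: big1 => n _; rewrite E1 d0 mul0r.
    rewrite exchange_big /=; under eq_bigr do rewrite -mulr_sumr p_sum1 mulr1.
    move/eqP; rewrite psumr_eq0; last by move=> v _; apply: cge.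
    by move=> /allP/(_ u); rewrite mem_index_enum => /(_ isT)/eqP.
  move: neg; rewrite [X in _ + X]big1; last by move=> u _; rewrite c00 mul0r.
  rewrite addr0 ltNge sumr_ge0 // => n _.
  have [->|xn] := eqVneq (x n) 0; first by rewrite mulr0.
  apply: mulr_ge0 => //.
  have := cge (inl (inr (e n))) isT; rewrite E2 ?eW // d0 mul0r addr0.
  rewrite (bigD1 n) //= pe eqxx mulr1 big1 ?addr0 // => m /negbTE; by rewrite pe => ->; rewrite mulr0.
move=> /existsNP[y] /not_implyP[yS /not_implyP[yE /negP]]; rewrite -ltNge => gy.
set z := y (inr (inr ord0)).
have z0 : 0 < z.
  by move: gy; rewrite dotE /= !s0 !add0r mul1r.
pose l n := y (inl n) / z.
pose t u := if u \in W then y (inr (inl u)) / z else 0.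
have t0 u : 0 <= t u.
  rewrite /t; case: ifP => // uW; apply: divr_ge0 (ltW z0).
  have := yS (inl (inr u)); rewrite inE => /(_ isT); rewrite dotE /= s0 mul0r addr0 add0r.
  rewrite (bigD1 u) //= eqxx mulN1r big1 ?addr0 ?oppr_le0 // => v.
  by rewrite eq_sym => /negbTE ->; rewrite oppr0 mul0r.
have xt n : x n = \sum_u t u * p u n.
  have := yE (inr (inl n)); rewrite inE => /(_ isT); rewrite dotE /= s0 add0r -/z mulNr.
  move=> /eqP; rewrite subr_eq0 => /eqP E1.
  apply: (mulIf (lt0r_neq0 z0)); rewrite -E1 mulr_suml; apply: eq_bigr => u _.
  rewrite /t; case: ifP => _; last by rewrite !mul0r.
  by rewrite mulrAC divfK ?lt0r_neq0 // mulrC.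
have lw u : u \in W -> dot l (p u) <= w u.
  move=> uW; have := yS (inl (inl u)); rewrite inE => /(_ uW); rewrite dotE /= s0 add0r -/z.
  rewrite mulNr subr_le0 => H; rewrite -(ler_pM2r z0).
  rewrite /dot mulr_suml; apply: le_trans H; apply: eq_ler; apply: eq_bigr => n _.
  by rewrite /l mulrAC divfK ?lt0r_neq0 // mulrC.
have tw : \sum_u t u * w u <= dot l x.
  have := yS (inr (inr (inl ord0))); rewrite inE => /(_ isT); rewrite dotE /= mul0r addr0.
  under eq_bigr do rewrite mulNr.
  rewrite sumrN addrC subr_le0 => H.
  rewrite -(ler_pM2r z0) /dot !mulr_suml.
  apply: le_trans (le_trans H _); apply: eq_ler; apply: eq_bigr => i _.
    rewrite /t; case: ifP => _; last by rewrite !mul0r.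
    by rewrite mulrAC divfK ?lt0r_neq0 // mulrC.
  by rewrite /l mulrAC divfK ?lt0r_neq0 // mulrC.
have tight u : t u != 0 -> dot l (p u) = w u.
  have le v : 0 <= t v * w v - t v * dot l (p v).
    rewrite -mulrBr; have [vW|vW] := boolP (v \in W); last by rewrite /t (negbTE vW) mul0r.
    by rewrite mulr_ge0 // subr_ge0 lw.
  have : \sum_v (t v * w v - t v * dot l (p v)) == 0.
    rewrite eq_le sumr_ge0 // andbT sumrB subr_le0; apply: le_trans tw _.
    by rewrite -dot_sumr; apply: eq_ler; apply: eq_bigr => n _; rewrite -xt.
  rewrite psumr_eq0 // => /allP/(_ u); rewrite mem_index_enum => /(_ isT).
  by rewrite -mulrBr mulf_eq0 subr_eq0 => /orP[/eqP->|/eqP ->] //; rewrite eqxx.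
exists [set u in W | dot l (p u) == w u], t; split=> //; last first.
  move=> v; rewrite inE negb_and => vs; apply/eqP; apply: contraTT vs => tv.
  by rewrite tight // eqxx orbF negbK; move: tv; rewrite /t; case: ifP => // _; rewrite eqxx.
split.
- by apply/subsetP => u; rewrite inE => /andP[/WU].
- apply: (Xsub Xx); apply/subsetP => n; rewrite !inE => /exists_inP[v].
  rewrite inE => /andP[vW _] pv; apply: contra pv => /eqP xn.
  by rewrite (Wx _ _ vW xn).
(* The mass of [p v] outside the support of x: zero on [W] and positive on the rest of U.
   Subtracting a large M from l outside this support thus makes the inequalities off [W] strict and
   leaves those on [W] unchanged. *)
pose off v := \sum_(n | x n == 0) p v n.
have offp v : v \in U :\: W -> 0 < off v.
  rewrite inE => /andP[vW vU]; have [n pv /eqP xn] := Wn _ vU vW.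
  rewrite /off (bigD1 n) //=; apply: ltr_wpDr; first exact: sumr_ge0.
  by rewrite lt0r pv p_ge0.
pose M := \sum_(v in U :\: W) `|dot l (p v) - w v| / off v + 1.
exists (fun n => l n - (if x n == 0 then M else 0)).
have dl v : dot (fun n => l n - (if x n == 0 then M else 0)) (p v) = dot l (p v) - M * off v.
  have -> : M * off v = \sum_n (if x n == 0 then M * p v n else 0).
    by rewrite /off mulr_sumr big_mkcond.
  rewrite /dot -sumrB; apply: eq_bigr => n _.
  by rewrite mulrBl; case: ifP => // _; rewrite mul0r.
have dW v : v \in W -> off v = 0.
  by move=> vW; apply: big1 => n /eqP; apply: Wx.
split=> v; rewrite dl.
  by rewrite inE => /andP[vW /eqP->]; rewrite dW // mulr0 subr0.
rewrite !inE => /andP[n1 n2]; have [vW|vW] := boolP (v \in W).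
  rewrite dW // mulr0 subr0 lt_neqAle lw // andbT.
  by move: n1; rewrite vW.
have vUW : v \in U :\: W by rewrite inE vW.
have h : `|dot l (p v) - w v| < M * off v.
  rewrite -ltr_pdivrMr ?offp // /M (bigD1 v) //= -addrA ltrDl.
  apply: ltr_wpDl ltr01; apply: sumr_ge0 => u /andP[uUW _].
  by apply: divr_ge0 => //; apply/ltW/offp.
have := ler_norm (dot l (p v) - w v); lra.
Qed.

End Faces.

(** * Flips of families of subsets of a finite type *)

Section FlipS.
Variable V : finType.
Implicit Types (A B s : {set V}) (T : {set V} -> Prop).

Definition flipS A B T s := (T s /\ ~~ (A \subset s)) \/
  [/\ B \subset s, ~~ (A \subset s) & T ((s :\: B) :|: A)].

Record flip_okS A B T : Prop := FlipOkS {
  flipS_A0 : A != set0;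
  flipS_B0 : B != set0;
  flipS_dis : [disjoint A & B];
  flipS_A : T A;
  flipS_B : ~ T B;
  flipS_link : forall s b, T s -> A \subset s -> b \in B -> T ((s :|: B) :\ b) }.

Inductive feqS : ({set V} -> Prop) -> ({set V} -> Prop) -> Prop :=
| feqS_refl T : feqS T T
| feqS_step A B T T' : flip_okS A B T -> (3 <= #|A| + #|B|)%N ->
    feqS (flipS A B T) T' -> feqS T T'.

Lemma feqS_trans T1 T2 T3 : feqS T1 T2 -> feqS T2 T3 -> feqS T1 T3.
Proof.
move=> H; elim: H T3 => {T1 T2} [//|A B T T' ok c _ IH] T3 H3.
by apply: feqS_step ok c _; apply: IH.
Qed.
End FlipS.

Lemma exists_eps (R : realFieldType) (I : finType) (P : I -> R -> Prop) :
  (forall i, exists2 eps, 0 < eps & forall d, 0 < d -> d < eps -> P i d) ->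
  exists2 eps, 0 < eps & forall d, 0 < d -> d < eps -> forall i, P i d.
Proof.
move=> H; have /choice[f Hf] : forall i, exists eps, 0 < eps /\ forall d, 0 < d -> d < eps -> P i d.
  by move=> i; have [eps e0 He] := H i; exists eps.
have f0 i : 0 < f i by have [] := Hf i.
have s0 : 0 <= \sum_i (f i)^-1 by apply: sumr_ge0 => i _; rewrite invr_ge0 ltW.
(* This lies below every threshold and is positive also for empty [I]. *)
exists (1 + \sum_i (f i)^-1)^-1; first by rewrite invr_gt0; lra.
move=> d d0 dl i; have [_] := Hf i; apply=> //; apply: lt_le_trans dl _.
rewrite -[leRHS]invrK lef_pV2 ?posrE ?invr_gt0 //; last by lra.
rewrite (bigD1 i) //= addrCA lerDl addr_ge0 //.
by apply: sumr_ge0 => j _; rewrite invr_ge0 ltW.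
Qed.

Section Sweep.
Variables (R : realType) (N V : finType) (X : {set N} -> Prop).
Variables (p : V -> N -> R) (e : N -> V).
Hypotheses (X0 : X set0) (Xsub : forall s t : {set N}, X s -> t \subset s -> X t)
  (X1 : forall n, X [set n]).
Hypotheses (p_ge0 : forall v n, 0 <= p v n) (p_sum1 : forall v, \sum_n p v n = 1)
  (pe : forall n m, p (e n) m = (m == n)%:R)
  (p_inj : forall u v, (forall n, p u n = p v n) -> u = v).

Definition indep (s : {set V}) := forall d : V -> R, (forall v, v \notin s -> d v = 0) ->
  (forall n, \sum_v d v * p v n = 0) -> forall v, d v = 0.

Notation face := (face X p).

Definition simplicial U w := forall F, face U w F -> indep F.

(* The vertex v0 is added at height c, which is then lowered from +oo.  At a
   critical height c the faces may be affinely dependent, with a unique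
   dependence d normalized by d v0 = 1; the two signs of d are the sides of a
   circuit. *)
Section Step.
Variables (U : {set V}) (v0 : V) (w : V -> R).
Hypotheses (v0U : v0 \notin U) (eU : forall n, e n \in U) (simp0 : simplicial U w).

Implicit Types (F s t : {set V}) (c : R) (b : bool).

Let U' := v0 |: U.
Definition wc c v := if v == v0 then c else w v.
Definition Tb c F := face U' (wc c) F.

Lemma Tb_del c F : Tb c F -> face U w (F :\ v0).
Proof.
move=> [FU XF [l [l1 l2]]]; split.
- apply/subsetP => v; rewrite !inE => /andP[vv vF].
  by have := subsetP FU _ vF; rewrite !inE (negbTE vv).
- by apply: (Xsub XF); apply: carrS; apply: subD1set.
- exists l; split=> v.
    rewrite !inE => /andP[vv /l1]; by rewrite /wc (negbTE vv).
  rewrite !inE negb_and negbK => /andP[vF vU].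
  have vv : v != v0 by apply: contraNneq v0U => <-.
  move: vF; rewrite (negbTE vv) /= => vF.
  by have := l2 v; rewrite /wc (negbTE vv); apply; rewrite !inE vF vU orbT.
Qed.

Definition dep F (d : V -> R) := [/\ forall v, v \notin F -> d v = 0,
  forall n, \sum_v d v * p v n = 0 & d v0 = 1].

Lemma Tb_v0 c F (d : V -> R) : Tb c F -> (forall v, v \notin F -> d v = 0) ->
  (forall n, \sum_v d v * p v n = 0) -> d v0 = 0 -> forall v, d v = 0.
Proof.
move=> /Tb_del/simp0 H dF d0 dv; apply: H => // v; rewrite !inE negb_and negbK.
by case/orP=> [/eqP->|/dF].
Qed.

(** The difference of two normalized dependences vanishes at v0, hence lives on F - v0, which is a
    face of the simplicial complex on U. *)
Lemma dep_uniq c F d d' : Tb c F -> dep F d -> dep F d' -> d = d'.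
Proof.
move=> TF [d1 d2 d3] [d1' d2' d3']; apply/funext => v; apply/eqP; rewrite -subr_eq0; apply/eqP.
apply: (@Tb_v0 c F (fun v => d v - d' v)) => // [u uF|n|].
- by rewrite d1 // d1' // subrr.
- under eq_bigr do rewrite mulrBl; by rewrite sumrB d2 d2' subrr.
- by rewrite d3 d3' subrr.
Qed.

Lemma dep_scale c F (d : V -> R) : Tb c F -> (forall v, v \notin F -> d v = 0) ->
  (forall n, \sum_v d v * p v n = 0) -> d v0 != 0 -> dep F (fun v => d v / d v0).
Proof.
move=> TF d1 d2 d3; split; last by rewrite divff.
  by move=> v vF; rewrite d1 // mul0r.
move=> n; under eq_bigr do rewrite mulrAC; by rewrite -mulr_suml d2 mul0r.
Qed.

Definition sgn (b : bool) : R := if b then 1 else -1.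
Definition side b (d : V -> R) : {set V} := [set v | 0 < sgn b * d v].

(* The triangulation just above (b = true) or just below (b = false) height c;
   see Tq_near. *)
Definition Tq b c s := exists F, [/\ Tb c F, s \subset F &
  forall d, dep F d -> ~~ (side b d \subset s)].

Lemma Tq_sub b c s t : Tq b c s -> t \subset s -> Tq b c t.
Proof.
move=> [F [F1 F2 F3]] ts; exists F; split=> //; first exact: subset_trans F2.
move=> d dF; apply: contra (F3 _ dF) => H; exact: subset_trans ts.
Qed.

(** The tilt comes from [motzkin] with the indicator of v0, up to sign, as rate. The obstructing
    dependence, normalized at v0, would have its [b] side inside s, which [Tq] forbids. Points
    outside F keep a positive distance for small changes. *)
Lemma Tq_pert b c s : Tq b c s ->
  exists2 eps, 0 < eps & forall dl, 0 < dl -> dl < eps -> Tb (c + sgn b * dl) s.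
Proof.
move=> [F [TF sF Fd]]; have [FU XF [l [l1 l2]]] := TF.
pose y v := sgn b * (v == v0)%:R.
have wE dl v : wc (c + sgn b * dl) v = wc c v + dl * y v.
  rewrite /wc /y; case: eqP => _; first by rewrite mulr1 mulrC.
  by rewrite mulr0 mulr0 addr0.
have [[m [m1 m2]]|[d [d1 d2 d3 d4 d5]]] := motzkin p y sF; last first.
  have E : \sum_v d v * y v = sgn b * d v0.
    rewrite (bigD1 v0) //= /y eqxx mulr1 mulrC big1 ?addr0 // => v /negbTE ->.
    by rewrite !mulr0.
  rewrite E in d4 d5.
  have dv : d v0 != 0.
    apply/eqP => dv; have d0 := Tb_v0 TF d1 d3 dv.
    by case: d5 => [|[v _]]; rewrite ?d0 ?mulr0 ltxx.
  have sd : sgn b * d v0 < 0.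
    rewrite lt_neqAle d4 andbT mulf_neq0 // /sgn; case: (b) => //.
      by rewrite oner_neq0.
    by rewrite oppr_eq0 oner_neq0.
  have /negP[] := Fd _ (dep_scale TF d1 d3 dv).
  apply/subsetP => v; rewrite inE => sv; apply: contraTT isT => vs.
  have dv' := d2 _ vs; move: sv.
  have -> : sgn b * (d v / d v0) = (sgn b * d v0) * (d v / d v0 ^+ 2) by field.
  by rewrite ltNge mulr_le0_ge0 // ?(ltW sd) // divr_ge0 // sqr_ge0.
have : forall v, exists2 eps, 0 < eps & forall dl, 0 < dl -> dl < eps ->
    v \in U' :\: F -> dot l (p v) + dl * dot m (p v) < wc c v + dl * y v.
  move=> v; have [vF|vF] := boolP (v \in U' :\: F); last by exists 1.
  have g0 : 0 < wc c v - dot l (p v) by rewrite subr_gt0 l2.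
  set a := dot m (p v) - y v.
  have a0 : 0 < `|a| + 1 by rewrite ltr_wpDl.
  exists ((wc c v - dot l (p v)) / (`|a| + 1)); first by rewrite divr_gt0.
  move=> dl dl0; rewrite ltr_pdivlMr // => H _.
  have : dl * a <= dl * `|a| by rewrite ler_pM2l // ler_norm.
  move: H; rewrite mulrDr mulr1 {3}/a mulrBr; lra.
move=> /exists_eps[eps e0 He]; exists eps => // dl dl0 dle; split.
- exact: subset_trans FU.
- by apply: (Xsub XF); apply: carrS.
- exists (fun n => l n + dl * m n); split=> v vs; rewrite dotDZl wE.
    by rewrite m1 // l1 //; apply: (subsetP sF).
  have [vF|vF] := boolP (v \in F).
    by rewrite l1 // ltrD2l ltr_pM2l // m2 // inE vF andbT; move: vs; rewrite inE => /andP[].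
  by apply: He => //; move: vs; rewrite !inE vF => /andP[].
Qed.

Lemma sgn_neq0 b : sgn b != 0.
Proof. by rewrite /sgn; case: b; rewrite ?oppr_eq0 oner_neq0. Qed.

Lemma side_neq0 b F d : dep F d -> exists v, v \in side b d.
Proof.
move=> [d1 d2 d3]; case: b; first by exists v0; rewrite inE /sgn mul1r d3.
apply: contrapT => nv.
have ge v : 0 <= d v.
  by rewrite leNgt; apply/negP => dv; apply: nv; exists v; rewrite inE /sgn mulN1r oppr_gt0.
have : \sum_v d v = 0.
  have : \sum_n \sum_v d v * p v n = 0 by apply: big1 => n _.
  by rewrite exchange_big /=; under eq_bigr do rewrite -mulr_sumr p_sum1 mulr1.
by move/eqP; rewrite psumr_eq0 // => /allP/(_ v0); rewrite mem_index_enum d3 oner_eq0 => /(_ isT).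
Qed.

(** A point of a face F at height c is rewritten by subtracting a multiple of the dependence of F.
    The smallest ratio of coefficients on the [b] side is where the first of these coefficients
    vanishes, and then s no longer contains that side. *)
Lemma Tq_cover b c (x : N -> R) : (forall n, 0 <= x n) -> X [set n | x n != 0] ->
  exists s (t : V -> R), [/\ Tq b c s, forall v, 0 <= t v,
    forall v, v \notin s -> t v = 0 & forall n, x n = \sum_v t v * p v n].
Proof.
move=> x0 Xx.
have eU' n : e n \in U' by rewrite inE eU orbT.
have [F [t [TF t0 tF xt]]] := face_cover Xsub p_ge0 p_sum1 pe (wc c) eU' x0 Xx.
have [[d dd]|nd] := pselect (exists d, dep F d); last first.
  by exists F, t; split=> //; exists F; split=> // d dd; case: nd; exists d.
have [v1 v1D] := side_neq0 b dd.
case: (@arg_minP _ _ _ v1 (mem (side b d)) (fun v => t v / (sgn b * d v)) v1D) => v2 v2D0 min.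
have v2D : v2 \in side b d := v2D0.
set th := t v2 / (sgn b * d v2) in min.
have d20 : 0 < sgn b * d v2 by move: v2D; rewrite inE.
have th0 : 0 <= th by rewrite divr_ge0 // ltW.
have [d1 d2 d3] := dd.
pose t' v := t v - th * (sgn b * d v).
exists (F :\ v2), t'; split.
- exists F; split=> //; first exact: subD1set.
  move=> d' /(dep_uniq TF dd) <-; apply/negP => /subsetP/(_ _ v2D).
  by rewrite !inE eqxx.
- move=> v; rewrite /t' subr_ge0; have [vD|vD] := boolP (v \in side b d).
    have := min _ vD; rewrite ler_pdivlMr //; by move: vD; rewrite inE.
  apply: le_trans (t0 v); apply: mulr_ge0_le0 => //.
  by move: vD; rewrite inE -leNgt.
- move=> v; rewrite !inE negb_and negbK => /orP[/eqP->|vF].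
    by rewrite /t' /th divfK ?subrr // gt_eqF.
  by rewrite /t' tF // d1 // !mulr0 subrr.
- move=> n; rewrite xt /t'.
  under [RHS]eq_bigr do rewrite mulrBl.
  rewrite sumrB (_ : \sum_v th * _ * _ = 0) ?subr0 //.
  under eq_bigr do rewrite mulrA -mulrA.
  by rewrite -mulr_sumr d2 mulr0.
Qed.

(** One inclusion is [Tq_pert]. For the other, an interior point of a face s at the nearby height is
    covered by some s' in [Tq], which is a face at that height too; uniqueness of the lowest
    combination puts s inside s'. *)
Lemma Tq_near b c : exists2 eps, 0 < eps & forall dl, 0 < dl -> dl < eps ->
  Tb (c + sgn b * dl) = Tq b c.
Proof.
have : forall s, exists2 eps, 0 < eps & forall dl, 0 < dl -> dl < eps ->
    Tq b c s -> Tb (c + sgn b * dl) s.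
  move=> s; have [Ts|nT] := pselect (Tq b c s); last by exists 1.
  by have [eps e0 He] := Tq_pert Ts; exists eps => // *; apply: He.
move=> /exists_eps[eps e0 He]; exists eps => // dl dl0 dle.
apply/predeqP => s; split; last exact: He.
move=> Ts; have [_ Xs _] := Ts.
pose x n := \sum_(v in s) p v n.
have x0 n : 0 <= x n by apply: sumr_ge0.
have Xx : X [set n | x n != 0].
  apply: (Xsub Xs); apply/subsetP => n; rewrite !inE; apply: contraR.
  rewrite negb_exists => /forallP H; rewrite /x big1 // => v vs.
  by have := H v; rewrite vs negbK => /eqP.
have [s' [t [Ts' t0 ts xt]]] := Tq_cover b c x0 Xx.
have Fs' := He _ dl0 dle _ Ts'.
pose t1 v : R := (v \in s)%:R.
have xt1 n : x n = \sum_v t1 v * p v n.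
  rewrite /x big_mkcond; apply: eq_bigr => v _; rewrite /t1; case: ifP; by rewrite ?mul1r ?mul0r.
apply: (Tq_sub Ts'); apply/subsetP => v vs; apply: contraTT isT => vs'.
have : t1 v = 0.
  apply: (face_uniq Fs' Ts t0 ts _ _ _ vs') => [u|u|n].
  - by rewrite /t1 ler0n.
  - by rewrite /t1 => /negbTE ->.
  - by rewrite -xt xt1.
by rewrite /t1 vs => /eqP; rewrite oner_eq0.
Qed.

Lemma dep_zero c F d : Tb c F -> dep F d -> \sum_v d v * wc c v = 0.
Proof.
move=> [_ _ [l [l1 _]]] [d1 d2 _].
transitivity (\sum_v d v * dot l (p v)).
  apply: eq_bigr => v _; have [vF|vF] := boolP (v \in F); first by rewrite l1.
  by rewrite d1 // !mul0r.
rewrite -dot_sumr /dot big1 // => n _; by rewrite d2 mulr0.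
Qed.

(** A face containing one side of a circuit contains the other as well: the gaps between heights and
    functional, weighted by d, sum to zero; they vanish on the given side, and on the other side
    they all have one sign. *)
Lemma dep_face c b F0 F d : Tb c F0 -> dep F0 d -> Tb c F -> side b d \subset F -> dep F d.
Proof.
move=> TF0 dd TF sF; have E0 := dep_zero TF0 dd.
have [d1 d2 d3] := dd; have [FU' _ _] := TF0; have [FU XF [l [l1 l2]]] := TF.
have El : \sum_v d v * dot l (p v) = 0.
  by rewrite -dot_sumr /dot big1 // => n _; rewrite d2 mulr0.
have le v : v \in U' -> 0 <= wc c v - dot l (p v).
  move=> vU; rewrite subr_ge0; have [vF|vF] := boolP (v \in F); first by rewrite l1.
  by rewrite ltW // l2 // inE vF.
have ge v : 0 <= - (sgn b * d v * (wc c v - dot l (p v))).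
  have [vU|vU] := boolP (v \in U'); last first.
    by rewrite d1 ?mulr0 ?mul0r ?oppr0 //; apply: contra vU; apply: (subsetP FU').
  have [vs|vs] := boolP (v \in side b d).
    by rewrite l1 ?subrr ?mulr0 ?oppr0 //; apply: (subsetP sF).
  rewrite oppr_ge0 mulr_le0_ge0 ?le //; by move: vs; rewrite inE -leNgt.
have S0 : \sum_v - (sgn b * d v * (wc c v - dot l (p v))) == 0.
  rewrite sumrN oppr_eq0; apply/eqP.
  transitivity (sgn b * (\sum_v d v * wc c v - \sum_v d v * dot l (p v))).
    rewrite -sumrB mulr_sumr; apply: eq_bigr => v _; ring.
  by rewrite E0 El subrr mulr0.
split=> // v vF; apply/eqP; apply: contraTT isT => dv.
move: S0; rewrite psumr_eq0 // => /allP/(_ v); rewrite mem_index_enum => /(_ isT).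
rewrite /= oppr_eq0 !mulf_eq0 (negbTE (sgn_neq0 b)) (negbTE dv) /= subr_eq0 => /eqP E.
have vU : v \in U'.
  apply: (subsetP FU'); by apply: contraNT dv => /d1 ->.
by have := l2 v; rewrite inE vF vU E ltxx => /(_ isT).
Qed.

Definition circ c (C : {set V} * {set V}) := exists F d,
  [/\ Tb c F, dep F d, C.1 = side false d & C.2 = side true d].

(* Between Tq true c and Tq false c: the circuits in S have been flipped. *)
Definition TS c (S : seq ({set V} * {set V})) s := exists F, [/\ Tb c F, s \subset F &
  forall d, dep F d -> ~~ (side ((side false d, side true d) \notin S) d \subset s)].

Lemma side_dis d : [disjoint side false d & side true d].
Proof.
rewrite -setI_eq0; apply/eqP/setP => v; rewrite !inE /sgn mul1r mulN1r oppr_gt0.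
by apply/negP => /andP[h1 h2]; have := lt_trans h1 h2; rewrite ltxx.
Qed.

(** By [dep_face], the faces at height c that contain one side of C are those on which the
    dependence of C lives, so flipping C exactly exchanges which of its two sides is forbidden. *)
Lemma TS_flip c S C : circ c C -> C \notin S ->
  [/\ flip_okS C.1 C.2 (TS c S), (3 <= #|C.1| + #|C.2|)%N &
      flipS C.1 C.2 (TS c S) = TS c (C :: S)].
Proof.
case: C => A B [F0 [d0 [/= TF0 dd0 EA EB]]] CS; subst A B.
set A := side false d0; set B := side true d0.
have dAB : [disjoint A & B] by apply: side_dis.
have [a aA] : exists v, v \in A by apply: (side_neq0 false dd0).
have [b bB] : exists v, v \in B by apply: (side_neq0 true dd0).
have A0 : A != set0 by apply/set0Pn; exists a.
have B0 : B != set0 by apply/set0Pn; exists b.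
have sideF b' F d : dep F d -> side b' d \subset F.
  move=> [d1 _ _]; apply/subsetP => v; rewrite inE; apply: contraTT => /d1 ->.
  by rewrite mulr0 ltxx.
have FA F : Tb c F -> A \subset F -> dep F d0 by move=> TF; apply: (dep_face TF0 dd0 TF).
have FB F : Tb c F -> B \subset F -> dep F d0 by move=> TF; apply: (dep_face TF0 dd0 TF).
have uniq F d : Tb c F -> dep F d0 -> dep F d -> d = d0.
  by move=> TF h1 h2; apply: (dep_uniq TF).
have nBA : ~~ (B \subset A).
  by apply/negP => /subsetP/(_ _ bB) bA; have := disjointFr dAB bA; rewrite bB.
split.
- split=> //.
  + exists F0; split=> //; first exact: sideF.
    move=> d /(uniq _ _ TF0 dd0) ->; by rewrite CS.
  + move=> [F [TF BF Fd]]; have := Fd _ (FB _ TF BF); by rewrite CS subxx.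
  + move=> s b' [F [TF sF Fd]] As b'B.
    have dF := FA _ TF (subset_trans As sF); exists F; split=> //.
      apply: (subset_trans (subD1set _ _)); rewrite subUset sF; exact: sideF.
    move=> d /(uniq _ _ TF dF) ->; rewrite CS; apply/negP => /subsetP/(_ _ b'B).
    by rewrite !inE eqxx.
- have cA : (0 < #|A|)%N by rewrite card_gt0.
  have cB : (0 < #|B|)%N by rewrite card_gt0.
  (* A circuit with one point on each side would make two points of V coincide, against [p_inj]. *)
  rewrite leqNgt; apply/negP => h.
  have [d1 d2 d3] := dd0.
  have cA1 : #|A| == 1%N by move: h; rewrite -/A -/B; lia.
  have cB1 : #|B| == 1%N by move: h; rewrite -/A -/B; lia.
  have v0B : v0 \in B by rewrite inE /sgn mul1r d3.
  have Bv v : v \in B -> v = v0.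
    by move/cards1P: cB1 v0B => [u ->]; rewrite !inE => /eqP-> /eqP->.
  have Av v : v \in A -> v = a.
    by move/cards1P: cA1 aA => [u ->]; rewrite !inE => /eqP-> /eqP->.
  have av : a != v0.
    by apply/eqP => E; have := disjointFr dAB aA; rewrite E v0B.
  have dz v : v != v0 -> v != a -> d0 v = 0.
    move=> h1 h2; apply/eqP; rewrite eq_le; apply/andP; split; rewrite leNgt; apply/negP => h3.
      by move: h1; rewrite (Bv v) ?eqxx // inE /sgn mul1r.
    by move: h2; rewrite (Av v) ?eqxx // inE /sgn mulN1r oppr_gt0.
  have sumE (f : V -> R) : \sum_v d0 v * f v = f v0 + d0 a * f a.
    rewrite (bigD1 v0) //= d3 mul1r (bigD1 a) //= big1 ?addr0 // => v /andP[h1 h2].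
    by rewrite dz // mul0r.
  have dE : d0 a = -1.
    have : \sum_v d0 v * (\sum_n p v n) = 0.
      under eq_bigr do rewrite mulr_sumr; rewrite exchange_big /= big1 // => n _.
    by rewrite sumE !p_sum1; lra.
  suff : v0 = a by move=> E; rewrite E eqxx in av.
  apply: p_inj => n; have := d2 n; rewrite sumE dE; lra.
- apply/predeqP => s; split.
    case=> [[[F [TF sF Fd]] nA]|[Bs nA [F [TF sF Fd]]]].
      exists F; split=> // d dd; have := Fd _ dd; rewrite in_cons.
      case: eqP => [[E1 E2]|_] //=; by rewrite E1.
    move: sF; rewrite subUset => /andP[sF AF]; have dF := FA _ TF AF.
    have BF := sideF true _ _ dF.
    exists F; split=> //.
      apply/subsetP => v vs; have [vB|vB] := boolP (v \in B); first exact: (subsetP BF).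
      by apply: (subsetP sF); rewrite inE vB.
    by move=> d /(uniq _ _ TF dF) ->; rewrite in_cons eqxx.
  move=> [F [TF sF Fd]].
  have nA : ~~ (A \subset s).
    apply/negP => As; have dF := FA _ TF (subset_trans As sF).
    by have := Fd _ dF; rewrite in_cons eqxx /= As.
  have [Bs|nB] := boolP (B \subset s).
    right; split=> //; have dF := FB _ TF (subset_trans Bs sF).
    exists F; split=> //.
      rewrite subUset (sideF false _ _ dF) andbT; apply: subset_trans sF; exact: subsetDl.
    move=> d /(uniq _ _ TF dF) ->; rewrite CS /=; apply/negP => /subsetP/(_ _ bB).
    by rewrite in_setU in_setD bB /= => bA; have := disjointFr dAB bA; rewrite bB.
  left; split=> //; exists F; split=> // d dd; have := Fd _ dd; rewrite in_cons.
  case: eqP => [[E1 E2] _|_] //=; by rewrite E1 E2 CS /= E2.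
Qed.

Lemma TS_chain c (L : seq ({set V} * {set V})) : (forall C, C \in L -> circ c C) ->
  exists2 S, {subset L <= S} & feqS (TS c [::]) (TS c S).
Proof.
elim: L => [_|C L IH HL]; first by exists [::] => //; apply: feqS_refl.
have [|S LS H] := IH; first by move=> C' C'L; apply: HL; rewrite inE C'L orbT.
have [CS|CS] := boolP (C \in S).
  by exists S => // C'; rewrite inE => /orP[/eqP->|/LS].
have [ok c3 E] := TS_flip (HL C (mem_head _ _)) CS.
exists (C :: S); last by apply: (feqS_trans H); apply: (feqS_step ok c3); rewrite E; apply: feqS_refl.
by move=> C'; rewrite !inE => /orP[->//|/LS ->]; rewrite orbT.
Qed.

Lemma Tq_flips c : feqS (Tq true c) (Tq false c).
Proof.
have [|S HS H] := @TS_chain c [seq C <- enum {: {set V} * {set V}} | `[< circ c C >]].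
  by move=> C; rewrite mem_filter => /andP[/asboolP].
have E1 : TS c [::] = Tq true c by [].
have E2 : TS c S = Tq false c.
  have inS F d : Tb c F -> dep F d -> (side false d, side true d) \in S.
    by move=> TF dd; apply: HS; rewrite mem_filter mem_enum andbT; apply/asboolP; exists F, d.
  apply/predeqP => s; split=> -[F [TF sF Fd]]; exists F; split=> // d dd;
    have := Fd _ dd; by rewrite (inS _ _ TF dd).
by rewrite -E1 -E2.
Qed.
(** With constant heights, the obstruction in [motzkin] would be a nonzero dependence on F. *)
Lemma face_sub (A : {set V}) (w' : V -> R) F s :
  face A w' F -> indep F -> s \subset F -> face A w' s.
Proof.
move=> [FA XF [l [l1 l2]]] iF sF.
have [[m [m1 m2]]|[d [d1 d2 d3 d4 d5]]] := motzkin p (fun=> 0) sF; last first.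
  have d0 := iF _ d1 d3; have {d4} E : \sum_v d v * 0 = 0 by apply: big1 => v _; rewrite mulr0.
  by case: d5 => [|[v _]]; rewrite ?E ?d0 ltxx.
have : forall v, exists2 eps, 0 < eps & forall dl, 0 < dl -> dl < eps ->
    v \in A :\: F -> dot l (p v) + dl * dot m (p v) < w' v.
  move=> v; have [vF|vF] := boolP (v \in A :\: F); last by exists 1.
  have g0 : 0 < w' v - dot l (p v) by rewrite subr_gt0 l2.
  set a := dot m (p v).
  have a0 : 0 < `|a| + 1 by rewrite ltr_wpDl.
  exists ((w' v - dot l (p v)) / (`|a| + 1)); first by rewrite divr_gt0.
  move=> dl dl0; rewrite ltr_pdivlMr // => H _.
  have : dl * a <= dl * `|a| by rewrite ler_pM2l // ler_norm.
  move: H; rewrite mulrDr mulr1; lra.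
move=> /exists_eps[eps e0 He].
have h1 : 0 < eps / 2 by lra.
have h2 : eps / 2 < eps by lra.
split; first exact: subset_trans FA.
  by apply: (Xsub XF); apply: carrS.
exists (fun n => l n + eps / 2 * m n); split=> v vs; rewrite dotDZl.
  by rewrite m1 // mulr0 addr0 l1 //; apply: (subsetP sF).
have [vF|vF] := boolP (v \in F).
  rewrite l1 // gtrDl pmulr_rlt0 // m2 // inE vF andbT; by move: vs; rewrite inE => /andP[].
by apply: He => //; move: vs; rewrite !inE vF => /andP[].
Qed.

Lemma Tq_simp b c : (forall F, Tb c F -> indep F) -> Tq b c = Tb c.
Proof.
move=> iF; apply/predeqP => s; split; last first.
  move=> Ts; exists s; split=> // d [d1 d2 d3].
  by have := iF _ Ts _ d1 d2 v0; rewrite d3 => /eqP; rewrite oner_eq0.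
by move=> [F [TF sF _]]; apply: face_sub sF; [exact: TF|exact: iF].
Qed.

Lemma Tb_big : exists B, forall c, B < c -> Tb c = face U w.
Proof.
(* The height over [p v0] of the linear interpolation of the heights of the [e n]. A face containing
   v0 cannot be higher there. *)
pose b := \sum_n w (e n) * p v0 n.
have /choice[f Hf] : forall s, exists C, face U w s -> exists l : N -> R,
    [/\ forall v, v \in s -> dot l (p v) = w v,
        forall v, v \in U :\: s -> dot l (p v) < w v & dot l (p v0) < C].
  move=> s; have [[_ _ [l [l1 l2]]]|nf] := pselect (face U w s); last by exists 0.
  by exists (dot l (p v0) + 1) => _; exists l; split=> //; rewrite ltrDl.
exists (`|b| + \sum_s `|f s|) => c cB; apply/predeqP => s; split.
  move=> Ts; have [sU' Xs [l [l1 l2]]] := Ts.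
  have v0s : v0 \notin s.
    apply/negP => vs; have := l1 _ vs; rewrite /wc eqxx => E.
    have : dot l (p v0) <= b.
      apply: ler_sum => n _; apply: ler_wpM2r => //.
      have <- : dot l (p (e n)) = l n.
        rewrite /dot (bigD1 n) //= pe eqxx mulr1 big1 ?addr0 // => m /negbTE.
        by rewrite pe => ->; rewrite mulr0.
      have nv : e n == v0 = false by apply: contraNF v0U => /eqP <-.
      have [es|es] := boolP (e n \in s).
        by rewrite l1 // /wc nv.
      by have := l2 (e n); rewrite /wc nv => H; apply/ltW/H; rewrite !inE es eU orbT.
    rewrite E leNgt => /negP; apply; apply: le_lt_trans cB.
    by apply: (le_trans (ler_norm b)); rewrite lerDl sumr_ge0.
  have := Tb_del Ts; by rewrite (_ : s :\ v0 = s) //; apply/setDidPl; rewrite disjoint_sym disjoints1.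
move=> fs; have [sU Xs _] := fs; have [l [l1 l2 l3]] := Hf _ fs.
have v0s : v0 \notin s by apply: contra v0U; apply: (subsetP sU).
split=> //.
  by apply: subset_trans sU _; apply: subsetUr.
exists l; split=> v vs.
  by rewrite l1 // /wc; case: eqP => // E; rewrite -E vs in v0s.
rewrite /wc; case: eqP => [->|/eqP nv].
  apply: lt_trans l3 _; apply: le_lt_trans cB; apply: (le_trans (ler_norm _)).
  by rewrite (bigD1 s) //= addrCA lerDl addr_ge0 // sumr_ge0.
by apply: l2; move: vs; rewrite !inE (negbTE nv).
Qed.

(** Induction over the real line: the heights reached by flips have an infimum i. Just above i the
    triangulation is [Tq true i], so i is reached; [Tq_flips] crosses it, and the triangulation
    [Tq false i] found just below contradicts minimality unless i = c0. *)
Lemma sweep1 c0 : (forall F, Tb c0 F -> indep F) -> feqS (face U w) (Tb c0).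
Proof.
move=> i0; rewrite -(Tq_simp true i0).
pose S : classical_sets.set R := fun c => c0 <= c /\ feqS (face U w) (Tq true c).
have Sne : exists c, S c.
  have [B HB] := Tb_big; exists (`|B| + `|c0| + 1); split.
    by have := ler_norm c0; have := normr_ge0 B; lra.
  have [eps e0 He] := Tq_near true (`|B| + `|c0| + 1).
  rewrite -(He (eps / 2)) ?HB; first exact: feqS_refl.
  - by have := ler_norm B; have := normr_ge0 c0; rewrite /sgn; lra.
  - by lra.
  - by lra.
have hinf : classical_sets.has_inf S by split=> //; exists c0 => c [].
set i := inf S.
have ci : c0 <= i by apply: lb_le_inf => // c [].
have Si : S i.
  split=> //; have [eps e0 He] := Tq_near true i.
  have [c [cc Hc] ci'] := inf_adherent e0 hinf.
  have ic : i <= c by apply: ge_inf => //; case: hinf.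
  have [->//|ne] := eqVneq i c.
  have [eps2 e20 He2] := Tq_near true c.
  pose dl := Num.min (eps2 / 2) ((i + eps - c) / 2).
  have dl0 : 0 < dl by rewrite /dl lt_min; apply/andP; split; rewrite /i; lra.
  have dl1 : dl < eps2 by rewrite /dl gt_min; apply/orP; left; lra.
  have dl2 : dl < i + eps - c by rewrite /dl gt_min; apply/orP; right; rewrite /i; lra.
  have := He2 _ dl0 dl1; have := He (c + dl - i).
  have -> : i + sgn true * (c + dl - i) = c + sgn true * dl by rewrite /sgn; ring.
  by move=> -> => [->//||]; rewrite /i in dl0 dl1 dl2 ic *; lra.
have [<-|ne] := eqVneq i c0; first by case: Si.
have [eps e0 He] := Tq_near false i.
pose c := Num.max c0 (i - eps / 2).
have ci2 : c < i.
  rewrite /c gt_max; apply/andP; split; last by lra.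
  by rewrite lt_neqAle eq_sym ne.
have cc : c0 <= c by rewrite /c le_max lexx.
have ce : i - eps < c by rewrite /c lt_max; apply/orP; right; lra.
have : S c.
  split=> //; apply: (feqS_trans Si.2); apply: (feqS_trans (Tq_flips i)).
  have [eps2 e20 He2] := Tq_near true c.
  pose dl := Num.min (eps2 / 2) ((i - c) / 2).
  have dl0 : 0 < dl by rewrite /dl lt_min; apply/andP; split; lra.
  have dl1 : dl < eps2 by rewrite /dl gt_min; apply/orP; left; lra.
  have dl2 : dl < i - c by rewrite /dl gt_min; apply/orP; right; lra.
  have := He2 _ dl0 dl1; have := He (i - c - dl).
  have -> : i + sgn false * (i - c - dl) = c + sgn true * dl by rewrite /sgn; ring.
  by move=> -> => [->||]; [apply: feqS_refl|lra|lra].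
move=> Sc; have : i <= c by apply: ge_inf => //; case: hinf.
by rewrite leNgt ci2.
Qed.

End Step.

(* Initially the vertices e n are at their heights and all others at +oo. *)
Lemma sweep w : (forall s, X (carr p s) -> (exists l, forall v, v \in s -> dot l (p v) = w v) -> indep s) ->
  feqS (fun s => exists2 a, X a & s = e @: a) (face setT w).
Proof.
move=> gen; have simp U : simplicial U w.
  by move=> F [_ XF [l [l1 _]]]; apply: gen => //; exists l.
pose U0 := e @: [set: N].
have fU0 : face U0 w = (fun s => exists2 a, X a & s = e @: a).
  apply/predeqP => s.
  (* The points [e n] are the coordinate vectors, so a functional can be given arbitrary values on
     them, and every simplex of X is a lower face. *)
  have eI : injective e.
    move=> n m E; have := pe n m; rewrite E pe eqxx; case: eqP => // _ /eqP.
    by rewrite oner_eq0.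
  have dotE l n : dot l (p (e n)) = l n.
    rewrite /dot (bigD1 n) //= pe eqxx mulr1 big1 ?addr0 // => m /negbTE.
    by rewrite pe => ->; rewrite mulr0.
  have carrE (a : {set N}) : carr p (e @: a) = a.
    apply/setP => n; rewrite inE; apply/exists_inP/idP => [[v /imsetP[m ma ->]]|na].
      rewrite pe; by have [->|] := eqVneq n m; rewrite ?eqxx.
    by exists (e n); rewrite ?imset_f // pe eqxx oner_neq0.
  split.
    move=> [sU Xs _].
    have E : s = e @: (e @^-1: s).
      apply/setP => v; apply/idP/imsetP => [vs|[n]]; last by rewrite inE => ? ->.
      by have /imsetP[n _ E] := subsetP sU _ vs; exists n => //; rewrite inE -E.
    by exists (e @^-1: s) => //; rewrite -[e @^-1: s]carrE -E.
  move=> [a Xa ->]; split; rewrite ?carrE //; first exact: imsetS (subsetT _).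
  exists (fun n => if n \in a then w (e n) else w (e n) - 1); split=> v.
    by case/imsetP=> n na ->; rewrite dotE na.
  rewrite inE => /andP[va /imsetP[n _ E]]; rewrite E dotE; move: va.
  by rewrite E mem_imset // => /negbTE ->; rewrite ltrBlDr ltrDl ltr01.
rewrite -fU0; suff H : forall k (U : {set V}), U0 \subset U -> #|U| = (#|U0| + k)%N ->
    feqS (face U0 w) (face U w).
  by apply: (H (#|[set: V]| - #|U0|)%N) => //; rewrite subnKC // subset_leq_card.
elim=> [|k IH] U UU.
  rewrite addn0 => cU; have <- : U0 = U by apply/eqP; rewrite eqEcard UU cU leqnn.
  exact: feqS_refl.
move=> cU; have /set0Pn[v0] : U :\: U0 != set0.
  by rewrite -card_gt0 cardsD (setIidPr UU) cU; lia.
rewrite inE => /andP[v0U0 v0U].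
pose U1 := U :\ v0; have v0U1 : v0 \notin U1 by rewrite !inE eqxx.
have UU1 : U0 \subset U1.
  apply/subsetP => u uU; rewrite !inE (subsetP UU _ uU) andbT.
  by apply: contraNneq v0U0 => <-.
have eU1 n : e n \in U1 by apply: (subsetP UU1); apply: imset_f.
have E : v0 |: U1 = U by rewrite setD1K.
have wE : wc v0 w (w v0) = w by apply/funext => v; rewrite /wc; case: eqP => [->|].
have TE : Tb U1 v0 w (w v0) = face U w by rewrite /Tb wE E.
apply: feqS_trans (IH _ UU1 _) _.
  by move: cU; rewrite (cardsD1 v0 U) v0U addnS => -[].
rewrite -TE; apply: (@sweep1 U1 v0) => //.
by move=> F; rewrite TE; apply: simp.
Qed.

End Sweep.

(** * Cutting by hyperplanes *)

Section Generic.
Variables (R : realType) (N V : finType) (p : V -> N -> R).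
Implicit Types (s U : {set V}).

Lemma avoid (L : seq R) a b : a < b -> exists c, [/\ a < c, c < b & c \notin L].
Proof.
elim: L a b => [|x L IH] a b ab.
  by exists ((a + b) / 2); split=> //; lra.
have [xm|mx] := ltP x ((a + b) / 2).
  have [|c [c1 c2 cL]] := IH ((a + b) / 2) b; first by lra.
  exists c; split=> //; first by lra.
  by rewrite inE negb_or cL andbT; apply/eqP => E; move: c1; rewrite E; lra.
have [|c [c1 c2 cL]] := IH a ((a + b) / 2); first by lra.
exists c; split=> //; first by lra.
by rewrite inE negb_or cL andbT; apply/eqP => E; move: c2; rewrite E; lra.
Qed.

(** Genericity: lifted points on a common hyperplane are linearly independent below, so that every
    face is a simplex. *)
Definition gen U (w : V -> R) := forall s, s \subset U ->
  (exists l, forall v, v \in s -> dot l (p v) = w v) -> indep p s.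

(** Heights are chosen vertex by vertex. For each independent s the dependence of v0 on s, if any,
    is unique and excludes a single height of v0, so finitely many values have to be avoided. *)
Lemma generic_near (w0 : V -> R) eps : 0 < eps ->
  exists w, (forall v, `|w v - w0 v| < eps) /\ gen setT w.
Proof.
move=> e0; suff H : forall k U, #|U| = k -> exists w, (forall v, `|w v - w0 v| < eps) /\ gen U w.
  exact: (H _ setT (erefl _)).
elim=> [|k IH] U cU.
  exists w0; split; first by move=> v; rewrite subrr normr0.
  move=> s sU _ d dE _ v; apply: dE.
  have U0 : U = set0 by apply/eqP; rewrite -cards_eq0 cU.
  by apply/negP => /(subsetP sU); rewrite U0 inE.
have /set0Pn[v0 v0U] : U != set0 by rewrite -card_gt0 cU.
have [|w [w1 w2]] := IH (U :\ v0); first by move: cU; rewrite (cardsD1 v0 U) v0U => -[].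
pose bad s c := indep p s /\ exists d, [/\ forall v, v \notin v0 |: s -> d v = 0,
  forall n, \sum_v d v * p v n = 0, d v0 = 1 & c = - \sum_(v | v != v0) d v * w v].
have bad1 s c c' : bad s c -> bad s c' -> c = c'.
  move=> [is_ [d [d1 d2 d3 ->]]] [_ [d' [d1' d2' d3' ->]]]; congr (- _).
  have E : forall v, d v - d' v = 0.
    apply: is_ => [v vs|n].
      have [->|vv] := eqVneq v v0; first by rewrite d3 d3' subrr.
      by rewrite d1 ?d1' ?subrr // !inE negb_or vv.
    by under eq_bigr do rewrite mulrBl; rewrite sumrB d2 d2' subrr.
  by apply: eq_bigr => v _; have /eqP := E v; rewrite subr_eq0 => /eqP ->.
have /choice[f Hf] : forall s, exists c, forall c', bad s c' -> c' = c.
  move=> s; have [[c bc]|nb] := pselect (exists c, bad s c).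
    by exists c => c' bc'; apply: bad1 bc' bc.
  by exists 0 => c' bc'; case: nb; exists c'.
have [|c [c1 c2 cL]] := @avoid [seq f s | s : {set V}] (w0 v0 - eps) (w0 v0 + eps); first by lra.
exists (fun v => if v == v0 then c else w v); split.
  move=> v; case: eqP => [->|_]; last exact: w1.
  by rewrite ltr_norml; apply/andP; split; lra.
move=> s sU [l Hl].
have sU1 : s :\ v0 \subset U :\ v0 by apply: setSD.
have is1 : indep p (s :\ v0).
  apply: w2 sU1 _; exists l => v; rewrite !inE => /andP[vv vs].
  by rewrite Hl // (negbTE vv).
have [v0s|v0s] := boolP (v0 \in s); last first.
  by have -> : s = s :\ v0 by apply/esym/setDidPl; rewrite disjoint_sym disjoints1.
move=> d d1 d2; have [dv|dv] := eqVneq (d v0) 0.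
  by apply: is1 => // v; rewrite !inE negb_and negbK => /orP[/eqP->|/d1].
case/negP: cL; apply/imageP; exists (s :\ v0) => //; apply: Hf; split=> //.
exists (fun v => d v / d v0); split.
- by move=> v; rewrite setD1K // => /d1 ->; rewrite mul0r.
- by move=> n; under eq_bigr do rewrite mulrAC; rewrite -mulr_suml d2 mul0r.
- by rewrite divff.
have E : \sum_v d v * dot l (p v) = 0.
  by rewrite -dot_sumr /dot big1 // => n _; rewrite d2 mulr0.
have E2 : d v0 * c + \sum_(v | v != v0) d v * w v = 0.
  rewrite -[RHS]E [RHS](bigD1 v0) //= Hl // eqxx; congr (_ + _).
  apply: eq_bigr => v vv; have [vs|vs] := boolP (v \in s).
    by rewrite Hl // (negbTE vv).
  by rewrite d1 // !mul0r.
apply: (mulfI dv); rewrite mulrN mulr_sumr.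
have -> : d v0 * c = - \sum_(v | v != v0) d v * w v by apply/eqP; rewrite -addr_eq0 E2.
congr (- _); apply: eq_bigr => v _; by rewrite mulrA mulrCA divff // mulr1.
Qed.
End Generic.

Section Cut.
Variables (R : realType) (N : finType).
Notation pt := {ffun N -> R}.
Implicit Types (x y z : pt) (h : N -> R).

Definition spt x : {set N} := [set n | x n != 0].
Definition bary x := (forall n, 0 <= x n) /\ \sum_n x n = 1.

(** Membership in S is asked only of points of positive weight, so that a combination can be
    restricted to a smaller set without changing its index type. *)
Definition conv (S : pt -> Prop) z := exists (I : finType) (q : I -> pt) (t : I -> R),
  [/\ forall i, 0 <= t i, \sum_i t i = 1, forall n, z n = \sum_i t i * q i n &
      forall i, 0 < t i -> S (q i)].

(* The point of the segment from x to y on the hyperplane h = 0. *)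
Definition cross h x y : pt :=
  [ffun n => (dot h x * y n - dot h y * x n) / (dot h x - dot h y)].

Lemma cross_lin h x y : 0 < dot h x -> dot h y < 0 ->
  exists a b, [/\ 0 < a, 0 < b, a + b = 1 & forall n, cross h x y n = a * x n + b * y n] /\
    a * dot h x + b * dot h y = 0.
Proof.
move=> hx hy; have d0 : 0 < dot h x - dot h y by lra.
have dn : dot h x - dot h y != 0 by rewrite gt_eqF.
exists (- dot h y / (dot h x - dot h y)), (dot h x / (dot h x - dot h y)).
split; first split.
- by rewrite divr_gt0 // oppr_gt0.
- by rewrite divr_gt0.
- by field.
- by move=> n; rewrite ffunE; field.
- by field.
Qed.

Lemma bary_lin x y z a b : bary x -> bary y -> 0 <= a -> 0 <= b -> a + b = 1 ->
  (forall n, z n = a * x n + b * y n) -> bary z.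
Proof.
move=> [x0 x1] [y0 y1] a0 b0 ab E; split.
  by move=> n; rewrite E addr_ge0 // mulr_ge0.
under eq_bigr do rewrite E; by rewrite big_split /= -!mulr_sumr x1 y1 !mulr1.
Qed.

Lemma dot_lin2 h x y z a b : (forall n, z n = a * x n + b * y n) ->
  dot h z = a * dot h x + b * dot h y.
Proof.
move=> E; rewrite /dot !mulr_sumr -big_split /=; apply: eq_bigr => n _; rewrite E; ring.
Qed.

(* Points on the negative side of h are eliminated by crossing each of them
   with the points on the positive side; that this suffices is Farkas. *)
Lemma conv_cross h (S : pt -> Prop) z : (forall x, S x -> bary x) -> conv S z -> 0 <= dot h z ->
  conv (fun u => 0 <= dot h u /\
    (S u \/ exists x y, [/\ S x, S y, 0 < dot h x, dot h y < 0 & u = cross h x y])) z.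
Proof.
move=> Sb [I [q [t [t0 t1 zE tS]]]] hz.
have bz : \sum_n z n = 1.
  under eq_bigr do rewrite zE; rewrite exchange_big /= -t1; apply: eq_bigr => i _.
  rewrite -mulr_sumr; have [/tS/Sb[_ ->]|] := ltP 0 (t i); first by rewrite mulr1.
  by move=> ti; rewrite (_ : t i = 0) ?mul0r //; apply/eqP; rewrite eq_le ti t0.
pose q' (j : I + I * I) : pt := match j with inl i => q i | inr (i, k) => cross h (q i) (q k) end.
pose W : {set I + I * I} := [set j | match j with
  | inl i => (0 < t i) && (0 <= dot h (q i))
  | inr (i, k) => [&& 0 < t i, 0 < t k, 0 < dot h (q i) & dot h (q k) < 0] end].
have Wq' j : j \in W -> 0 <= dot h (q' j) /\
    (S (q' j) \/ exists x y, [/\ S x, S y, 0 < dot h x, dot h y < 0 & q' j = cross h x y]).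
  rewrite inE; case: j => [i /andP[ti hi]|[i k] /and4P[ti tk hi hk]] /=.
    by split=> //; left; apply: tS.
  split; last by right; exists (q i), (q k); split=> //; apply: tS.
  have [a [b [[_ _ _ E] E0]]] := cross_lin hi hk.
  by rewrite (dot_lin2 h E) E0.
have [|l [l0 lW lE]] := @farkas R _ _ W (fun j n => q' j n) z.
  move=> m Hm.
  have Hi i : 0 < t i -> 0 <= dot h (q i) -> dot (q i) m <= 0.
    by move=> ti hi; apply: (Hm (inl i)); rewrite inE ti.
  (* A multiplier for which m + kp h is nonpositive at all points with h < 0. The crossing points
     ensure the same where h > 0: a violation there would make m positive at a crossing. *)
  pose kp := \big[Num.max/0]_(i | (0 < t i) && (dot h (q i) < 0)) (dot (q i) m / - dot h (q i)).
  have kp0 : 0 <= kp.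
    exact: bigmax_ge_id.
  have neg i : 0 < t i -> dot h (q i) < 0 -> dot (q i) m + kp * dot h (q i) <= 0.
    move=> ti hi; have : dot (q i) m / - dot h (q i) <= kp.
      by apply: (le_bigmax_cond 0 (fun i => dot (q i) m / - dot h (q i))); rewrite ti hi.
    rewrite ler_pdivrMr ?oppr_gt0 //; lra.
  have pos k : 0 < t k -> 0 < dot h (q k) -> dot (q k) m + kp * dot h (q k) <= 0.
    move=> tk hk; rewrite /kp; elim/big_ind: _ => [|u v Hu Hv|i /andP[ti hi]].
    - by rewrite mul0r addr0; apply: Hi => //; apply: ltW.
    - by rewrite maxEle; case: ifP.
    have := Hm (inr (k, i)); rewrite inE tk ti hk hi => /(_ isT).
    have [a [b [[a0 b0 ab E] E0]]] := cross_lin hk hi.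
    rewrite dotC (dot_lin2 m E) ![dot m _]dotC => H.
    have hn : dot h (q i) != 0 by rewrite lt_eqF.
    have an : a != 0 by rewrite gt_eqF.
    have -> : dot (q k) m + dot (q i) m / - dot h (q i) * dot h (q k) =
        (a * dot (q k) m + b * dot (q i) m) / a.
      have -> : b = - a * dot h (q k) / dot h (q i).
        by apply: (mulIf hn); rewrite divfK //; lra.
      by field; rewrite hn an.
    by rewrite pmulr_lle0 // invr_gt0.
  have zm : dot z m = \sum_i t i * dot (q i) m.
    by rewrite -dot_suml; apply: eq_bigr => n _; rewrite zE.
  have zh : dot h z = \sum_i t i * dot h (q i).
    by rewrite -dot_sumr; apply: eq_bigr => n _; rewrite zE.
  have : dot z m + kp * dot h z <= 0.
    rewrite zm zh mulr_sumr -big_split /=; apply: sumr_le0 => i _.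
    have -> : t i * dot (q i) m + kp * (t i * dot h (q i)) = t i * (dot (q i) m + kp * dot h (q i)) by ring.
    have [ti|ti] := ltP 0 (t i); last first.
      by rewrite (_ : t i = 0) ?mul0r //; apply/eqP; rewrite eq_le ti t0.
    rewrite pmulr_rle0 //; have [hi|hi|hi] := ltgtP (dot h (q i)) 0.
    - exact: neg.
    - exact: pos.
    - by rewrite hi mulr0 addr0; apply: Hi => //; rewrite hi.
  have : 0 <= kp * dot h z by apply: mulr_ge0.
  lra.
have lpos j : 0 < l j -> j \in W.
  by move=> lj; apply: contraTT lj => /lW ->; rewrite ltxx.
have bq j : 0 < l j -> \sum_n q' j n = 1.
  move=> /lpos/Wq'[_ [/Sb[]//|[x [y [Sx Sy hx hy E]]]]].
  have [a [b [[a0 b0 ab E1] _]]] := cross_lin hx hy.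
  by rewrite E; have [_ ->] := bary_lin (Sb _ Sx) (Sb _ Sy) (ltW a0) (ltW b0) ab E1.
exists (I + I * I)%type, q', l; split=> // [|j /lpos/Wq' //].
rewrite -bz; under [RHS]eq_bigr do rewrite lE.
rewrite exchange_big /=; apply: eq_bigr => j _; rewrite -mulr_sumr.
have [lj|lj] := ltP 0 (l j); first by rewrite bq // mulr1.
by rewrite (_ : l j = 0) ?mul0r //; apply/eqP; rewrite eq_le lj l0.
Qed.

Lemma crossN h x y : cross (fun n => - h n) x y = cross h x y.
Proof.
have dN z : dot (fun n => - h n) z = - dot h z.
  by rewrite /dot -sumrN; apply: eq_bigr => n _; rewrite mulNr.
apply/ffunP => n; rewrite !ffunE !dN.
have -> : - dot h x - - dot h y = - (dot h x - dot h y) by ring.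
rewrite invrN; ring.
Qed.

Lemma crossC h x y : cross h x y = cross h y x.
Proof.
apply/ffunP => n; rewrite !ffunE.
have -> : dot h y - dot h x = - (dot h x - dot h y) by ring.
rewrite invrN; ring.
Qed.

Lemma conv_dot h S z : conv S z -> exists (I : finType) (q : I -> pt) (t : I -> R),
  [/\ forall i, 0 <= t i, \sum_i t i = 1, forall n, z n = \sum_i t i * q i n,
      forall i, 0 < t i -> S (q i) & dot h z = \sum_i t i * dot h (q i)].
Proof.
move=> [I [q [t [t0 t1 zE tS]]]]; exists I, q, t; split=> //.
by rewrite -dot_sumr; apply: eq_bigr => n _; rewrite zE.
Qed.

Lemma conv_sub (S S' : pt -> Prop) z : (forall x, S x -> S' x) -> conv S z -> conv S' z.
Proof.
move=> SS' [I [q [t [t0 t1 zE tS]]]]; exists I, q, t; split=> // i /tS; exact: SS'.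
Qed.

Lemma conv_zero h S z : conv S z -> (forall x, S x -> 0 <= dot h x) -> dot h z <= 0 ->
  conv (fun x => S x /\ dot h x <= 0) z.
Proof.
move=> /(conv_dot h)[I [q [t [t0 t1 zE tS hE]]]] Sh hz; exists I, q, t; split=> // i ti.
split; first exact: tS.
have ge k : 0 <= t k * dot h (q k).
  have [tk|tk] := ltP 0 (t k); first by apply: mulr_ge0; [exact: ltW|apply/Sh/tS].
  by rewrite (_ : t k = 0) ?mul0r //; apply/eqP; rewrite eq_le tk t0.
have : \sum_k t k * dot h (q k) == 0 by rewrite -hE eq_le hz /= hE sumr_ge0.
rewrite psumr_eq0 // => /allP/(_ i); rewrite mem_index_enum => /(_ isT).
by rewrite mulf_eq0 gt_eqF //= => /eqP ->.
Qed.

Definition unit_pt (n : N) : pt := [ffun m => (m == n)%:R].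

Variable X : {set N} -> Prop.
Hypotheses (X0 : X set0) (Xsub : forall s t : {set N}, X s -> t \subset s -> X t)
  (X1 : forall n, X [set n]).

Definition inX x := bary x /\ X (spt x).

Lemma inX_unit n : inX (unit_pt n).
Proof.
split; first split.
- by move=> m; rewrite ffunE ler0n.
- rewrite (bigD1 n) //= ffunE eqxx big1 ?addr0 // => m /negbTE.
  by rewrite ffunE => ->.
- apply: (Xsub (X1 n)); apply/subsetP => m; rewrite !inE ffunE.
  by case: (m == n) => //; rewrite eqxx.
Qed.

(** The points of P in the closed cell of z, for the arrangement of H inside the simplex that
    supports z. *)
Definition cell (H : seq (N -> R)) (P : seq pt) z x := [/\ x \in P, spt x \subset spt z &
  forall i, (i < size H)%N -> (0 <= dot (nth (fun=> 0) H i) z -> 0 <= dot (nth (fun=> 0) H i) x) /\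
                              (dot (nth (fun=> 0) H i) z <= 0 -> dot (nth (fun=> 0) H i) x <= 0)].

(** Hyperplanes are added one at a time, and with each of them all crossings of segments between
    present points that stay in X. P may contain more than the vertices of the arrangement; what
    counts is that each closed cell lies in the hull of its points. *)
Lemma conv_cells (H : seq (N -> R)) (P0 : seq pt) : (forall x, x \in P0 -> inX x) ->
  exists P, [/\ {subset P0 <= P}, forall n, unit_pt n \in P, forall x, x \in P -> inX x &
    forall z, inX z -> conv (cell H P z) z].
Proof.
move=> P0X; elim: H => [|h H [P [P1 P2 P3 P4]]].
  exists (P0 ++ [seq unit_pt n | n <- enum N]).
  have uP n : unit_pt n \in P0 ++ [seq unit_pt n | n <- enum N].
    by rewrite mem_cat; apply/orP; right; apply/map_f; rewrite mem_enum.
  split=> //.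
  - by move=> x xP; rewrite mem_cat xP.
  - by move=> x; rewrite mem_cat => /orP[/P0X //|/mapP[n _ ->]]; apply: inX_unit.
  move=> z [[z0 z1] Xz]; exists N, unit_pt, (fun n => z n); split=> //.
    move=> n; rewrite (bigD1 n) //= ffunE eqxx mulr1 big1 ?addr0 // => m /negbTE.
    by rewrite ffunE eq_sym => ->; rewrite mulr0.
  move=> n zn; split=> //; apply/subsetP => m; rewrite !inE ffunE.
  by have [-> _|_] := eqVneq m n; [rewrite gt_eqF|rewrite eqxx].
pose P' := P ++ [seq x <- [seq cross h x y | x <- P, y <- P] | `[< inX x >]].
have PP' x : x \in P -> x \in P' by move=> xP; rewrite mem_cat xP.
exists P'; split.
- by move=> x /P1/PP'.
- by move=> n; apply/PP'.
- by move=> x; rewrite mem_cat => /orP[/P3 //|]; rewrite mem_filter => /andP[/asboolP].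
move=> z zX; have [bz Xz] := zX; have cz := P4 _ zX.
have Sb x : cell H P z x -> bary x by case=> /P3[].
have crossS x y : cell H P z x -> cell H P z y -> 0 < dot h x -> dot h y < 0 ->
    cell H P' z (cross h x y).
  move=> Sx Sy hx hy; have [a [b [[a0 b0 ab E] _]]] := cross_lin hx hy.
  have [xP xz xH] := Sx; have [yP yz yH] := Sy.
  have sz : spt (cross h x y) \subset spt z.
    apply/subsetP => n; rewrite inE E => ne; apply: contraTT ne => nz.
    have xn : n \notin spt x by apply: contra nz; apply: (subsetP xz).
    have yn : n \notin spt y by apply: contra nz; apply: (subsetP yz).
    by move: xn yn; rewrite !inE !negbK => /eqP -> /eqP ->; rewrite !mulr0 addr0.
  split=> //.
    rewrite mem_cat mem_filter; apply/orP; right; apply/andP; split.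
      apply/asboolP; split; last exact: Xsub Xz sz.
      exact: (bary_lin (Sb _ Sx) (Sb _ Sy) (ltW a0) (ltW b0) ab E).
    by apply: allpairs_f.
  move=> i iH; rewrite (dot_lin2 _ E); split=> hz.
    by apply: addr_ge0; apply: mulr_ge0; rewrite ?(ltW a0) ?(ltW b0) //; [apply: (xH i iH).1|apply: (yH i iH).1].
  have h1 := mulr_ge0_le0 (ltW a0) ((xH i iH).2 hz).
  have h2 := mulr_ge0_le0 (ltW b0) ((yH i iH).2 hz).
  lra.
have cellP x : cell H P z x -> cell H P' z x by case=> *; split=> //; apply: PP'.
have fin : conv (fun x => cell H P' z x /\ ((0 <= dot h z -> 0 <= dot h x) /\ (dot h z <= 0 -> dot h x <= 0))) z ->
    conv (cell (h :: H) P' z) z.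
  apply: conv_sub => x [[xP xz xH] hx]; split=> // -[|i] //= iH; exact: xH.
apply: fin; have [hz|hz] := leP 0 (dot h z).
  have c1 := conv_cross Sb cz hz.
  have c2 : conv (fun x => cell H P' z x /\ 0 <= dot h x) z.
    apply: conv_sub c1 => u [hu [Su|[x [y [Sx Sy hx hy ->]]]]].
      by split=> //; apply: cellP.
    split; first exact: crossS.
    by have [a [b [[_ _ _ E] E0]]] := cross_lin hx hy; rewrite (dot_lin2 _ E) E0.
  have [hz'|hz'] := leP (dot h z) 0.
    have := @conv_zero h _ _ c2 (fun x => @proj2 _ _) hz'.
    by apply: conv_sub => x [[cx hx] hx']; split.
  by apply: conv_sub c2 => x [cx hx]; split=> //; split.
pose h' n := - h n.
have dN x : dot h' x = - dot h x.
  by rewrite /dot -sumrN; apply: eq_bigr => n _; rewrite mulNr.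
have hz1 : 0 <= dot h' z by rewrite dN oppr_ge0 ltW.
have c1 := conv_cross Sb cz hz1.
apply: conv_sub c1 => u [hu Hu]; rewrite dN oppr_ge0 in hu; split=> //.
  case: Hu => [Su|[x [y [Sx Sy hx hy ->]]]]; first exact: cellP.
  rewrite dN oppr_gt0 in hx; rewrite dN oppr_lt0 in hy.
  by rewrite crossN crossC; apply: crossS.
Qed.

(* The heights are a generic perturbation of the sum of |h|, h in H, whose domains
   of linearity are the cells of the arrangement. *)
Lemma cut (H : seq (N -> R)) (P0 : seq pt) : (forall x, x \in P0 -> inX x) ->
  exists (V : finType) (p : V -> pt) (e : N -> V) (w : V -> R),
  [/\ forall v, inX (p v), forall n, p (e n) = unit_pt n, injective p,
      forall x, x \in P0 -> exists v, p v = x & gen p setT w] /\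
  forall s, face X p setT w s -> forall i, (i < size H)%N -> forall u v, u \in s -> v \in s ->
    0 < dot (nth (fun=> 0) H i) (p u) -> 0 <= dot (nth (fun=> 0) H i) (p v).
Proof.
move=> P0X; have [P [PP uP PX Pc]] := conv_cells H P0X.
pose V : finType := seq_sub P; pose p (v : V) : pt := val v.
pose e n : V := SeqSub (uP n).
have pX v : inX (p v) by apply: PX; apply: valP.
have pI : injective p by apply: val_inj.
pose g i := dot (nth (fun=> 0) H i).
pose w0 (v : V) := \sum_(i < size H) `|g i (p v)|.
(* On the closed cell of z each |h| is linear, so the points of P there represent z at height
   exactly the sum of the |h|. *)
have rep z : inX z -> exists t : V -> R, [/\ forall v, 0 <= t v, \sum_v t v = 1,
    forall n, z n = \sum_v t v * p v n & \sum_v t v * w0 v = \sum_(i < size H) `|g i z| ].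
  move=> /Pc[I [q [t [t0 t1 zE tS]]]].
  pose t' (v : V) := \sum_(i | q i == p v) t i.
  have sumE (f : pt -> R) : \sum_v t' v * f (p v) = \sum_i t i * f (q i).
    rewrite /t'; under eq_bigr do rewrite mulr_suml big_mkcond /=.
    rewrite exchange_big /=; apply: eq_bigr => i _.
    have [ti|ti] := ltP 0 (t i); last first.
      have -> : t i = 0 by apply/eqP; rewrite eq_le ti t0.
      by rewrite mul0r big1 // => v _; rewrite mul0r if_same.
    have [qP _ _] := tS _ ti; rewrite (bigD1 (SeqSub qP : V)) //= eqxx big1 ?addr0 //.
    move=> v vq; case: eqP => // E; case/eqP: vq; apply: val_inj; by rewrite /= E.
  exists t'; split.
  - by move=> v; apply: sumr_ge0.
  - have := sumE (fun=> 1); under eq_bigr do rewrite mulr1.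
    by move=> ->; under eq_bigr do rewrite mulr1.
  - by move=> n; rewrite zE (sumE (fun x => x n)).
  rewrite (sumE (fun x => \sum_(i < size H) `|g i x|)).
  under eq_bigr do rewrite mulr_sumr.
  rewrite exchange_big /=; apply: eq_bigr => i _.
  have gE : g i z = \sum_j t j * g i (q j).
    by rewrite /g -dot_sumr; apply: eq_bigr => n _; rewrite zE.
  have [hz|hz] := leP 0 (g i z).
    rewrite ger0_norm // gE; apply: eq_bigr => j _; have [tj|tj] := ltP 0 (t j); last first.
      by rewrite (_ : t j = 0) ?mul0r //; apply/eqP; rewrite eq_le tj t0.
    by rewrite ger0_norm //; have [_ _ /(_ i (ltn_ord i))[->]] := tS _ tj.
  rewrite (ltr0_norm hz) gE -sumrN; apply: eq_bigr => j _; have [tj|tj] := ltP 0 (t j); last first.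
    by rewrite (_ : t j = 0) ?mul0r ?oppr0 //; apply/eqP; rewrite eq_le tj t0.
  rewrite ler0_norm ?mulrN //; have [_ _ /(_ i (ltn_ord i))[_ ->]] := tS _ tj => //.
  exact: ltW.
(* If u and v are strictly separated by a hyperplane, its |h| is strictly convex between them: at
   the crossing point, the segment is strictly higher than the combination given by [rep]. With
   finitely many triples there is a uniform gap, which the perturbation cannot close. *)
have gap : forall k : V * V * 'I_(size H), exists2 eps : R, 0 < eps & forall dl : R, 0 < dl -> dl < eps ->
    let: (u, v, i) := k in X (spt (p u) :|: spt (p v)) -> 0 < g i (p u) -> g i (p v) < 0 ->
    exists t t' : V -> R, [/\ forall r, r \notin [set u; v] -> t r = 0, forall r, 0 <= t r,
      \sum_r t r = 1, forall r, 0 <= t' r & \sum_r t' r = 1] /\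
      (forall n, \sum_r t r * p r n = \sum_r t' r * p r n) /\
      \sum_r t' r * w0 r + dl + dl < \sum_r t r * w0 r.
  move=> [[u v] i].
  have [[Xuv hu hv]|nh] := pselect [/\ X (spt (p u) :|: spt (p v)), 0 < g i (p u) & g i (p v) < 0];
    last by exists 1 => // dl _ _ *; case: nh; split.
  have uv : u != v by apply/eqP => E; move: hu hv; rewrite E; lra.
  have [a [b [[a0 b0 ab E] E0]]] := cross_lin hu hv.
  have [bu _] := pX u; have [bv _] := pX v.
  have zX : inX (cross (nth (fun=> 0) H i) (p u) (p v)).
    split; first exact: (bary_lin bu bv (ltW a0) (ltW b0) ab E).
    apply: (Xsub Xuv); apply/subsetP => n; rewrite !inE E; apply: contraR.
    by rewrite negb_or !negbK => /andP[/eqP-> /eqP->]; rewrite !mulr0 addr0.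
  have [t' [t'0 t'1 zE tw]] := rep _ zX; set z := cross _ _ _ in zX zE tw E.
  pose t r := if r == u then a else if r == v then b else 0.
  have sumE (f : V -> R) : \sum_r t r * f r = a * f u + b * f v.
    rewrite (bigD1 u) //= {1}/t eqxx (bigD1 v) 1?eq_sym //= {1}/t eq_sym (negbTE uv) eqxx.
    rewrite big1 ?addr0 // => r /andP[xu xv].
    by rewrite /t (negbTE xu) (negbTE xv) mul0r.
  have lt : \sum_r t' r * w0 r < \sum_r t r * w0 r.
    rewrite tw sumE /w0 !mulr_sumr -big_split /=.
    rewrite [ltLHS](bigD1 i) //= [ltRHS](bigD1 i) //=; apply: ltr_leD.
      have -> : g i z = 0 by rewrite /g (dot_lin2 _ E) E0.
      rewrite normr0; apply: ltr_pwDl; first by apply: mulr_gt0; rewrite // gtr0_norm.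
      by apply: mulr_ge0 => //; apply: ltW.
    apply: ler_sum => j _; rewrite /g (dot_lin2 _ E).
    by apply: (le_trans (ler_normD _ _)); rewrite !normrM (gtr0_norm a0) (gtr0_norm b0).
  exists ((\sum_r t r * w0 r - \sum_r t' r * w0 r) / 2); first by lra.
  move=> dl dl0 dl1 _ _ _; exists t, t'; split; first split=> //.
  - by move=> r; rewrite !inE negb_or /t => /andP[/negbTE-> /negbTE->].
  - by move=> r; rewrite /t; case: ifP => _; first exact: ltW; case: ifP => _ //; exact: ltW.
  - have := sumE (fun=> 1); rewrite !mulr1 ab => <-; by apply: eq_bigr => r _; rewrite mulr1.
  split; last by lra.
  by move=> n; rewrite sumE -zE E.
have [eps e0 He] := exists_eps gap.
have h2 : 0 < eps / 2 by lra.
have h3 : eps / 2 < eps by lra.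
have [w [ww wg]] := generic_near (fun v n => p v n) w0 h2.
exists V, p, e, w; split; first split=> //.
  by move=> r xP; exists (SeqSub (PP _ xP)).
move=> s fs i iH u v us vs hu; rewrite leNgt; apply/negP => hv.
have Xuv : X (spt (p u) :|: spt (p v)).
  have [_ Xs _] := fs; apply: (Xsub Xs); apply/subsetP => n; rewrite !inE.
  by case/orP=> h; apply/exists_inP; [exists u|exists v].
have [t [t' [[ts t0 t1 t'0 t'1] [tE lt]]]] := He _ h2 h3 (u, v, Ordinal iH) Xuv hu hv.
have ts' (r : V) : r \notin s -> t r = 0.
  move=> xs; apply: ts; apply: contra xs; rewrite !inE => /orP[/eqP->|/eqP->] //.
have tU (r : V) : r \notin [set: V] -> t' r = 0 by rewrite inE.
have [le _] := face_opt fs ts' t'0 tU tE.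
have near (f : V -> R) : (forall r, 0 <= f r) -> \sum_r f r = 1 ->
    `|\sum_r f r * w r - \sum_r f r * w0 r| <= eps / 2.
  move=> f0 f1; rewrite -sumrB; apply: (le_trans (ler_norm_sum _ _ _)).
  have -> : eps / 2 = \sum_r f r * (eps / 2) by rewrite -mulr_suml f1 mul1r.
  apply: ler_sum => r _.
  by rewrite -mulrBr normrM (ger0_norm (f0 r)); apply: ler_wpM2l => //; apply: ltW.
have := near _ t0 t1; have := near _ t'0 t'1; rewrite !ler_norml => /andP[n1 n2] /andP[n3 n4].
lra.
Qed.
End Cut.

(** * Subdivisions and piecewise-linear homeomorphisms *)

Definition XK (K : complex) (s : {set vert K}) : Prop := s = set0 \/ s \in simplices K.

Lemma XK0 K : XK (K:=K) set0. Proof. by left. Qed.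

Lemma XKsub K (s t : {set vert K}) : XK s -> t \subset s -> XK t.
Proof.
move=> [->|sK] ts; first by left; apply/eqP; rewrite -subset0.
have [->|t0] := eqVneq t set0; first by left.
by right; apply: simplices_sub sK ts t0.
Qed.

Lemma XK1 K (v : vert K) : XK [set v].
Proof. by right; apply: simplices1. Qed.

Lemma XKin K (s : {set vert K}) v : v \in s -> XK s -> s \in K.
Proof. by move=> vs [E|//]; rewrite E inE in vs. Qed.

Section Realize.
Variable R : realType.

Lemma inX_real (K : complex) (x : {ffun vert K -> R}) : inX (XK (K:=K)) x <-> realization x.
Proof.
split=> [[[x0 x1] Xx]|[s sK [x0 x1 xs]]].
  have sp v : x v != 0 -> v \in spt x by rewrite inE.
  have [v xv] : exists v, x v != 0.
    apply: contrapT => nx; move: x1; rewrite big1 => [/eqP|v _]; first by rewrite eq_sym oner_eq0.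
    by apply/eqP; apply: contraTT isT => xv; case: nx; exists v.
  exists (spt x); first exact: XKin (sp _ xv) Xx.
  by split=> // u; rewrite inE negbK => /eqP.
split=> //; apply: (@XKsub K s); first by right.
by apply/subsetP => v; rewrite inE; apply: contraNT => /xs ->.
Qed.

Lemma combE (W V : finType) (t : {ffun W -> R}) (pos : W -> {ffun V -> R}) v :
  combination t pos v = \sum_w t w * pos w v.
Proof. by rewrite ffunE. Qed.

Lemma comb_comb (U W V : finType) (t : {ffun U -> R}) (q : U -> {ffun W -> R})
    (pos : W -> {ffun V -> R}) :
  combination (combination t q) pos = combination t (fun u => combination (q u) pos).
Proof.
apply/ffunP => v; rewrite !combE; under eq_bigr do rewrite combE mulr_suml.
rewrite exchange_big /=; apply: eq_bigr => u _; rewrite combE mulr_sumr.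
by apply: eq_bigr => w _; rewrite mulrA.
Qed.

Lemma comb_eq (W V : finType) (t : {ffun W -> R}) (a : {set W}) (pos pos' : W -> {ffun V -> R}) :
  (forall w, w \notin a -> t w = 0) -> (forall w, w \in a -> pos w = pos' w) ->
  combination t pos = combination t pos'.
Proof.
move=> ta pp; apply/ffunP => v; rewrite !combE; apply: eq_bigr => w _.
by have [/pp ->//|/ta ->] := boolP (w \in a); rewrite !mul0r.
Qed.

Definition dirac (V : finType) (v : V) : {ffun V -> R} := [ffun u => (u == v)%:R].

Lemma diracE (V : finType) (f : V -> R) v : \sum_u dirac v u * f u = f v.
Proof.
rewrite (bigD1 v) //= ffunE eqxx mul1r big1 ?addr0 // => u /negbTE.
by rewrite ffunE => ->; rewrite mul0r.
Qed.

Lemma comb_dirac (W V : finType) (w : W) (pos : W -> {ffun V -> R}) :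
  combination (dirac w) pos = pos w.
Proof. by apply/ffunP => v; rewrite combE (diracE (fun w => pos w v)). Qed.

Lemma in_simplex_dirac (V : finType) (s : {set V}) v : v \in s -> in_simplex s (dirac v).
Proof.
move=> vs; split.
- by move=> u; rewrite ffunE ler0n.
- by have := diracE (fun=> 1) v; under eq_bigr do rewrite mulr1.
- by move=> u us; rewrite ffunE; case: eqP => // E; rewrite -E (negbTE us) in vs.
Qed.

Lemma in_simplex_comb (W V : finType) (a : {set W}) (s : {set V}) (t : {ffun W -> R})
    (pos : W -> {ffun V -> R}) : in_simplex a t -> (forall w, w \in a -> in_simplex s (pos w)) ->
  in_simplex s (combination t pos).
Proof.
move=> [t0 t1 ta] ps; split.
- move=> v; rewrite combE sumr_ge0 // => w _.
  have [/ps[p0 _ _]|/ta ->] := boolP (w \in a); last by rewrite mul0r.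
  by rewrite mulr_ge0.
- under eq_bigr do rewrite combE; rewrite exchange_big /= -t1; apply: eq_bigr => w _.
  rewrite -mulr_sumr; have [/ps[_ -> _]|/ta ->] := boolP (w \in a); last by rewrite mul0r.
  by rewrite mulr1.
- move=> v vs; rewrite combE big1 // => w _.
  have [/ps[_ _ p0]|/ta ->] := boolP (w \in a); last by rewrite mul0r.
  by rewrite p0 // mulr0.
Qed.

Lemma hull_vert (W V : finType) (pos : W -> {ffun V -> R}) (a : {set W}) w :
  w \in a -> hull pos a (pos w).
Proof. by move=> wa; exists (dirac w); [exact: in_simplex_dirac|rewrite comb_dirac]. Qed.

Lemma in_simplex_neq0 (V : finType) (s : {set V}) (x : {ffun V -> R}) : in_simplex s x -> s != set0.
Proof.
move=> [_ x1 xs]; apply/eqP => s0; move: x1; rewrite big1 => [/eqP|v _].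
  by rewrite eq_sym oner_eq0.
by apply: xs; rewrite s0 inE.
Qed.

Lemma in_simplexS (V : finType) (s t : {set V}) (x : {ffun V -> R}) :
  s \subset t -> in_simplex s x -> in_simplex t x.
Proof.
move=> st [x0 x1 xs]; split=> // v vt; apply: xs; apply: contra vt; exact: (subsetP st).
Qed.

Lemma indep_aff (W V : finType) (pos : W -> {ffun V -> R}) a :
  indep (fun w v => pos w v) a -> affinely_independent pos a.
Proof.
move=> ia c ca _ c0; apply/ffunP => w; rewrite ffunE; apply: ia => // v.
by move/ffunP/(_ v): c0; rewrite combE ffunE.
Qed.

Lemma aff_eq (W V : finType) (pos : W -> {ffun V -> R}) a (t t' : {ffun W -> R}) :
  affinely_independent pos a -> in_simplex a t -> in_simplex a t' ->
  combination t pos = combination t' pos -> t = t'.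
Proof.
move=> ia [_ t1 ta] [_ t1' ta'] E.
have : [ffun w => t w - t' w] = [ffun=> 0] :> {ffun W -> R}.
  apply: ia.
  - by move=> w wa; rewrite ffunE ta // ta' // subrr.
  - by under eq_bigr do rewrite ffunE; rewrite sumrB t1 t1' subrr.
  - apply/ffunP => v; rewrite combE ffunE; under eq_bigr do rewrite ffunE mulrBl.
    by rewrite sumrB -!combE E subrr.
by move/ffunP => E2; apply/ffunP => w; have := E2 w; rewrite !ffunE => /eqP; rewrite subr_eq0 => /eqP.
Qed.

Section SubT.
Variables (K A : complex) (pos : vert A -> {ffun vert K -> R}) (w : vert A -> R).
Let p (u : vert A) v := pos u v.
Hypotheses (hind : forall a, a \in A -> indep p a)
  (hface : forall a, a \in A -> face (XK (K:=K)) p setT w a)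
  (hbary : forall u, bary (pos u))
  (hcov : forall x : {ffun vert K -> R}, realization x -> exists2 a, a \in A & hull pos a x).

(** The intersection property is the uniqueness of lowest combinations, [face_uniq]. *)
Lemma face_subdivision : subdivision pos.
Proof.
have carrK a : a \in A -> carr p a \in K /\ forall x, hull pos a x -> in_simplex (carr p a) x.
  move=> aA; have [_ Xa _] := hface aA.
  have H x : hull pos a x -> in_simplex (carr p a) x.
    move=> [t ta ->]; apply: (in_simplex_comb ta) => u ua; have [u0 u1] := hbary u; split=> //.
    move=> v; rewrite inE; apply: contraNeq => uv; apply/exists_inP; by exists u.
  split=> //; have /set0Pn[u ua] := simplices_neq0 aA.
  have /in_simplex_neq0/set0Pn[v vc] := H _ (hull_vert pos ua).
  exact: XKin vc Xa.
split.
- by move=> a /hind/indep_aff.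
- move=> a b aA bA x [t [t0 t1 ta] Et] [t' [t0' t1' tb'] Et'].
  exists t => //; split=> // u; rewrite inE negb_and => /orP[/ta//|ub].
  apply: (face_uniq (hface bA) (hface aA) t0' tb' t0 ta _ ub) => v.
  by rewrite -!combE -Et -Et'.
- by move=> a /carrK[c1 c2]; exists (carr p a).
- move=> x; split=> [/hcov//|[a aA xa]]; have [c1 c2] := carrK _ aA.
  by exists (carr p a) => //; apply: c2.
Qed.
End SubT.

Lemma subdivision_inj (K A : complex) (pos : vert A -> {ffun vert K -> R}) a b t t' :
  subdivision pos -> a \in A -> b \in A -> in_simplex a t -> in_simplex b t' ->
  combination t pos = combination t' pos -> t = t'.
Proof.
move=> [s1 s2 s3 s4] aA bA ta tb E.
have [t2 ht2 E2] : hull pos (a :&: b) (combination t pos).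
  by apply: s2 => //; [exists t|exists t'].
have h1 := in_simplexS (subsetIl a b) ht2.
have h2 := in_simplexS (subsetIr a b) ht2.
by rewrite (aff_eq (s1 _ aA) ta h1 E2) (aff_eq (s1 _ bA) tb h2 (etrans (esym E) E2)).
Qed.

Lemma subdivision_real (K A : complex) (pos : vert A -> {ffun vert K -> R}) t :
  subdivision pos -> realization t -> realization (combination t pos).
Proof. by move=> [_ _ _ s4] [a aA ta]; apply/s4; exists a => //; exists t. Qed.

Lemma subdivision_comp (K A B : complex) (pos : vert A -> {ffun vert K -> R})
    (q : vert B -> {ffun vert A -> R}) : subdivision pos -> subdivision q ->
  subdivision (fun w => combination (q w) pos).
Proof.
move=> sp sq; have [s1 s2 s3 s4] := sp; have [q1 q2 q3 q4] := sq; split.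
- move=> b bB c cb c0 E; have [a aA ba] := q3 _ bB.
  apply: (q1 _ bB) => //; apply: (s1 _ aA); last by rewrite comb_comb.
    move=> u ua; rewrite combE big1 // => w _.
    have [wb|/cb ->] := boolP (w \in b); last by rewrite mul0r.
    by have [_ _ ->] := ba _ (hull_vert q wb); rewrite ?mulr0.
  under eq_bigr do rewrite combE; rewrite exchange_big /= -[RHS]c0; apply: eq_bigr => w _.
  rewrite -mulr_sumr; have [wb|/cb ->] := boolP (w \in b); last by rewrite mul0r.
  by have [_ -> _] := ba _ (hull_vert q wb); rewrite mulr1.
- move=> b b' bB bB' x [t tb Et] [t' tb' Et'].
  have [a aA ba] := q3 _ bB; have [a' aA' ba'] := q3 _ bB'.
  have h1 : hull q b (combination t q) by exists t.
  have h1' : hull q b' (combination t' q) by exists t'.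
  have E : combination t q = combination t' q.
    apply: (subdivision_inj sp aA aA' (ba _ h1) (ba' _ h1')).
    by rewrite !comb_comb -Et -Et'.
  rewrite -E in h1'; have [t2 ht2 E2] := q2 _ _ bB bB' _ h1 h1'.
  by exists t2 => //; rewrite Et -comb_comb E2 comb_comb.
- move=> b bB; have [a aA ba] := q3 _ bB; have [s sK as_] := s3 _ aA.
  exists s => // x [t tb ->]; apply: as_; exists (combination t q).
    by apply: ba; exists t.
  by rewrite comb_comb.
- move=> x; split=> [/s4[a aA [t ta ->]]|[b bB [t tb ->]]].
    have /q4[b bB [t' tb ->]] : realization t by exists a.
    by exists b => //; exists t' => //; rewrite comb_comb.
  rewrite -comb_comb; apply: (subdivision_real sp); apply/q4.
  by exists b => //; exists t.
Qed.

(** If every simplex of the subdivision A lies in a simplex of the subdivision B, then A subdivides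
    B as well; [al] gives the barycentric coordinates with respect to B. *)
Lemma subdivision_factor (K A B : complex) (pA : vert A -> {ffun vert K -> R})
    (pB : vert B -> {ffun vert K -> R}) (al : vert A -> {ffun vert B -> R}) :
  subdivision pA -> subdivision pB ->
  (forall w, realization (al w) /\ combination (al w) pB = pA w) ->
  (forall a, a \in A -> exists2 b, b \in B & forall w, w \in a -> hull pB b (pA w)) ->
  subdivision al.
Proof.
move=> sA sB hal hab; have [a1 a2 a3 a4] := sA; have [b1 b2 b3 b4] := sB.
have E t : combination (combination t al) pB = combination t pA.
  rewrite comb_comb; apply: (comb_eq (a := setT)) => w; first by rewrite inE.
  by move=> _; have [] := hal w.
have al_in a b : a \in A -> b \in B -> (forall w, w \in a -> hull pB b (pA w)) ->
    forall t, in_simplex a t -> in_simplex b (combination t al).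
  move=> aA bB ab t ta; apply: (in_simplex_comb ta) => w wa.
  have [t' tb Et] := ab _ wa; have [[b' bB' tb'] Ew] := hal w.
  suff -> : al w = t' by [].
  by apply: (subdivision_inj sB bB' bB tb' tb); rewrite Ew -Et.
split.
- move=> a aA c ca c0 c1; apply: (a1 _ aA) => //.
  by rewrite -E c1; apply/ffunP => v; rewrite combE !ffunE big1 // => w _; rewrite ffunE mul0r.
- move=> a a' aA aA' x [t ta Et] [t' ta' Et'].
  have h1 : hull pA a (combination t pA) by exists t.
  have E2 : combination t pA = combination t' pA by rewrite -!E -Et -Et'.
  have h2 : hull pA a' (combination t pA) by rewrite E2; exists t'.
  have [t2 ht2 Et2] := a2 _ _ aA aA' _ h1 h2.
  exists t2 => //; rewrite Et; congr (combination _ _).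
  by apply: (aff_eq (a1 _ aA) ta _ Et2); apply: in_simplexS (subsetIl _ _) ht2.
- move=> a aA; have [b bB ab] := hab _ aA; exists b => // x [t ta ->].
  exact: (al_in a b).
- move=> x; split=> [xr|[a aA [t ta ->]]]; last first.
    have [b bB ab] := hab _ aA; exists b => //; exact: (al_in a b).
  have /a4[a aA [t ta Et]] := subdivision_real sB xr.
  exists a => //; exists t => //; have [b bB ab] := hab _ aA.
  have [b' bB' xb'] := xr.
  by apply: (subdivision_inj sB bB' bB xb' (al_in _ _ aA bB ab _ ta)); rewrite E.
Qed.

Definition common (K L : complex) := exists (A : complex) (pK : vert A -> {ffun vert K -> R})
  (pL : vert A -> {ffun vert L -> R}), subdivision pK /\ subdivision pL.

Lemma common_sym K L : common K L -> common L K.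
Proof. by move=> [A [pK [pL [h1 h2]]]]; exists A, pL, pK. Qed.

Lemma subdivision_coord (K A : complex) (p : vert A -> {ffun vert K -> R}) : subdivision p ->
  exists co : {ffun vert K -> R} -> {ffun vert A -> R}, forall a t, a \in A -> in_simplex a t ->
    co (combination t p) = t.
Proof.
move=> sp; pose rep x t := (exists2 a, a \in A & in_simplex a t) /\ x = combination t p.
have /choice[co Hco] : forall x, exists t, (exists t', rep x t') -> rep x t.
  move=> x; have [[t rt]|nt] := pselect (exists t', rep x t'); first by exists t.
  by exists [ffun=> 0].
exists co => a t aA ta; have [|[b bA tb] E] := Hco (combination t p).
  by exists t; split=> //; exists a.
by apply/esym; apply: (subdivision_inj sp aA bA ta tb E).
Qed.

Lemma common_pl K L : common K L -> pl_homeomorphic R K L.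
Proof.
move=> [A [pK [pL [sK sL]]]].
have map M M' (p : vert A -> {ffun vert M -> R}) (p' : vert A -> {ffun vert M' -> R}) co :
    subdivision p -> subdivision p' ->
    (forall a t, a \in A -> in_simplex a t -> co (combination t p) = t) ->
    pl_map (K:=M) (L:=M') (fun x => combination (co x) p').
  move=> sp sp' coE; have [_ _ _ s4] := sp; split.
    move=> x /s4[a aA [t ta ->]]; rewrite (coE a) //.
    by apply: (subdivision_real sp'); exists a.
  exists A, p; split=> // a t aA ta; rewrite (coE a) //.
  apply: (comb_eq (a := a)); first by case: ta.
  move=> w wa; have h := in_simplex_dirac wa.
  by rewrite -(comb_dirac w p) (coE a) // comb_dirac.
have [cK HK] := subdivision_coord sK; have [cL HL] := subdivision_coord sL.
exists (fun x => combination (cK x) pL), (fun x => combination (cL x) pK).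
have [_ _ _ k4] := sK; have [_ _ _ l4] := sL.
split; [exact: (map _ _ _ _ _ sK sL HK)|exact: (map _ _ _ _ _ sL sK HL)| |].
- by move=> x /k4[a aA [t ta ->]]; rewrite (HK a) // (HL a).
- by move=> x /l4[a aA [t ta ->]]; rewrite (HL a) // (HK a).
Qed.

(** The vertices of a subdivision A of K on which f is affine are placed in L by f. Injectivity of f
    makes this a geometric complex and surjectivity makes it cover |L|. *)
Lemma pl_common K L : pl_homeomorphic R K L -> common K L.
Proof.
move=> [f [g [[fr [A [pos [sp faff]]]] [gr _] gf fg]]].
have [s1 s2 s3 s4] := sp; exists A, pos, (fun w => f (pos w)); split=> //.
have real a t : a \in A -> in_simplex a t -> realization (combination t pos).
  by move=> aA ta; apply/s4; exists a => //; exists t.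
have finj a b t t' : a \in A -> b \in A -> in_simplex a t -> in_simplex b t' ->
    combination t (fun w => f (pos w)) = combination t' (fun w => f (pos w)) ->
    combination t pos = combination t' pos.
  move=> aA bA ta tb; rewrite -(faff a) // -(faff b) // => E.
  by rewrite -[LHS]gf ?E ?gf //; [exact: real tb|exact: real ta].
pose bc (a : {set vert A}) : {ffun vert A -> R} := [ffun w => if w \in a then (#|a|%:R)^-1 else 0].
have bcP a : a \in A -> in_simplex a (bc a) /\ 0 < #|a|%:R :> R.
  move=> aA; have ca : 0 < #|a|%:R :> R by rewrite ltr0n card_gt0; apply: simplices_neq0 aA.
  split=> //; split.
  - by move=> w; rewrite ffunE; case: ifP => // _; rewrite invr_ge0 ltW.
  - under eq_bigr do rewrite ffunE; rewrite -big_mkcond /= sumr_const -[LHS]mulr_natr mulVf //.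
    by rewrite gt_eqF.
  - by move=> w /negbTE wa; rewrite ffunE wa.
split.
- move=> a aA c ca c0 E; have [[b0 b1 ba] ac] := bcP _ aA.
  (* A dependence c among the images, scaled by [ep] to stay inside the simplex, moves the
     barycenter to a point with the same image; by injectivity c = 0. *)
  pose S := \sum_w `|c w| + 1.
  have S0 : 0 < S by rewrite /S ltr_wpDl // sumr_ge0.
  pose ep := (#|a|%:R * S)^-1.
  have ep0 : 0 < ep by rewrite invr_gt0 mulr_gt0.
  pose t : {ffun vert A -> R} := [ffun w => bc a w + ep * c w].
  have ta : in_simplex a t.
    split.
    - move=> w; rewrite ffunE; have [wa|wa] := boolP (w \in a); last by rewrite ba // ca // mulr0 addr0.
      rewrite ffunE wa /ep invfM -mulrA -[X in X + _]mulr1 -mulrDr; apply: mulr_ge0; first by rewrite invr_ge0 ltW.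
      have : `|c w| <= S by rewrite /S (bigD1 w) //= -addrA lerDl addr_ge0 // sumr_ge0.
      rewrite ler_norml => /andP[h _].
      have : - 1 <= S^-1 * c w by rewrite mulrC ler_pdivlMr // mulN1r.
      lra.
    - under eq_bigr do rewrite ffunE; by rewrite big_split /= -mulr_sumr c0 mulr0 addr0.
    - by move=> w wa; rewrite ffunE ba // ca // mulr0 addr0.
  have : combination t (fun w => f (pos w)) = combination (bc a) (fun w => f (pos w)).
    apply/ffunP => v; rewrite !combE; under eq_bigr do rewrite ffunE mulrDl -mulrA.
    rewrite big_split /= -mulr_sumr; move/ffunP/(_ v): E; rewrite combE ffunE => ->.
    by rewrite mulr0 addr0.
  move=> /(finj a a) E1; have /ffunP E2 := aff_eq (s1 _ aA) ta (bcP _ aA).1 (E1 aA aA ta (bcP _ aA).1).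
  apply/ffunP => w; rewrite ffunE; have := E2 w; have -> : t w = bc a w + ep * c w by rewrite ffunE.
  move=> E3; have /eqP : ep * c w = 0 by lra.
  by rewrite mulf_eq0 gt_eqF //= => /eqP.
- move=> a b aA bA x [t ta Et] [t' tb Et'].
  have E : combination t pos = combination t' pos by apply: (finj a b) => //; rewrite -Et -Et'.
  have h1 : hull pos a (combination t pos) by exists t.
  have h2 : hull pos b (combination t pos) by rewrite E; exists t'.
  have [t2 ht2 E2] := s2 _ _ aA bA _ h1 h2; exists t2 => //.
  have abA : a :&: b \in A by apply: simplices_sub aA (subsetIl _ _) (in_simplex_neq0 ht2).
  by rewrite Et -(faff a) // E2 (faff (a :&: b)).
- move=> a aA; have [ba ca] := bcP _ aA.
  (* All coordinates of the barycenter are positive, so the simplex of L carrying its image carries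
     the image of every vertex of a. *)
  have [s sL [h0 h1 hs]] := fr _ (real _ _ aA ba).
  have pr w : realization (f (pos w)).
    apply: fr; rewrite -comb_dirac; apply: (real [set w]); first exact: simplices1.
    by apply: in_simplex_dirac; rewrite inE.
  exists s => // x [t ta ->]; apply: (in_simplex_comb ta) => w wa.
  have [s' sL' [w0 w1 ws]] := pr w; split=> // v vs; apply/eqP; apply: contraTT isT => wv.
  have := hs _ vs; rewrite (faff a) // combE => /eqP.
  rewrite psumr_eq0; last first.
    move=> u _; have [b0 _ _] := ba; have [? ? [u0 _ _]] := pr u; apply: mulr_ge0; [exact: b0|exact: u0].
  move=> /allP/(_ w); rewrite mem_index_enum mulf_eq0 (negbTE wv) orbF ffunE wa => /(_ isT).
  by rewrite invr_eq0 gt_eqF.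
- move=> y; split=> [yr|[a aA [t ta ->]]]; last by rewrite -(faff a) //; apply: fr; apply: real ta.
  have /s4[a aA [t ta E]] := gr _ yr; exists a => //; exists t => //.
  by rewrite -(faff a) // -E fg.
Qed.
End Realize.

(** * Refining subdivisions by hyperplanes *)

Section Refine.
Variable R : realType.

(** Points with coordinate sum 1 lie in the simplex exactly if they lie in the linear cone over it,
    and this cone is cut out of its span by the coordinate functionals. *)
Lemma hull_halfspaces (V N : finType) (q : V -> {ffun N -> R}) (b : {set V}) :
  indep (fun v n => q v n) b -> (forall v, bary (q v)) ->
  exists (m : nat) (h : nat -> N -> R), forall x : {ffun N -> R}, bary x ->
    (hull q b x <-> forall i, (i < m)%N -> 0 <= dot (h i) x).
Proof.
move=> ib qb; pose M : 'M[R]_(#|b|, #|N|) := \matrix_(i, j) q (enum_val i) (enum_val j).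
pose xr (x : {ffun N -> R}) : 'rV[R]_(#|N|) := \row_j x (enum_val j).
have sumV (c : 'rV[R]_(#|b|)) (f : V -> R) :
    \sum_v (\sum_i (enum_val i == v)%:R * c 0 i) * f v = \sum_i c 0 i * f (enum_val i).
  under eq_bigr do rewrite mulr_suml.
  rewrite exchange_big /=; apply: eq_bigr => i _.
  rewrite (bigD1 (enum_val i)) //= eqxx mul1r big1 ?addr0 // => v.
  by rewrite eq_sym => /negbTE ->; rewrite !mul0r.
have offb (c : 'rV[R]_(#|b|)) v : v \notin b -> \sum_i (enum_val i == v)%:R * c 0 i = 0.
  move=> vb; apply: big1 => i _; case: eqP => [E|_]; last by rewrite mul0r.
  by move: vb; rewrite -E enum_valP.
have cM (c : 'rV[R]_(#|b|)) n : (c *m M) 0 (enum_rank n) = \sum_i c 0 i * q (enum_val i) n.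
  by rewrite mxE; apply: eq_bigr => i _; rewrite mxE enum_rankK.
have fM : row_free M.
  apply: inj_row_free => c cM0; apply/rowP => i; rewrite mxE.
  have := ib (fun v => \sum_i (enum_val i == v)%:R * c 0 i) (offb c).
  move=> /(_ _ (enum_val i)); rewrite (bigD1 i) //= eqxx mul1r big1 ?addr0; last first.
    by move=> j /negbTE ji; rewrite (inj_eq enum_val_inj) ji mul0r.
  by apply=> n; rewrite sumV -cM cM0 mxE.
pose fc m (Q : 'M[R]_(#|N|, m)) i (n : N) : R := Q (enum_rank n) i.
have fcE m (Q : 'M[R]_(#|N|, m)) i (x : {ffun N -> R}) : dot (fc m Q i) x = (xr x *m Q) 0 i.
  rewrite mxE /dot [RHS](reindex (@enum_rank N)) /=; last by apply: onW_bij; apply: enum_rank_bij.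
  by apply: eq_bigr => n _; rewrite /fc mxE enum_rankK mulrC.
(* The columns of [pinvmx] give the coordinates, those of [cokermx] the equations of the span, each
   entered as two inequalities. *)
pose H := [seq fc _ (pinvmx M) i | i <- enum 'I_(#|b|)] ++
  ([seq fc _ (cokermx M) i | i <- enum 'I_(#|N|)] ++ [seq fc _ (- cokermx M) i | i <- enum 'I_(#|N|)]).
have allH (P : (N -> R) -> Prop) : (forall i, (i < size H)%N -> P (nth (fun=> 0) H i)) <->
    [/\ forall i, P (fc _ (pinvmx M) i), forall i, P (fc _ (cokermx M) i) &
        forall i, P (fc _ (- cokermx M) i)].
  have inP (I : finType) (f : I -> N -> R) : (forall i, (i < size [seq f j | j <- enum I])%N ->
      P (nth (fun=> 0) [seq f j | j <- enum I] i)) <-> forall j, P (f j).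
    split=> [Hi j|Hj i].
      have /Hi : (index j (enum I) < size [seq f j | j <- enum I])%N by rewrite size_map index_mem mem_enum.
      by rewrite (nth_map j) ?nth_index ?index_mem ?mem_enum.
    rewrite size_map => iI; have [j _] : exists j : I, true.
      by case: (enum I) iI => // j s _; exists j.
    by rewrite (nth_map j).
  have catP (s1 s2 : seq (N -> R)) : (forall i, (i < size (s1 ++ s2))%N -> P (nth (fun=> 0) (s1 ++ s2) i)) <->
      (forall i, (i < size s1)%N -> P (nth (fun=> 0) s1 i)) /\ (forall i, (i < size s2)%N -> P (nth (fun=> 0) s2 i)).
    rewrite size_cat; split=> [Hi|[H1 H2] i ilt].
      split=> i ilt; first by have := Hi i; rewrite nth_cat ilt; apply; rewrite ltn_addr.
      by have := Hi (size s1 + i)%N; rewrite ltn_add2l nth_cat addKn => /(_ ilt); rewrite ltnNge leq_addr.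
    rewrite nth_cat; case: ifP => [/H1 //|/negbT]; rewrite -leqNgt => le; apply: H2.
    by rewrite ltn_subLR.
  by rewrite !catP !inP; split=> [[? []]|[]].
exists (size H), (fun i => nth (fun=> 0) H i) => x bx.
rewrite (allH (fun h => 0 <= dot h x)); split.
  move=> [t [t0 t1 tb] ->].
  pose c : 'rV[R]_(#|b|) := \row_i t (enum_val i).
  have xc : xr (combination t q) = c *m M.
    apply/rowP => j; rewrite mxE -[j]enum_valK cM combE enum_valK.
    rewrite (bigID (mem b)) /= [X in _ + X]big1 ?addr0; last first.
      by move=> v vb; rewrite tb ?mul0r.
    by rewrite big_enum_val /=; apply: eq_bigr => i _; rewrite mxE.
  split=> i; rewrite fcE xc -mulmxA.
  - by rewrite mulmxVp // mulmx1 mxE.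
  - by rewrite mulmx_coker mulmx0 mxE.
  - by rewrite mulmxN mulmx_coker oppr0 mulmx0 mxE.
move=> [H1 H2 H3].
have sx : (xr x <= M)%MS.
  rewrite submxE; apply/eqP/rowP => j; rewrite [RHS]mxE; apply/eqP; rewrite eq_le -fcE H2 andbT.
  by have := H3 j; rewrite !fcE mulmxN mxE oppr_ge0.
pose c := xr x *m pinvmx M.
have xE n : x n = \sum_i c 0 i * q (enum_val i) n.
  by rewrite -cM /c mulmxKpV // mxE enum_rankK.
have xT n : x n = \sum_v (\sum_i (enum_val i == v)%:R * c 0 i) * q v n by rewrite sumV.
exists [ffun v => \sum_i (enum_val i == v)%:R * c 0 i].
  split.
  - move=> v; rewrite ffunE; apply: sumr_ge0 => i _; apply: mulr_ge0; first exact: ler0n.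
    by rewrite /c -fcE.
  - under eq_bigr do rewrite ffunE.
    rewrite -[RHS](proj2 bx); under [RHS]eq_bigr do rewrite xT.
    rewrite [RHS]exchange_big /=; apply: eq_bigr => v _; rewrite -mulr_sumr.
    by have [_ ->] := qb v; rewrite mulr1.
  - by move=> v vb; rewrite ffunE offb.
apply/ffunP => n; rewrite combE [LHS]xT; by apply: eq_bigr => v _; rewrite ffunE.
Qed.

Lemma sum_sub (V : finType) (P : pred V) (F : V -> R) : (forall v, ~~ P v -> F v = 0) ->
  \sum_v F v = \sum_(u : {v | P v}) F (val u).
Proof.
move=> FP; transitivity (\sum_v \sum_(u : {v | P v} | val u == v) F (val u)).
  apply: eq_bigr => v _; have [Pv|nP] := boolP (P v).
    by rewrite (big_pred1 (exist _ v Pv)) // => u; rewrite -val_eqE.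
  rewrite FP // big1 // => u /eqP E; by rewrite -E (valP u) in nP.
rewrite (exchange_big_dep predT) //=; apply: eq_bigr => u _.
by rewrite (big_pred1 (val u)) // => v; rewrite eq_sym.
Qed.

Lemma bary_real (K : complex) (x : {ffun vert K -> R}) : realization x -> bary x.
Proof. by case/inX_real. Qed.

Lemma real_dirac (K : complex) (v : vert K) : realization (dirac R v).
Proof. by exists [set v]; [exact: simplices1|apply: in_simplex_dirac; rewrite inE]. Qed.

Lemma subdivision_vert (K A : complex) (p : vert A -> {ffun vert K -> R}) w :
  subdivision p -> realization (p w).
Proof. by move=> sp; rewrite -comb_dirac; apply: subdivision_real sp (real_dirac w). Qed.

(** All points have coordinate sum 1, so the coefficients of a linear dependence sum to 0. *)
Lemma aff_indep (W V : finType) (pos : W -> {ffun V -> R}) a : (forall w, bary (pos w)) ->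
  affinely_independent pos a -> indep (fun w v => pos w v) a.
Proof.
move=> bp ia d da d0 w.
have /ffunP/(_ w) : [ffun w => d w] = [ffun=> 0] :> {ffun W -> R}; last by rewrite !ffunE.
apply: ia => [u ua||]; first by rewrite ffunE da.
  have : \sum_v \sum_u d u * pos u v = 0 by apply: big1 => v _.
  rewrite exchange_big /= => E; rewrite -[RHS]E; apply: eq_bigr => u _.
  by rewrite ffunE -mulr_sumr; have [_ ->] := bp u; rewrite mulr1.
by apply/ffunP => v; rewrite combE ffunE -[RHS](d0 v); apply: eq_bigr => u _; rewrite ffunE.
Qed.

Lemma subdivision_indep (K A : complex) (p : vert A -> {ffun vert K -> R}) a :
  subdivision p -> a \in A -> indep (fun w v => p w v) a.
Proof.
move=> sp aA; apply: aff_indep; last by have [h _ _ _] := sp; apply: h.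
by move=> w; apply: bary_real; apply: subdivision_vert.
Qed.

Lemma cut_family (N J : finType) (X : {set N} -> Prop) (h : J -> N -> R) (P0 : seq {ffun N -> R}) :
  X set0 -> (forall s t : {set N}, X s -> t \subset s -> X t) -> (forall n, X [set n]) ->
  (forall x, x \in P0 -> inX X x) ->
  exists (V : finType) (p : V -> {ffun N -> R}) (e : N -> V) (w : V -> R),
  [/\ forall v, inX X (p v), forall n, p (e n) = dirac R n, injective p,
      forall x, x \in P0 -> exists v, p v = x & gen (fun v n => p v n) setT w] /\
  forall s, face X (fun v n => p v n) setT w s -> forall j u v, u \in s -> v \in s ->
    0 < dot (h j) (p u) -> 0 <= dot (h j) (p v).
Proof.
move=> X0 Xsub X1 HP.
have [V [p [e [w [H1 H2]]]]] := cut Xsub X1 [seq h j | j <- enum J] HP.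
exists V, p, e, w; split=> // s fs j u v us vs.
have ji : (index j (enum J) < size [seq h j | j <- enum J])%N by rewrite size_map index_mem mem_enum.
have := H2 s fs _ ji u v us vs.
by rewrite (nth_map j) ?nth_index ?index_mem ?mem_enum.
Qed.

Lemma cut_cover (N V : finType) (X : {set N} -> Prop) (p : V -> {ffun N -> R}) (e : N -> V) w x :
  (forall s t : {set N}, X s -> t \subset s -> X t) ->
  (forall v, inX X (p v)) -> (forall n, p (e n) = dirac R n) -> inX X x ->
  exists s (t : {ffun V -> R}), [/\ face X (fun v n => p v n) setT w s, in_simplex s t & x = combination t p].
Proof.
move=> Xsub pX pe [bx Xx]; have [x0 x1] := bx.
have pe' n m : p (e n) m = (m == n)%:R by rewrite pe ffunE.
have [s [t [fs t0 ts xE]]] := @face_cover _ _ _ X (fun v n => p v n) e Xsub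
  (fun v => (pX v).1.1) (fun v => (pX v).1.2) pe' setT w (fun n => x n)
  (fun n => in_setT _) x0 Xx.
exists s, [ffun v => t v]; split=> //; last first.
  by apply/ffunP => n; rewrite xE combE; apply: eq_bigr => v _; rewrite ffunE.
split=> [v||v /ts]; rewrite ?ffunE //.
under eq_bigr do rewrite ffunE.
rewrite -x1; under [RHS]eq_bigr do rewrite xE.
rewrite exchange_big /=; apply: eq_bigr => v _; rewrite -mulr_sumr.
by rewrite (pX v).1.2 mulr1.
Qed.

Lemma face_subset (N V : finType) (X : {set N} -> Prop) (p : V -> N -> R) w (s t : {set V}) :
  (forall s t : {set N}, X s -> t \subset s -> X t) -> gen p setT w ->
  face X p setT w s -> t \subset s -> face X p setT w t.
Proof.
move=> Xsub g fs; apply: (face_sub Xsub fs); have [_ _ [l [l1 _]]] := fs.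
by apply: g; [exact: subsetT|exists l].
Qed.

Lemma cut_complex (K : complex) (J : finType) (h : J -> vert K -> R) :
  exists (T : complex) (p : vert T -> {ffun vert K -> R}), subdivision p /\
  forall a j u v, a \in T -> u \in a -> v \in a -> 0 < dot (h j) (p u) -> 0 <= dot (h j) (p v).
Proof.
have [|V [p [e [w [[pX pe pI _ pg] nc]]]]] := @cut_family _ J (XK (K:=K)) h [::] (@XK0 K) (@XKsub K) (@XK1 K).
  by [].
pose fc (s : {set V}) := face (XK (K:=K)) (fun v n => p v n) setT w s.
have fcs (s t : {set V}) : fc s -> t \subset s -> fc t by apply: face_subset => //; exact: (@XKsub K).
(* A point of V need not be a vertex of the triangulation, whereas every vertex of a [complex] is a
   simplex. *)
pose W := {v : V | `[< fc [set v] >]}.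
pose S := [set s : {set W} | (s != set0) && `[< fc (val @: s) >]].
have S0 (s : {set W}) : s \in S -> s != set0 by rewrite inE => /andP[].
have Ss (s t : {set W}) : s \in S -> t \subset s -> t != set0 -> t \in S.
  rewrite !inE => /andP[_ /asboolP fs] ts ->; apply/asboolP; apply: fcs fs _; exact: imsetS.
have S1 u : [set u] \in S.
  rewrite inE imset_set1; apply/andP; split; last exact: valP u.
  by apply/set0Pn; exists u; rewrite inE.
exists (Complex S0 Ss S1), (fun u => p (val u)); split; last first.
  move=> a j u v; rewrite inE => /andP[_ /asboolP fa] ua va.
  by apply: (nc _ fa); apply: imset_f.
have SF (a : {set W}) : a \in S -> fc (val @: a) by rewrite inE => /andP[_ /asboolP].
apply: (@face_subdivision _ K (Complex S0 Ss S1) (fun u => p (val u)) (fun u => w (val u))).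
- move=> a /SF fa; have [_ _ [l [l1 _]]] := fa.
  have ia : indep (fun v n => p v n) (val @: a) by apply: pg; [exact: subsetT|exists l].
  move=> d da d0 u.
  pose d' v := \sum_(u : W | val u == v) d u.
  have dE (F : V -> R) : \sum_v d' v * F v = \sum_u d u * F (val u).
    rewrite /d'; under eq_bigr do rewrite mulr_suml.
    rewrite (exchange_big_dep predT) //=; apply: eq_bigr => u' _.
    by rewrite (big_pred1 (val u')) // => v; rewrite eq_sym.
  have -> : d u = d' (val u) by rewrite /d' (big_pred1 u) // => u'; rewrite val_eqE.
  apply: ia => [v va|n]; last by rewrite dE; apply: d0.
  apply: big1 => u' /eqP E; apply: da; apply: contra va => ua; by rewrite -E imset_f.
- move=> a /SF [_ Xa [l [l1 l2]]]; split; first exact: subsetT.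
    apply: XKsub Xa _; apply/subsetP => n; rewrite !inE => /exists_inP[u ua pu].
    by apply/exists_inP; exists (val u) => //; apply: imset_f.
  exists l; split=> u; first by move=> ua; apply: l1; apply: imset_f.
  rewrite !inE andbT => ua; apply: l2; rewrite !inE andbT; apply: contra ua.
  by case/imsetP => u' ua' /val_inj ->.
- by move=> u; have [] := pX (val u).
- move=> x /inX_real xX; have [s [t [fs ts xE]]] := cut_cover w (@XKsub K) pX pe xX.
  have [t0 t1 tz] := ts; have /set0Pn[v0 v0s] := in_simplex_neq0 ts.
  have inW v : v \in s -> `[< fc [set v] >].
    by move=> vs; apply/asboolP; apply: fcs fs _; rewrite sub1set.
  have vE : val @: [set u : W | val u \in s] = s.
    apply/setP => v; apply/imsetP/idP => [[u]|vs]; first by rewrite inE => ? ->.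
    by exists (exist _ v (inW _ vs)); rewrite ?inE.
  have nW (F : V -> R) v : ~~ `[< fc [set v] >] -> t v * F v = 0.
    by move=> nv; rewrite tz ?mul0r //; apply: contra nv; apply: inW.
  exists [set u : W | val u \in s].
    rewrite inE vE; apply/andP; split; last exact/asboolP.
    by apply/set0Pn; exists (exist _ v0 (inW _ v0s)); rewrite inE.
  exists [ffun u => t (val u)].
    split=> [u||u]; rewrite ?inE ?ffunE //; last exact: tz.
    under eq_bigr do rewrite ffunE; rewrite -sum_sub // => v nv.
    by have := nW (fun=> 1) _ nv; rewrite mulr1.
  apply/ffunP => n; rewrite xE !combE (sum_sub (P := fun v => `[< fc [set v] >])); last exact: nW.
  by apply: eq_bigr => u _; rewrite ffunE.
Qed.
End Refine.

Section Trans.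
Variable R : realType.

Definition barycenter (V : finType) (a : {set V}) : {ffun V -> R} :=
  [ffun v => if v \in a then (#|a|%:R)^-1 else 0].

Lemma barycenter_in (V : finType) (a : {set V}) : a != set0 -> in_simplex a (barycenter a).
Proof.
rewrite -card_gt0 => a0; have ca : 0 < #|a|%:R :> R by rewrite ltr0n.
split.
- by move=> w; rewrite ffunE; case: ifP => // _; rewrite invr_ge0 ltW.
- under eq_bigr do rewrite ffunE; rewrite -big_mkcond /= sumr_const -[LHS]mulr_natr mulVf //.
  by rewrite gt_eqF.
- by move=> w /negbTE wa; rewrite ffunE wa.
Qed.

Lemma barycenter_gt0 (V : finType) (a : {set V}) v : v \in a -> 0 < barycenter a v.
Proof.
move=> va; rewrite ffunE va invr_gt0 ltr0n card_gt0; apply/set0Pn; by exists v.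
Qed.

(* All the half-spaces cutting out the simplices of a subdivision. *)
Lemma subdivision_halfspaces (K B : complex) (q : vert B -> {ffun vert K -> R}) : subdivision q ->
  exists (J : finType) (h : J -> vert K -> R),
  forall (V : finType) (p : V -> {ffun vert K -> R}) (a : {set V}), a != set0 ->
    (forall t, in_simplex a t -> realization (combination t p)) ->
    (forall j u v, u \in a -> v \in a -> 0 < dot (h j) (p u) -> 0 <= dot (h j) (p v)) ->
    exists2 b, b \in B & forall w, w \in a -> hull q b (p w).
Proof.
move=> sq; have qv v := bary_real (subdivision_vert v sq).
have /choice[f Hf] : forall b : {set vert B}, exists mh : nat * (nat -> vert K -> R), b \in B ->
    forall x : {ffun vert K -> R}, bary x ->
      (hull q b x <-> forall i, (i < mh.1)%N -> 0 <= dot (mh.2 i) x).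
  move=> b; have [bB|nb] := boolP (b \in B); last by exists (0%N, fun=> fun=> 0).
  have [m [h H]] := hull_halfspaces (subdivision_indep sq bB) qv.
  by exists (m, h).
exists {b : {set vert B} & 'I_((f b).1)},
  (fun j : {b : {set vert B} & 'I_((f b).1)} => (f (tag j)).2 (nat_of_ord (tagged j))).
move=> V p a a0 rp nc.
have bca := barycenter_in a0; set bc := barycenter a in bca.
(* The simplex b is the one containing the barycenter of a. If a vertex of a violated a half-space
   of b, no vertex could lie strictly inside it, and the barycenter would violate it too. *)
have zr := rp _ bca; have [_ _ _ q4] := sq; have /q4[b bB zb] := zr.
exists b => // w wa.
apply/(Hf _ bB); first by apply: bary_real; rewrite -comb_dirac; apply: rp; apply: in_simplex_dirac.
move=> i im; set h := (f b).2 i; rewrite leNgt; apply/negP => hw.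
have hz := (Hf _ bB _ (bary_real zr)).1 zb i im.
have hle u : u \in a -> dot h (p u) <= 0.
  move=> ua; rewrite leNgt; apply/negP => hu.
  have := nc (Tagged (fun b : {set vert B} => 'I_((f b).1)) (Ordinal im)) u w ua wa hu.
  by rewrite /= leNgt hw.
have : dot h (combination bc p) < 0.
  have -> : dot h (combination bc p) = \sum_u bc u * dot h (p u).
    by rewrite -dot_sumr; apply: eq_bigr => n _; rewrite combE.
  rewrite (bigD1 w) //=.
  have h1 : bc w * dot h (p w) < 0 by rewrite pmulr_rlt0 // barycenter_gt0.
  have h2 : \sum_(u | u != w) bc u * dot h (p u) <= 0.
    apply: sumr_le0 => u _; have [ua|ua] := boolP (u \in a); last by rewrite ffunE (negbTE ua) mul0r.
    by apply: mulr_ge0_le0 (hle _ ua); have [b0 _ _] := bca.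
  lra.
by rewrite ltNge hz.
Qed.

(** The common subdivision A of K and L is cut by the half-spaces of the simplices of B, pulled back
    to A along [pL]. The result refines A and B at once, and so subdivides K and M. *)
Lemma common_trans K L M : common R K L -> common R L M -> common R K M.
Proof.
move=> [A [pK [pL [sK sL]]]] [B [qL [qM [tL tM]]]].
have [J [h Hh]] := subdivision_halfspaces tL.
have [T [pT [sT nc]]] := @cut_complex R A J (fun j w => dot (h j) (pL w)).
have sTL := subdivision_comp sL sT.
have dE j (x : {ffun vert A -> R}) : dot (fun w => dot (h j) (pL w)) x = dot (h j) (combination x pL).
  rewrite dotC /dot; under eq_bigr do rewrite mulr_sumr.
  rewrite exchange_big /=; apply: eq_bigr => n _; rewrite combE mulr_sumr.
  by apply: eq_bigr => w _; rewrite mulrCA.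
have ref a : a \in T -> exists2 b, b \in B & forall w, w \in a -> hull qL b (combination (pT w) pL).
  move=> aT; apply: Hh => [|t ta|j u v ua va]; first exact: simplices_neq0 aT.
    by apply: (subdivision_real sTL); exists a.
  by rewrite -!dE; apply: (nc _ _ _ _ aT ua va).
have [_ _ _ l4] := tL.
have /choice[al Hal] : forall w, exists y, realization y /\ combination y qL = combination (pT w) pL.
  move=> w; have /l4[b bB [t tb ->]] := subdivision_vert w sTL.
  by exists t; split=> //; exists b.
exists T, (fun w => combination (pT w) pK), (fun w => combination (al w) qM).
split; first exact: subdivision_comp.
apply: (subdivision_comp tM); exact: (subdivision_factor sTL tL Hal ref).
Qed.

Lemma dirac_subdivision (K A : complex) (f : vert A -> vert K) : bijective f ->
  im_simplices f A = K -> subdivision (fun u => dirac R (f u)).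
Proof.
move=> fB fA; have fI := bij_inj fB; have [g fK gK] := fB.
have dE l u : dot l (dirac R (f u)) = l (f u).
  by rewrite dotC /dot diracE.
apply: (@face_subdivision _ K A _ (fun=> 0)).
- move=> a aA d da d0 u; rewrite -[RHS](d0 (f u)) (bigD1 u) //= ffunE eqxx mulr1 big1 ?addr0 // => v vu.
  by rewrite ffunE (inj_eq fI) eq_sym (negbTE vu) mulr0.
- move=> a aA; split; first exact: subsetT.
    right; rewrite -fA; apply/imsetP; exists a => //.
    apply/setP => n; rewrite inE; apply/exists_inP/imsetP => [[u ua]|[u ua ->]].
      by rewrite ffunE; have [->|nf] := eqVneq n (f u); [exists u|rewrite eqxx].
    by exists u => //; rewrite ffunE eqxx oner_neq0.
  exists (fun n => if n \in f @: a then 0 else -1); split=> u; rewrite dE mem_imset //.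
    by move=> ->.
  by rewrite !inE andbT => /negbTE ->; rewrite ltrN10.
- by move=> u; apply: bary_real; apply: real_dirac.
- move=> x [s]; rewrite -fA => /imsetP[a aA ->] [x0 x1 xs].
  exists a => //; exists [ffun u => x (f u)].
    split=> [u||u ua]; rewrite ?ffunE //; last by apply: xs; rewrite mem_imset.
    under eq_bigr do rewrite ffunE.
    by rewrite -[RHS]x1 [RHS](reindex f) //; apply: onW_bij.
  apply/ffunP => n; rewrite combE (bigD1 (g n)) //= !ffunE gK eqxx mulr1 big1 ?addr0 // => u ug.
  rewrite !ffunE; case: eqP => [E|_]; last by rewrite mulr0.
  by move: ug; rewrite E fK eqxx.
Qed.

Lemma common_iso K L : isomorphic K L -> common R K L.
Proof.
move=> [f [fB fK]]; exists K, (fun u => dirac R u), (fun u => dirac R (f u)); split.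
  apply: (@dirac_subdivision K K id); first by exists id.
  by apply/setP => s; apply/imsetP/idP => [[t tK ->]|sK]; [rewrite imset_id|exists s; rewrite ?imset_id].
exact: dirac_subdivision.
Qed.

Lemma pl_sym K L : pl_homeomorphic R K L -> pl_homeomorphic R L K.
Proof. by move=> /pl_common/common_sym/common_pl. Qed.

Lemma pl_trans K L M : pl_homeomorphic R K L -> pl_homeomorphic R L M -> pl_homeomorphic R K M.
Proof. by move=> /pl_common h1 /pl_common h2; apply/common_pl/(common_trans h1 h2). Qed.

Lemma pl_iso K L : isomorphic K L -> pl_homeomorphic R K L.
Proof. by move=> /common_iso/common_pl. Qed.

(* The intermediate T is a regular subdivision of both K and A, so that two
   sweeps suffice. *)
Lemma subdivision_flips (K A : complex) (pos : vert A -> {ffun vert K -> R}) : subdivision pos ->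
  exists (V : finType) (eK : vert K -> V) (eA : vert A -> V) (T : {set V} -> Prop),
  [/\ injective eK, injective eA,
      feqS (fun s => exists2 a, XK a & s = eK @: a) T &
      feqS (fun s => exists2 a, XK a & s = eA @: a) T].
Proof.
move=> sp; have [s1 s2 s3 s4] := sp.
have [J [h Hh]] := subdivision_halfspaces sp.
have [|V [p [eK [w [[pX pe pI pP pg] nc]]]]] :=
  @cut_family R _ J (XK (K:=K)) h [seq pos u | u <- enum (vert A)] (@XK0 K) (@XKsub K) (@XK1 K).
  by move=> x /mapP[u _ ->]; apply/inX_real; apply: subdivision_vert.
pose T := face (XK (K:=K)) (fun v n => p v n) setT w.
have fp v : realization (p v) by apply/inX_real.
(* The points of V in barycentric coordinates with respect to A; they are used to see T as a regular
   triangulation over A. *)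
have /choice[al Hal] : forall v, exists y, realization y /\ combination y pos = p v.
  move=> v; have /s4[b bB [t tb ->]] := fp v.
  by exists t; split=> //; exists b.
have alb v : bary (al v) by apply: bary_real; have [] := Hal v.
have alE (x : V -> R) n : \sum_v x v * p v n = \sum_u (\sum_v x v * al v u) * pos u n.
  under [RHS]eq_bigr do rewrite mulr_suml.
  rewrite exchange_big /=; apply: eq_bigr => v _.
  have [_ <-] := Hal v; rewrite combE mulr_sumr; by apply: eq_bigr => u _; rewrite mulrA.
have /choice[eA HeA] : forall u, exists v, p v = pos u.
  by move=> u; apply: pP; apply: map_f; rewrite mem_enum.
have aleA u : al (eA u) = dirac R u.
  have [[b bA tb] E] := Hal (eA u).
  apply: (subdivision_inj sp bA (simplices1 u) tb); first by apply: in_simplex_dirac; rewrite inE.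
  by rewrite E comb_dirac HeA.
have alI : injective al.
  by move=> v v' E; apply: pI; rewrite -(Hal v).2 E (Hal v').2.
have diracI (W : finType) (u v : W) : dirac R u = dirac R v -> u = v.
  move=> /ffunP/(_ u); rewrite !ffunE eqxx; case: eqP => // _ /eqP; by rewrite oner_eq0.
have eKI : injective eK.
  by move=> m n E; apply: diracI; rewrite -!pe E.
have eAI : injective eA.
  by move=> m n E; apply: diracI; rewrite -!aleA E.
have Tsub (s t : {set V}) : T s -> t \subset s -> T t by apply: face_subset => //; exact: (@XKsub K).
have Treal s t : T s -> in_simplex s t -> realization (combination t p).
  move=> [_ Xs _] ts; apply/inX_real; split.
    have [|c0 c1 _] := in_simplex_comb (s := setT) ts (pos := p); last by split.
    by move=> v _; have [[c0 c1] _] := pX v; split=> // u; rewrite inE.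
  apply: (XKsub Xs); have [_ _ tz] := ts; apply/subsetP => n; rewrite !inE combE.
  apply: contraR; rewrite negb_exists => /forallP H; rewrite big1 // => v _.
  have [vs|vs] := boolP (v \in s); last by rewrite tz ?mul0r.
  by have := H v; rewrite vs negbK => /eqP ->; rewrite mulr0.
(* T respects the half-spaces of A, hence refines A. *)
have Tref s : T s -> s != set0 -> carr (fun v u => al v u) s \in A.
  move=> Ts s0; have [b bA hb] := Hh _ p s s0 (fun t => Treal s t Ts) (nc _ Ts).
  have alb' v : v \in s -> in_simplex b (al v).
    move=> /hb[t tb E]; have [[b' bA' tb'] E'] := Hal v.
    by rewrite (subdivision_inj sp bA' bA tb' tb) // E' -E.
  apply: (simplices_sub bA).
    apply/subsetP => u; rewrite inE => /exists_inP[v /alb'[_ _ z]]; apply: contraNT => /z ->.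
    by [].
  have /set0Pn[v vs] := s0; have [_ v1 _] := alb' _ vs.
  apply/eqP => c0; move: v1; rewrite big1 => [/eqP|u _]; first by rewrite eq_sym oner_eq0.
  apply/eqP; apply: contraTT isT => vu; have : u \in carr (fun v u => al v u) s.
    by rewrite inE; apply/exists_inP; exists v.
  by rewrite c0 inE.
pose TA := face (XK (K:=A)) (fun v u => al v u) setT w.
(* The simplices of A are independent in K, so a functional on the coordinates of a simplex of A
   extends to K, where the heights are generic. *)
have genA s : XK (carr (fun v u => al v u) s) -> (exists l, forall v, v \in s -> dot l (al v) = w v) ->
    indep (fun v u => al v u) s.
  move=> Xs [l Hl]; set a := carr _ s in Xs.
  have ia : indep (fun u n => pos u n) a.
    case: Xs => [->|aA]; last exact: subdivision_indep sp aA.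
    by move=> d d0 _ u; apply: d0; rewrite inE.
  have [[m [m1 _]]|[d [d1 d2 d3 d4 d5]]] := motzkin (fun u n => pos u n) l (subxx a); last first.
    have d0 := ia _ d1 d3.
    by case: d5 => [|[u]]; [rewrite big1 ?ltxx // => u _; rewrite d0 mul0r|rewrite setDv inE].
  have mE v : v \in s -> dot m (p v) = w v.
    move=> vs; rewrite -(Hl _ vs) -(Hal v).2.
    have -> : dot m (combination (al v) pos) = \sum_u al v u * dot m (pos u).
      by rewrite -dot_sumr; apply: eq_bigr => n _; rewrite combE.
    rewrite dotC; apply: eq_bigr => u _; have [ua|ua] := boolP (u \in a); first by rewrite m1.
    suff -> : al v u = 0 by rewrite !mul0r.
    apply/eqP; apply: contraNT ua => vu; rewrite inE; apply/exists_inP; by exists v.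
  have ip : indep (fun v n => p v n) s by apply: pg; [exact: subsetT|exists m].
  move=> d d1 d2; apply: ip => // n; rewrite alE big1 // => u _; by rewrite d2 mul0r.
(* A supporting functional on K pulls back to A along [pos], with the same values on the points of
   V. *)
have TTA s : T s -> TA s.
  move=> Ts; have [_ _ [l [l1 l2]]] := Ts; split; first exact: subsetT.
    have [->|s0] := eqVneq s set0; last by right; apply: Tref.
    left; apply/setP => u; rewrite !inE; apply/existsP => -[v]; by rewrite inE.
  have lE v : dot (fun u => dot l (pos u)) (al v) = dot l (p v).
    rewrite -(Hal v).2 dotC.
    have -> : dot l (combination (al v) pos) = \sum_u al v u * dot l (pos u).
      by rewrite -dot_sumr; apply: eq_bigr => n _; rewrite combE.
    by [].
  by exists (fun u => dot l (pos u)); split=> v vs; rewrite lE; [apply: l1|apply: l2].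
(* The barycenter of s is covered by some s' in T, which is also a face over A; uniqueness there
   puts s inside s'. *)
have TAT s : TA s -> T s.
  move=> TAs; have [E|s0] := eqVneq s set0.
    rewrite E; split; first exact: sub0set.
      by left; apply/setP => u; rewrite !inE; apply/existsP => -[v]; rewrite inE.
    (* The empty face needs a functional below all heights. *)
    exists (fun=> - (\sum_v `|w v| + 1)); split=> v; first by rewrite inE.
    move=> _; have -> : dot (fun=> - (\sum_v `|w v| + 1)) (p v) = - (\sum_v `|w v| + 1).
      by rewrite /dot -mulr_sumr; have [[_ ->] _] := pX v; rewrite mulr1.
    rewrite (bigD1 v) //=; have := ler_norm (- w v); rewrite normrN.
    have : 0 <= \sum_(i | i != v) `|w i| by apply: sumr_ge0.
    lra.
  have [_ Xa _] := TAs.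
  have [t0 t1 ts] := barycenter_in s0; set bc := barycenter s in t0 t1 ts.
  have bcs : in_simplex s bc by [].
  have alr t s' : TA s' -> in_simplex s' t -> realization (combination t al).
    move=> [_ Xs' _] ts'; apply/inX_real; split.
      have [|c0 c1 _] := in_simplex_comb (s := setT) ts' (pos := al); last by split.
      by move=> v _; have [c0 c1] := alb v; split=> // u; rewrite inE.
    apply: (XKsub Xs'); have [_ _ tz] := ts'; apply/subsetP => n; rewrite !inE combE.
    apply: contraR; rewrite negb_exists => /forallP H; rewrite big1 // => v _.
    have [vs|vs] := boolP (v \in s'); last by rewrite tz ?mul0r.
    by have := H v; rewrite vs negbK => /eqP ->; rewrite mulr0.
  have pE t : combination (combination t al) pos = combination t p.
    rewrite comb_comb; apply: (comb_eq (a := setT)) => v; rewrite ?inE // => _; by have [] := Hal v.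
  have zr := alr _ _ TAs bcs.
  have zX : inX (XK (K:=K)) (combination bc p).
    by apply/inX_real; rewrite -pE; apply: subdivision_real sp zr.
  have [s' [t' [Ts' ts' E]]] := cut_cover w (@XKsub K) pX pe zX.
  have TAs' := TTA _ Ts'; have zr' := alr _ _ TAs' ts'.
  have [b bA zb] := zr; have [b' bA' zb'] := zr'.
  have E2 : combination t' al = combination bc al.
    by apply: (subdivision_inj sp bA' bA zb' zb); rewrite !pE.
  have [t0' t1' tz'] := ts'.
  have ss' : s \subset s'.
    apply/subsetP => v vs; apply: contraTT isT => vs'.
    have : bc v = 0.
      by apply: (face_uniq TAs' TAs t0' tz' t0 ts _ vs') => u; rewrite -!combE E2.
    by move/eqP; rewrite gt_eqF // barycenter_gt0.
  exact: Tsub Ts' ss'.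
have ET : T = TA by apply/predeqP => s; split; [apply: TTA|apply: TAT].
exists V, eK, eA, T; split=> //.
  apply: sweep.
  - exact: XKsub.
  - by move=> v n; have [[]] := pX v.
  - by move=> v; have [[]] := pX v.
  - by move=> n m; rewrite pe ffunE.
  - by move=> u v E; apply: pI; apply/ffunP.
  - by move=> s _; apply: pg; apply: subsetT.
rewrite ET; apply: sweep.
- exact: XKsub.
- by move=> v n; have [] := alb v.
- by move=> v; have [] := alb v.
- by move=> n m; rewrite aleA ffunE.
- by move=> u v E; apply: alI; apply/ffunP.
- exact: genA.
Qed.
End Trans.

(** * Stellar subdivisions *)

Section Star.
Variables (R : realType) (C : complex) (A : {set vert C}).
Hypothesis A0 : A != set0.
Hypothesis A1 : (1 < #|A|)%N.

(* None is the new vertex, at the barycenter of A. *)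
Definition star_carr (s : {set option (vert C)}) : {set vert C} :=
  [set v | (Some v \in s) || (None \in s) && (v \in A)].
Definition star_simplices : {set {set option (vert C)}} :=
  [set s | [&& s != set0, ~~ [forall v in A, Some v \in s] & star_carr s \in C]].

Lemma star_neq0 s : s \in star_simplices -> s != set0.
Proof. by rewrite inE => /and3P[]. Qed.

Lemma star_sub (s t : {set option (vert C)}) :
  s \in star_simplices -> t \subset s -> t != set0 -> t \in star_simplices.
Proof.
rewrite !inE => /and3P[_ As sC] /subsetP ts t0; rewrite t0 /=; apply/andP; split.
  by apply: contra As => /forall_inP At; apply/forall_inP => v /At/ts.
apply: simplices_sub sC _ _.
  by apply/subsetP => v; rewrite !inE => /orP[/ts->//|/andP[/ts -> ->]]; rewrite orbT.
case/set0Pn: t0 => -[v|] vt; apply/set0Pn; first by exists v; rewrite inE vt.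
by case/set0Pn: A0 => v vA; exists v; rewrite inE vt vA orbT.
Qed.

Hypothesis AC : A \in C.

Lemma star_1 (v : option (vert C)) : [set v] \in star_simplices.
Proof.
rewrite inE; apply/and3P; split.
- by apply/set0Pn; exists v; rewrite inE.
- apply/negP => /forall_inP H; move: A1; apply/negP; rewrite -leqNgt.
  case: v H => [v|] H; last first.
    by case/set0Pn: A0 => v /H; rewrite inE.
  rewrite -(cards1 v); apply: subset_leq_card; apply/subsetP => u /H.
  by rewrite !inE => /eqP[->].
- case: v => [v|].
    rewrite (_ : star_carr _ = [set v]) ?simplices1 //.
    by apply/setP => u; rewrite !inE /= orbF.
  by rewrite (_ : star_carr _ = A) //; apply/setP => u; rewrite !inE.
Qed.

Definition star_complex := Complex star_neq0 star_sub star_1.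

Definition star_pos (u : option (vert C)) : {ffun vert C -> R} :=
  if u is Some v then dirac R v else barycenter R A.

Lemma big_some (V : finType) (F : option V -> R) : \sum_u F u = F None + \sum_v F (Some v).
Proof.
rewrite (bigD1 None) //=; congr (_ + _).
rewrite (reindex_omap Some id) => [|[v|]] //=.
by apply: eq_bigl => v; rewrite eqxx.
Qed.

Lemma star_comb (t : option (vert C) -> R) v :
  \sum_u t u * star_pos u v = t None * (if v \in A then (#|A|%:R)^-1 else 0) + t (Some v).
Proof.
rewrite big_some ffunE; congr (_ + _).
rewrite (bigD1 v) //= ffunE eqxx mulr1 big1 ?addr0 // => u /negbTE uv.
by rewrite ffunE eq_sym uv mulr0.
Qed.

(** A stellar subdivision is regular: the old vertices have height 0, and the new one is pushed down
    to -1. *)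
Lemma star_subdivision : @subdivision R C star_complex star_pos.
Proof.
have kp : 0 < #|A|%:R :> R by rewrite ltr0n card_gt0.
have k0 : #|A|%:R != 0 :> R by rewrite gt_eqF.
have dS l v : dot l (star_pos (Some v)) = l v by rewrite dotC /dot diracE.
have dN l : dot l (star_pos None) = (\sum_(v in A) l v) / #|A|%:R.
  rewrite /dot mulr_suml [RHS]big_mkcond; apply: eq_bigr => v _.
  by rewrite ffunE; case: ifP; rewrite ?mulr0.
have miss (a : {set option (vert C)}) : a \in star_simplices -> exists2 v, v \in A & Some v \notin a.
  by rewrite inE => /and3P[_ /forall_inPn[v vA va] _]; exists v.
apply: (@face_subdivision R C star_complex star_pos (fun u => if u is Some _ then 0 else -1)).
- move=> a /miss[v0 v0A v0a] d da d0.
  have dNone : d None = 0.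
    have := d0 v0; rewrite star_comb v0A (da _ v0a) addr0 => /eqP.
    by rewrite mulf_eq0 invr_eq0 (negbTE k0) orbF => /eqP.
  by case=> // v; have := d0 v; rewrite star_comb dNone mul0r add0r.
- move=> a aD; have [v0 v0A v0a] := miss _ aD.
  split; first exact: subsetT.
    right; move: (aD); rewrite inE => /and3P[_ _].
    rewrite (_ : star_carr a = carr (fun u v => star_pos u v) a) //.
    apply/setP => n; rewrite !inE; apply/orP/exists_inP => [[Sn|/andP[Na nA]]|[[v|] va]].
    + by exists (Some n) => //; rewrite /= ffunE eqxx oner_neq0.
    + by exists None => //=; apply: lt0r_neq0; apply: barycenter_gt0.
    + by rewrite /= ffunE; have [->|] := eqVneq n v; [left|rewrite eqxx].
    + by rewrite /= ffunE va; case: ifP; [right|rewrite eqxx].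
  pose c := #|[set n in A | Some n \notin a]|.
  have cp : 0 < c%:R :> R by rewrite ltr0n card_gt0; apply/set0Pn; exists v0; rewrite inE v0A.
  (* If the new vertex belongs to a, the c vertices of A missing from a share the value -|A|, so
     that the mean over A is -1. If not, a single missing vertex already brings the mean below
     -1. *)
  exists (fun n => if Some n \in a then 0 else
    if None \in a then (if n \in A then - (#|A|%:R / c%:R) else -1) else - (#|A|%:R + 1)).
  split=> -[v|].
  + by move=> va; rewrite dS va.
  + move=> Na; rewrite dN Na.
    rewrite (eq_bigr (fun n => if Some n \notin a then - (#|A|%:R / c%:R) else 0)); last first.
      by move=> n nA; rewrite nA; case: (_ \in a).
    rewrite -big_mkcondr /= sumr_const.
    rewrite [X in _ *+ X](_ : _ = c); last by rewrite /c cardsE; apply: eq_card.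
    by rewrite -[_ *+ c]mulr_natr mulNr divfK ?gt_eqF // mulNr divff.
  + rewrite in_setD in_setT andbT => /negbTE va; rewrite dS va.
    case: ifP => _; last by rewrite oppr_lt0 ltr_wpDl ?ler0n.
    by case: ifP => _; rewrite oppr_lt0 // divr_gt0.
  + rewrite in_setD in_setT andbT => /negbTE Na; rewrite dN Na ltr_pdivrMr // mulN1r.
    rewrite (bigD1 v0) //= (negbTE v0a); apply: (@le_lt_trans _ _ (- (#|A|%:R + 1))).
      rewrite gerDl sumr_le0 // => n _; case: ifP => // _.
      by rewrite oppr_le0 addr_ge0.
    by rewrite ltrN2 ltrDl.
- case=> [v|]; first by apply: bary_real; apply: real_dirac.
  by apply: bary_real; exists A => //; apply: barycenter_in.
- move=> x [s sC [x0 x1 xs]].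
  case/set0Pn: A0 => v0 v0A.
  case: (@arg_minP _ _ _ v0 [pred v in A] x v0A) => u0 u0A; set m := x u0 => u0m.
  have m0 : 0 <= m by apply: x0.
  (* The smallest coordinate m of x on A is taken off all vertices of A and given to the barycenter,
     which frees a vertex of A. *)
  pose t := [ffun u => if u is Some v then x v - (if v \in A then m else 0) else #|A|%:R * m].
  have ts : in_simplex [set u | t u != 0] t.
    split.
    + case=> [v|]; rewrite ffunE; last by rewrite mulr_ge0.
      by rewrite subr_ge0; case: ifP => // vA; apply: u0m.
    + rewrite big_some ffunE; under eq_bigr do rewrite ffunE.
      rewrite sumrB x1 -big_mkcond /= sumr_const -[m *+ _]mulr_natl.
      by rewrite addrC subrK.
    + by move=> u; rewrite inE negbK => /eqP.
  exists [set u | t u != 0].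
    change ([set u | t u != 0] \in star_simplices).
    rewrite inE (in_simplex_neq0 ts) /=; apply/andP; split.
      by apply/forall_inPn; exists u0; rewrite // inE ffunE (u0A : u0 \in A) subrr eqxx.
    apply: simplices_sub sC _ _; last first.
      have /set0Pn[u] := in_simplex_neq0 ts; rewrite inE => ut; apply/set0Pn.
      case: u ut => [v|] ut; first by exists v; rewrite !inE ut.
      by exists v0; rewrite !inE ut v0A orbT.
    apply/subsetP => v; rewrite !inE !ffunE; apply: contraTT => vs.
    rewrite (xs _ vs) sub0r; case: ifP => vA; last by rewrite oppr0 eqxx andbF.
    have m00 : m = 0 by apply/eqP; rewrite eq_le m0 andbT -(xs _ vs); apply: u0m.
    by rewrite m00 mulr0 oppr0 eqxx.
  exists t => //; apply/ffunP => v; rewrite combE star_comb !ffunE.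
  case: ifP => _; last by rewrite mulr0 add0r subr0.
  by rewrite mulrAC mulfV // mul1r addrC subrK.
Qed.
End Star.

Local Close Scope ring_scope.

(** * Bistellar moves as flips *)

Lemma facets_partE n (S s : {set 'I_n.+2}) :
  (s \in facets_part S) = (s != set0) && ~~ (S \subset s).
Proof.
rewrite inE; congr (_ && _); apply/exists_inP/subsetPn => [[i iS si]|[i iS si]]; exists i => //.
  by apply/negP => /(subsetP si); rewrite !inE eqxx.
by apply/subsetP => j js; rewrite !inE; apply: contraNneq si => <-.
Qed.

(** The boundary is dS * d(~: S). An (n-1)-simplex is the complement of a pair {i, j}; its two
    facets are opposite to i and j, and exactly one belongs to the part if and only if exactly one
    of i, j lies in S. *)
Lemma boundary_facets n (S s : {set 'I_n.+2}) :
  (s \in boundary n (facets_part S)) = [&& s != set0, ~~ (S \subset s) & ~~ (~: S \subset s)].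
Proof.
rewrite inE; have [->|s0] /= := eqVneq s set0; first by [].
have cN (t : {set 'I_n.+2}) : (#|t| + #|~: t| = n.+2)%N by rewrite cardsC card_ord.
apply/exists_inP/andP => [[t]|[]].
  rewrite facets_partE => /andP[t0 St] /and3P[st /eqP ct /cards1P[u0 Eu]].
  split; first by apply: contra St => /subset_trans; apply.
  apply/negP => SCs; have SCt := subset_trans SCs st.
  have /cards2P[i [j [ij Et]]] : #|~: t| == 2 by have := cN t; rewrite ct; lia.
  have H k : k \in ~: t -> ~: [set k] = u0.
    move=> kt; apply/set1P; rewrite -Eu inE facets_partE; apply/and3P; split.
    - apply/andP; split.
        have [v vt] := set0Pn _ t0; apply/set0Pn; exists v; rewrite !inE.
        by apply: contraTneq vt => ->; rewrite inE in kt.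
      apply/subsetPn; exists k; last by rewrite !inE eqxx.
      by apply: contraTT kt => kS; rewrite inE negbK; apply: (subsetP SCt); rewrite inE.
    - by apply/subsetP => v vt; rewrite !inE; apply: contraTneq vt => ->; rewrite inE in kt.
    - by have /eqP := cN [set k]; rewrite cards1 add1n eqSS.
  have /setC_inj/set1_inj E : ~: [set i] = ~: [set j] by rewrite !H // Et !inE eqxx ?orbT.
  by rewrite E eqxx in ij.
move=> /subsetPn[i iS is_] /subsetPn[j]; rewrite inE => jS js.
have ij : i != j by apply: contraNneq jS => <-.
have st : s \subset ~: [set i; j].
  by apply/subsetP => v vs; rewrite !inE; apply/norP; split; apply: contraTneq vs => ->.
exists (~: [set i; j]).
  rewrite facets_partE; apply/andP; split.
    by have /set0Pn[v vs] := s0; apply/set0Pn; exists v; apply: (subsetP st).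
  by apply/subsetPn; exists i => //; rewrite !inE eqxx.
apply/and3P; split=> //.
  by have /eqP := cN [set i; j]; rewrite cards2 ij addSn add1n !eqSS.
rewrite (_ : [set u in _ | _] = [set ~: [set i]]) ?cards1 //.
apply/setP => u; rewrite inE facets_partE inE; apply/idP/eqP => [|->].
  case/and3P => /andP[u0 Su] tu cu.
  have /cards1P[k Ek] : #|~: u| == 1 by rewrite -(eqn_add2l #|u|) cN (eqP cu) addn1.
  have Eu : u = ~: [set k] by rewrite -Ek setCK.
  have kS : k \in S.
    have /subsetPn[l lS lu] := Su; move: lu; rewrite Eu !inE negbK => /eqP <-//.
  have : k \in [set i; j].
    apply: contraTT tu => kij; apply/subsetPn; exists k; first by rewrite inE.
    by rewrite Eu !inE eqxx.
  by rewrite Eu !inE => /orP[]/eqP E; [rewrite E|rewrite -E kS in jS].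
apply/and3P; split.
- apply/andP; split; first by apply/set0Pn; exists j; rewrite !inE eq_sym.
  by apply/subsetPn; exists i => //; rewrite !inE eqxx.
- by rewrite setCS sub1set !inE eqxx.
- by have /eqP := cN [set i]; rewrite cards1 add1n eqSS.
Qed.

Definition imS (C : complex) (U : finType) (f : vert C -> U) (s : {set U}) : Prop :=
  exists2 a, XK a & s = f @: a.

Lemma imS_simplices (C : complex) (U : finType) (f : vert C -> U) (s : {set U}) :
  imS f s <-> s = set0 \/ s \in im_simplices f C.
Proof.
split=> [[a [->|aC] ->]|[->|/imsetP[a aC ->]]].
- by left; rewrite imset0.
- by right; apply: imset_f.
- by exists set0; [left|rewrite imset0].
- by exists a => //; right.
Qed.

Lemma imS_sub (C : complex) (U : finType) (f : vert C -> U) (s t : {set U}) :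
  imS f s -> t \subset s -> imS f t.
Proof.
move=> [a Xa ->] ts; exists (a :&: f @^-1: t); first by apply: XKsub Xa _; apply: subsetIl.
apply/setP => x; apply/idP/imsetP => [xt|[v]]; last by rewrite !inE => /andP[_ ?] ->.
by have /imsetP[v va E] := subsetP ts _ xt; exists v; rewrite // !inE va -E.
Qed.

Section Place.
Variables (n : nat) (U : finType) (h : 'I_n.+2 -> U) (S : {set 'I_n.+2}).
Hypothesis hI : injective h.

Lemma im_sub_set (s t : {set 'I_n.+2}) : (h @: s \subset h @: t) = (s \subset t).
Proof.
apply/subsetP/subsetP => H x; first by move=> xs; have := H (h x); rewrite !mem_imset // => ->.
by case/imsetP => y /H yt ->; rewrite mem_imset.
Qed.

Lemma im_facets (T : {set {set 'I_n.+2}}) (s : {set 'I_n.+2}) :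
  (h @: s \in im_simplices h T) = (s \in T).
Proof. by apply: mem_imset; apply: imset_inj. Qed.

Lemma sub_im (s : {set U}) : s \subset h @: [set: 'I_n.+2] -> exists s0 : {set 'I_n.+2}, s = h @: s0.
Proof.
move=> ss; exists (h @^-1: s); apply/setP => x; apply/idP/imsetP => [xs|[i]].
  by have /imsetP[i _ E] := subsetP ss _ xs; exists i; rewrite // inE -E.
by rewrite inE => ? ->.
Qed.
End Place.

Lemma move_flipS n p q C D : bistellar_move n p q C D ->
  exists (U : finType) (f : vert C -> U) (f' : vert D -> U) (A B : {set U}),
  [/\ injective f, injective f', flip_okS A B (imS f) & forall s, flipS A B (imS f) s <-> imS f' s].
Proof.
move=> [[p0 q0 pq] [S [U [L [h [f [f' [[cS [L0 Ls] hI fI fI'] [LP LQ EK EK']]]]]]]]].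
(* The part of the sphere given by S is the join of ~: S with dS, so the removed P is A * dB for
   these sets. *)
set A := h @: ~: S; set B := h @: S.
have S0 : S != set0 by rewrite -card_gt0 cS.
have SC0 : ~: S != set0.
  by rewrite -card_gt0 -(ltn_add2l #|S|) cardsC card_ord cS addn0; lia.
have nSC : ~~ (S \subset ~: S).
  have /set0Pn[i iS] := S0; by apply/subsetPn; exists i; rewrite ?inE ?iS.
have nCS : ~~ (~: S \subset S).
  have /set0Pn[i iS] := SC0; apply/subsetPn; exists i => //; by rewrite inE in iS.
have A0 : A != set0 by rewrite imset_eq0.
have B0 : B != set0 by rewrite imset_eq0.
have iK s : imS f s <-> s = set0 \/ (s \in L \/ s \in im_simplices h (facets_part S)).
  by rewrite imS_simplices EK inE; split=> -[]; [left|case/orP; auto|left|case=> ->; rewrite ?orbT; auto].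
have iK' s : imS f' s <-> s = set0 \/ (s \in L \/ s \in im_simplices h (facets_part (~: S))).
  by rewrite imS_simplices EK' inE; split=> -[]; [left|case/orP; auto|left|case=> ->; rewrite ?orbT; auto].
have LA s : s \in L -> ~~ (A \subset s).
  move=> sL; apply/negP => As; have AL := Ls _ _ sL As A0.
  have : A \in L :&: im_simplices h (facets_part S).
    by rewrite inE AL im_facets // facets_partE SC0.
  by rewrite LP im_facets // boundary_facets subxx !andbF.
have LB : B \notin L.
  apply/negP => BL; have : B \in L :&: im_simplices h (facets_part (~: S)).
    by rewrite inE BL im_facets // facets_partE S0.
  by rewrite LQ im_facets // boundary_facets setCK subxx !andbF.
have AT : imS f A by apply/iK; right; right; rewrite im_facets // facets_partE SC0.
have up s : imS f s -> A \subset s -> exists2 s0 : {set 'I_n.+2}, s = h @: s0 & ~: S \subset s0.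
  move=> /iK[->|[sL|/imsetP[s0 _ ->]]].
  - by rewrite subset0 (negbTE A0).
  - by rewrite (negbTE (LA _ sL)).
  - by rewrite im_sub_set //; exists s0.
have hD (s t : {set 'I_n.+2}) : h @: s :\: h @: t = h @: (s :\: t).
  apply/setP => x; rewrite inE; apply/andP/imsetP => [[xt /imsetP[i is_ E]]|[i]].
    by exists i => //; rewrite inE is_ andbT -(mem_imset _ _ hI) -E.
  by rewrite inE => /andP[it is_] ->; rewrite !mem_imset.
exists U, f, f', A, B; split=> //.
  split=> //.
  - rewrite -setI_eq0; apply/eqP/setP => x; rewrite !inE; apply/andP => -[/imsetP[i + ->]].
    by rewrite mem_imset // inE => /negbTE ->.
  - move/iK => [E|[BL|]]; first by rewrite E eqxx in B0.
      by rewrite BL in LB.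
    by rewrite im_facets // facets_partE subxx andbF.
  - move=> s b Ts As /imsetP[i iS ->]; have [s0 -> Cs] := up _ Ts As.
    rewrite /B -imset_set1 -imsetU hD; apply/iK.
    have [->|e0] := eqVneq ((s0 :|: S) :\ i) set0; first by left; rewrite imset0.
    right; right; rewrite im_facets // facets_partE e0.
    by apply/subsetPn; exists i; rewrite // !inE eqxx.
move=> s; split.
  case=> [[/iK[->|[sL|/imsetP[s0 sP E]]] nA]|[Bs nA Ts]]; apply/iK'.
  - by left.
  - by right; left.
  - move: sP; rewrite facets_partE => /andP[s00 _]; right; right.
    by rewrite E im_facets // facets_partE s00 -(im_sub_set hI) -E.
  - have [t E _] := up _ Ts (subsetUr _ _).
    have [s0 Es] : exists s0 : {set 'I_n.+2}, s = h @: s0.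
      apply: sub_im; apply/subsetP => x xs; have [xB|xB] := boolP (x \in B).
        by apply: (subsetP _ _ xB); apply: imsetS; apply: subsetT.
      have : x \in (s :\: B) :|: A by rewrite !inE xB xs.
      by rewrite E => /imsetP[i _ ->]; rewrite mem_imset.
    right; right; rewrite Es im_facets // facets_partE -(im_sub_set hI) -Es -/A nA andbT.
    apply: contra_neq B0 => E0; apply/eqP; rewrite -subset0.
    by rewrite Es E0 imset0 in Bs.
move/iK' => [->|[sL|/imsetP[s0]]].
- by left; rewrite subset0 A0; split=> //; apply/iK; left.
- by left; split; [apply/iK; right; left|apply: LA].
- rewrite facets_partE => /andP[s00 nC] ->.
  have nA : ~~ (A \subset h @: s0) by rewrite im_sub_set.
  have [Ss|nS] := boolP (S \subset s0); [right|left]; split=> //.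
  + by rewrite im_sub_set.
  + rewrite hD -imsetU (_ : _ :|: _ = ~: S) //.
    apply/setP => i; rewrite !inE; by case: (i \in S); rewrite ?orbT.
  + by apply/iK; right; right; rewrite im_facets // facets_partE s00.
Qed.

Lemma place_sets (U : finType) (A B : {set U}) n : [disjoint A & B] -> (#|B| + #|A| = n.+2)%N ->
  exists (h : 'I_n.+2 -> U) (S : {set 'I_n.+2}), [/\ injective h, h @: S = B & h @: (~: S) = A].
Proof.
move=> dAB c; have cU : #|A :|: B| = n.+2 by rewrite cardsU disjoint_setI0 // cards0 subn0 addnC.
pose h (i : 'I_n.+2) : U := enum_val (cast_ord (esym cU) i).
have hI : injective h by move=> i j /enum_val_inj/cast_ord_inj.
have hU x : x \in A :|: B -> exists i, x = h i.
  move=> xU; exists (cast_ord cU (enum_rank_in xU x)).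
  by rewrite /h cast_ordK enum_rankK_in.
exists h, (h @^-1: B); split=> //; apply/setP => x; apply/imsetP/idP.
- by case=> i; rewrite inE => ? ->.
- by move=> xB; have [|i E] := hU x; [rewrite inE xB orbT|exists i; rewrite // inE -E].
- case=> i; rewrite !inE => iB ->; have := enum_valP (cast_ord (esym cU) i).
  by rewrite inE -/(h i) (negbTE iB) orbF.
- move=> xA; have [|i E] := hU x; [by rewrite inE xA|exists i; rewrite // !inE -E].
  by have /pred0P/(_ x) /= := dAB; rewrite xA /= => /negbT.
Qed.

(** The removed part is A * dB, whose facets correspond to the vertices of B; hence p is |B|. *)
Lemma flipS_move n C D (U : finType) (f : vert C -> U) (f' : vert D -> U) (A B : {set U}) :
  injective f -> injective f' -> flip_okS A B (imS f) -> (#|B| + #|A| = n.+2)%N ->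
  (forall s : {set U}, imS f s -> A \subset s -> s \subset A :|: B) ->
  (forall s, flipS A B (imS f) s <-> imS f' s) -> bistellar_move n #|B| #|A| C D.
Proof.
move=> fI fI' ok c near E.
have [A0 B0 dAB TA TB kl] := ok; split.
  by rewrite !card_gt0 A0 B0 c addn2.
have [h [S [hI EB EA]]] := place_sets dAB c.
(* The part kept by the move: everything outside the open star of A. *)
pose L := [set s : {set U} | [&& s != set0, `[< imS f s >] & ~~ (A \subset s)]].
have inL s : reflect [/\ s != set0, imS f s & ~~ (A \subset s)] (s \in L).
  by rewrite inE; apply: (iffP and3P) => -[h1 /asboolP h2 h3]; split=> //; apply/asboolP.
have subh (s : {set 'I_n.+2}) : (A \subset h @: s) = (~: S \subset s) by rewrite -EA im_sub_set.
have Bsubh (s : {set 'I_n.+2}) : (B \subset h @: s) = (S \subset s) by rewrite -EB im_sub_set.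
have hs0 (s : {set 'I_n.+2}) : (h @: s != set0) = (s != set0) by rewrite imset_eq0.
have TP (s : {set 'I_n.+2}) : imS f (h @: s) <-> ~~ (S \subset s).
  split=> [Ts|/subsetPn[i iS is_]].
    by apply/negP; rewrite -Bsubh => Bs; apply: TB; apply: imS_sub Ts Bs.
  have hiB : h i \in B by rewrite -EB mem_imset.
  apply: imS_sub (kl _ _ TA (subxx _) hiB) _.
  apply/subsetP => x /imsetP[j js ->]; rewrite !inE (inj_eq hI) -EA -EB !mem_imset // inE.
  by rewrite orNb andbT; apply: contraNneq is_ => <-.
have inh (s : {set U}) : s \subset A :|: B -> exists s0 : {set 'I_n.+2}, s = h @: s0.
  move=> sAB; apply: sub_im; apply: subset_trans sAB _; rewrite -EA -EB -imsetU.
  by rewrite imsetS ?subsetT.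
exists S, U, L, h, f, f'; split.
  split=> //; first by rewrite -EB card_imset.
  split=> [s /inL[]//|s t /inL[_ Ts nA] ts t0]; apply/inL; split=> //.
    exact: imS_sub Ts ts.
  by apply: contra nA => /subset_trans; apply.
split; apply/setP => s.
- rewrite inE; apply/andP/imsetP => [[/inL[s0 Ts nA] /imsetP[t tP Es]]|[t]].
    exists t => //; rewrite boundary_facets -hs0 -Es s0 -subh -Es nA andbT.
    by move: tP; rewrite facets_partE => /andP[].
  rewrite boundary_facets => /and3P[t0 nS nC] ->; rewrite im_facets // facets_partE t0 nS.
  by split=> //; apply/inL; rewrite hs0 subh; split=> //; apply/TP.
- rewrite inE; apply/andP/imsetP => [[/inL[s0 Ts nA] /imsetP[t tP Es]]|[t]].
    exists t => //; rewrite boundary_facets setCK -hs0 -Es s0 -subh -Es nA /=.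
    by apply/TP; rewrite -Es.
  rewrite boundary_facets setCK => /and3P[t0 nC nS] ->; rewrite im_facets // facets_partE t0 nC.
  by split=> //; apply/inL; rewrite hs0 subh; split=> //; apply/TP.
- rewrite inE; apply/idP/orP => [sC|[/inL[s0 Ts _]|/imsetP[t]]].
  + have Ts : imS f s by apply/imS_simplices; right.
    have s0 : s != set0 by have /imsetP[a aC ->] := sC; rewrite imset_eq0 (simplices_neq0 aC).
    have [As|nA] := boolP (A \subset s); last by left; apply/inL.
    right; have [t Es] := inh _ (near _ Ts As).
    by rewrite Es im_facets // facets_partE -hs0 -Es s0; apply/TP; rewrite -Es.
  + by case/imS_simplices: Ts => // E0; rewrite E0 eqxx in s0.
  + rewrite facets_partE => /andP[t0 /TP/imS_simplices[E0|E0]] Es; last by rewrite Es.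
    by rewrite -hs0 E0 eqxx in t0.
- have inK' s1 : s1 != set0 -> imS f' s1 -> s1 \in im_simplices f' D.
    by move=> n0 /imS_simplices[E0|//]; rewrite E0 eqxx in n0.
  rewrite inE; apply/idP/orP => [sC|[/inL[s0 Ts nA]|/imsetP[t]]].
  + have s0 : s != set0 by have /imsetP[a aC ->] := sC; rewrite imset_eq0 (simplices_neq0 aC).
    have /E[[Ts nA]|[Bs nA Ts]] : imS f' s by apply/imS_simplices; right.
      by left; apply/inL.
    right; have [t Es] : exists t : {set 'I_n.+2}, s = h @: t.
      apply: inh; apply/subsetP => x xs; have [xB|xB] := boolP (x \in B); first by rewrite inE xB orbT.
      by apply: (subsetP (near _ Ts (subsetUr _ _))); rewrite !inE xB xs.
    by rewrite Es im_facets // facets_partE -hs0 -Es s0 -subh -Es.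
  + by apply: inK' => //; apply/E; left.
  + rewrite facets_partE => /andP[t0 nC] Es; apply: inK'; first by rewrite Es hs0.
    apply/E; have nA : ~~ (A \subset s) by rewrite Es subh.
    have [Ss|nS] := boolP (S \subset t); [right|left]; split=> //.
    * by rewrite Es Bsubh.
    * apply: imS_sub TA _; rewrite Es; apply/subsetP => x.
      rewrite !inE => /orP[/andP[xB /imsetP[i it Ex]]|//].
      by move: xB; rewrite Ex -EB -EA !mem_imset // inE.
    * by rewrite Es; apply/TP.
Qed.

Local Open Scope fset_scope.

(** * Complexes and complexes on nat *)

Section Img.
Variables (V : finType) (g : V -> nat).
Hypothesis gI : injective g.

Definition img (t : {set V}) : fs := [fset g v | v in t].

Lemma imgP (t : {set V}) x : reflect (exists2 v, v \in t & x = g v) (x \in img t).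
Proof. by apply: imfsetP. Qed.

Lemma mem_img (t : {set V}) v : (g v \in img t) = (v \in t).
Proof. by apply/imgP/idP => [[u ut /gI->]|vt] //; exists v. Qed.

Lemma img_sub (s t : {set V}) : (img s `<=` img t) = (s \subset t).
Proof.
apply/fsubsetP/subsetP => H v; first by rewrite -!mem_img; apply: H.
by case/imgP => u /H ut ->; rewrite mem_img.
Qed.

Lemma img_inj : injective img.
Proof. by move=> s t /fsetP E; apply/setP => v; rewrite -!mem_img E. Qed.

Lemma imgU (s t : {set V}) : img (s :|: t) = img s `|` img t.
Proof.
apply/fsetP => x; rewrite in_fsetU; apply/imgP/orP.
  by case=> v; rewrite inE => /orP[h|h] ->; rewrite !mem_img h; [left|right].
by case=> /imgP[v h ->]; exists v; rewrite // inE h ?orbT.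
Qed.

Lemma imgD (s t : {set V}) : img (s :\: t) = img s `\` img t.
Proof.
apply/fsetP => x; rewrite in_fsetD; apply/imgP/andP.
  by case=> v; rewrite inE => /andP[h1 h2] ->; rewrite !mem_img h1.
case=> h1 /imgP[v h E]; move: h1; rewrite E mem_img => h1.
by exists v; rewrite // inE h1.
Qed.

Lemma img1 v : img [set v] = [fset g v].
Proof.
apply/fsetP => x; rewrite inE; apply/imgP/eqP => [[u]|->]; first by rewrite inE => /eqP->.
by exists v; rewrite ?inE.
Qed.

Lemma img0 : img set0 = fset0.
Proof. by apply/fsetP => x; rewrite inE; apply/imgP => -[v]; rewrite inE. Qed.

Lemma img_eq0 t : (img t == fset0) = (t == set0).
Proof. by rewrite -img0 (inj_eq img_inj). Qed.

Lemma img_dis (s t : {set V}) : [disjoint img s & img t] = [disjoint s & t]%B.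
Proof.
apply/fdisjointP/pred0P => [H v|H x].
  apply/negP => /andP[/= vs vt]; have := H (g v); rewrite !mem_img => /(_ vs).
  by apply/negP; rewrite negbK.
case/imgP => v vs ->; rewrite mem_img; apply/negP => vt.
by have := H v; rewrite /= vs vt.
Qed.

Lemma card_img (t : {set V}) : #|` img t| = #|t|.
Proof.
rewrite card_imfset //= cardE; congr size.
Qed.

Lemma img_preim s (t : {set V}) : s `<=` img t -> exists2 u : {set V}, u \subset t & s = img u.
Proof.
move=> H; exists [set v in t | g v \in s]; first by apply/subsetP => v; rewrite inE => /andP[].
apply/fsetP => x; apply/idP/imgP => [xs|[v]]; last by rewrite inE => /andP[_ ?] ->.
have /imgP[v vt E] := fsubsetP H _ xs; exists v => //; by rewrite inE vt -E.
Qed.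

Definition imc (T : {set V} -> Prop) : cpx := fun s => exists2 t, T t & s = img t.

Lemma imc_in T t : imc T (img t) <-> T t.
Proof. by split=> [[u Tu /img_inj->]|Tt] //; exists t. Qed.

Lemma imc_flip A B T : imc (flipS A B T) = flip (img A) (img B) (imc T).
Proof.
apply: cpx_ext => s; split.
  case=> t H ->; case: H => [[Tt nA]|[Bt nA Tt]].
    by left; rewrite img_sub; split=> //; exists t.
  by right; rewrite !img_sub -imgD -imgU; split=> //; exists ((t :\: B) :|: A).
case=> [[[t Tt ->]]|[Bs nA [t Tt E]]].
  by rewrite img_sub => nA; exists t => //; left.
have [u ut Eu] : exists2 u : {set V}, u \subset t :|: B & s = img u.
  apply: img_preim; rewrite imgU -E; fsd.
exists u => //; right; split.
- by rewrite -img_sub -Eu.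
- by rewrite -img_sub -Eu.
- have -> // : (u :\: B) :|: A = t.
  by apply: img_inj; rewrite imgU imgD -Eu.
Qed.

Lemma imc_flip_ok A B T : flip_okS A B T -> flip_ok (img A) (img B) (imc T).
Proof.
case=> A0 B0 d TA TB kl; split; rewrite ?img_eq0 ?img_dis //.
- by exists A.
- by move/imc_in.
- move=> s b [t Tt ->]; rewrite img_sub => At /imgP[c cB ->].
  exists ((t :|: B) :\ c); first exact: kl.
  by rewrite imgD imgU img1.
Qed.
End Img.

Lemma imc_flip_okV (V : finType) (g : V -> nat) A B T : injective g ->
  flip_ok (img g A) (img g B) (imc g T) -> flip_okS A B T.
Proof.
move=> gI [A0 B0 d TA TB kl]; split.
- by rewrite -(img_eq0 gI).
- by rewrite -(img_eq0 gI).
- by rewrite -(img_dis gI).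
- by apply/(imc_in gI).
- by move=> h; apply: TB; apply/imc_in.
- move=> s b Ts As bB; apply/(imc_in gI); rewrite imgD // imgU // img1; apply: kl.
  + exact/imc_in.
  + by rewrite img_sub.
  + by rewrite mem_img.
Qed.

Lemma img_comp (U V : finType) (f : U -> V) (g : V -> nat) (t : {set U}) : img (g \o f) t = img g (f @: t).
Proof.
apply/fsetP => x; apply/imgP/imgP => [[v vt ->]|[u /imsetP[v vt ->] ->]].
  by exists (f v); rewrite ?imset_f.
by exists v.
Qed.

Lemma imc_imS (C : complex) (U : finType) (f : vert C -> U) (g : U -> nat) :
  imc g (imS f) = imc (g \o f) (XK (K:=C)).
Proof.
apply: cpx_ext => s; split=> [[t [a Xa ->] ->]|[t Xt ->]]; first by exists a; rewrite // (img_comp f g a).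
by exists (f @: t); [exists t|rewrite (img_comp f g t)].
Qed.

Inductive feq : cpx -> cpx -> Prop :=
| feq_refl K : feq K K
| feq_step A B K L : flip_ok A B K -> (3 <= #|` A| + #|` B|)%N -> feq (flip A B K) L -> feq K L.

Lemma imc_feq (V : finType) (g : V -> nat) T T' : injective g -> feqS T T' -> feq (imc g T) (imc g T').
Proof.
move=> gI; elim=> {T T'} [T|A B T T' ok c _ IH]; first exact: feq_refl.
apply: (@feq_step (img g A) (img g B)); first exact: imc_flip_ok.
  by rewrite !card_img.
by rewrite -imc_flip.
Qed.

Lemma feq_Sph K L j : feq K L -> Sph j K -> Sph j L.
Proof. by elim=> {K L} // A B K L ok c _ IH SK; apply: IH; apply: Sph_flip. Qed.

Lemma feq_SphV K L j : feq K L -> iscpx K -> Sph j L -> Sph j K.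
Proof.
elim=> {K L} // A B K L ok c _ IH cK SL; have cK' := iscpx_flip cK ok.
rewrite -(flipK cK ok); apply: Sph_flip; first exact: IH.
exact: flip_okC.
Qed.

Lemma feq_bst K L : feq K L -> sing4 K -> sing4 L /\ bst K L.
Proof.
elim=> {K L} [K cm|A B K L ok c _ IH cm]; first by split=> //; apply: bst_refl.
have [cL b] := IH (sing4_flip cm ok c); split=> //.
exact: bst_trans (bst_flip cm ok c) b.
Qed.

Lemma feq_sing4 K L : feq K L -> iscpx K -> sing4 L -> sing4 K.
Proof.
elim=> {K L} // A B K L ok c _ IH cK cL; have cK' := iscpx_flip cK ok.
rewrite -(flipK cK ok); apply: sing4_flip; [exact: IH|exact: flip_okC|by rewrite addnC].
Qed.

(** A placement of C on natural numbers, the empty simplex included. It passes between isomorphism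
    of complexes and equality of complexes on [nat], where fresh vertices are at hand. *)
Definition pres_by (C : complex) (X : cpx) (g : vert C -> nat) :=
  injective g /\ X = imc g (XK (K:=C)).
Definition pres C X := exists g, pres_by (C:=C) X g.

Lemma pres_cpx C X : pres C X -> iscpx X.
Proof.
move=> [g [gI ->]]; split.
- by exists set0; [left|rewrite img0].
- by move=> s t [u Xu ->] /img_preim[u' uu ->]; exists u' => //; apply: XKsub Xu uu.
- exists (\max_v g v).+1 => s x [t _ ->] /imgP[v _ ->]; rewrite ltnS; exact: leq_bigmax.
Qed.

Lemma pres_exists X : iscpx X -> exists C, pres C X.
Proof.
move=> cX; have [n Hn] := cpx_fin cX.
pose W := {i : 'I_n | `[< X [fset val i] >]}.
pose g (u : W) : nat := val (val u).
have gI : injective g by move=> u v /val_inj/val_inj.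
pose S := [set s : {set W} | (s != set0) && `[< X (img g s) >]].
have S0 (s : {set W}) : s \in S -> s != set0 by rewrite inE => /andP[].
have Ss (s t : {set W}) : s \in S -> t \subset s -> t != set0 -> t \in S.
  rewrite !inE => /andP[_ /asboolP Xs] ts ->; apply/asboolP; apply: (cpx_sub cX Xs).
  by rewrite img_sub.
have S1 u : [set u] \in S.
  rewrite inE; apply/andP; split; first by apply/set0Pn; exists u; rewrite inE.
  by apply/asboolP; rewrite img1; apply/asboolP; apply: (valP u).
exists (Complex S0 Ss S1), g; split=> //; apply: cpx_ext => s; split=> [Xs|[t Xt ->]].
  have sx x : x \in s -> exists2 u : W, true & x = g u.
    move=> xs; have xn := Hn _ _ Xs xs.
    have Xx : `[< X [fset val (Ordinal xn)] >] by apply/asboolP; apply: cpx_vert xs.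
    by exists (exist _ (Ordinal xn) Xx).
  have Es : s = img g [set u | g u \in s].
    apply/fsetP => x; apply/idP/imgP => [xs|[u]]; last by rewrite inE => ? ->.
    by have [u _ E] := sx _ xs; exists u => //; rewrite inE -E.
  exists [set u | g u \in s] => //.
  have [->|s0] := eqVneq [set u | g u \in s] set0; first by left.
  by right; rewrite inE s0 -Es; apply/asboolP.
case: Xt => [->|]; first by rewrite img0; apply: cpx0 cX.
by rewrite inE => /andP[_ /asboolP].
Qed.

Lemma pres_map C X X' : pres C X -> pres C X' -> exists2 f, injective f & X' = mapc f X.
Proof.
move=> [g [gI EX]] [g' [gI' EX']].
pose N := (\max_v g' v).+1.
have g'N v : (g' v < N)%N by rewrite ltnS; apply: leq_bigmax.
(* The renaming has to be injective on all of [nat]: numbers that are not labels go beyond all new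
   labels. *)
pose f x := if [pick v | g v == x] is Some v then g' v else (x + N)%N.
have fg v : f (g v) = g' v.
  rewrite /f; case: pickP => [u /eqP/gI ->//|/(_ v)]; by rewrite eqxx.
exists f.
  move=> x y; rewrite /f; case: pickP => [u /eqP <-|_]; case: pickP => [v /eqP <-|_].
  - by move/gI' ->.
  - by have := g'N u; lia.
  - by have := g'N v; lia.
  - by lia.
have fimg t : f @` (img g t) = img g' t.
  apply/fsetP => x; apply/imfsetP/imgP => [[y /imgP[v vt ->] ->]|[v vt ->]].
    by exists v.
  by exists (g v); rewrite ?mem_img.
rewrite EX EX'; apply: cpx_ext => s; split=> [[t Xt ->]|[u [t Xt ->] ->]].
  by exists (img g t) => //; exists t.
by exists t.
Qed.

Lemma pres_isom C D X : pres C X -> pres D X -> isomorphic C D.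
Proof.
move=> [g [gI EX]] [g' [gI' EX']].
have E : imc g (XK (K:=C)) = imc g' (XK (K:=D)) by rewrite -EX -EX'.
have tr (C1 D1 : complex) (g1 : vert C1 -> nat) (g2 : vert D1 -> nat) : injective g1 -> injective g2 ->
    imc g1 (XK (K:=C1)) = imc g2 (XK (K:=D1)) -> forall v, exists u, g1 v = g2 u.
  move=> i1 i2 E1 v; have : imc g1 (XK (K:=C1)) (img g1 [set v]) by exists [set v] => //; apply: XK1.
  rewrite E1 => -[t _ Et]; have : g1 v \in img g1 [set v] by rewrite mem_img // inE.
  by rewrite Et => /imgP[u _ ->]; exists u.
have /choice[f Hf] := tr _ _ _ _ gI gI' E.
have /choice[h Hh] := tr _ _ _ _ gI' gI (esym E).
have fB : bijective f.
  by exists h => v; [apply: gI; rewrite -Hh -Hf|apply: gI'; rewrite -Hf -Hh].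
have fimg t : img g t = img g' (f @: t).
  apply/fsetP => x; apply/imgP/imgP => [[v vt ->]|[u /imsetP[v vt ->] ->]].
    by exists (f v); rewrite ?imset_f.
  by exists v.
exists f; split=> //; apply/setP => s; apply/imsetP/idP => [[t tC ->]|sD].
  have : imc g (XK (K:=C)) (img g t) by exists t => //; right.
  rewrite E fimg => /(imc_in gI')[E0|//]; have := simplices_neq0 tC.
  by rewrite -(imset_eq0 f) E0 eqxx.
have : imc g' (XK (K:=D)) (img g' s) by exists s => //; right.
rewrite -E => -[t Xt Et]; have Es : s = f @: t by apply: (img_inj gI'); rewrite Et fimg.
exists t => //; case: Xt => // t0; have := simplices_neq0 sD.
by rewrite Es t0 imset0 eqxx.
Qed.

Lemma pres_mapc C X f : injective f -> pres C X -> pres C (mapc f X).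
Proof.
move=> fI [g [gI ->]]; exists (f \o g); split; first exact: inj_comp.
have fim t : img (f \o g) t = f @` (img g t).
  apply/fsetP => x; apply/imgP/imfsetP => [[v vt ->]|[y /imgP[v vt ->] ->]].
    by exists (g v); rewrite ?mem_img.
  by exists v.
apply: cpx_ext => s; split=> [[u [t Xt ->] ->]|[t Xt ->]]; first by exists t.
by exists (img g t) => //; exists t.
Qed.

Lemma sing4_map f X : injective f -> sing4 X -> sing4 (mapc f X).
Proof.
move=> fI [cX H]; split; first exact: iscpx_map.
move=> e ce [t Xt Et]; rewrite Et.
have -> : lk (f @` t) (mapc f X) = mapc f (lk t X).
  apply: cpx_ext => s; split.
    case=> d [u Xu E].
    have [w wu Ew] : exists2 w, w `<=` u & s = f @` w.
      by apply: im_preim; rewrite -E fsubsetUl.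
    exists w => //; split; first by rewrite -(im_dis fI) -Ew.
    by rewrite (_ : w `|` t = u) //; apply: (im_inj fI); rewrite imfsetU -Ew.
  by case=> w [d Xw] ->; split; [rewrite im_dis|exists (w `|` t) => //; rewrite imfsetU].
apply: Sph_map => //; apply: H => //.
by rewrite -ce Et card_imfset.
Qed.

(** * From piecewise-linear homeomorphisms to flips *)

Section PartA.
Variable R : realType.

Lemma subdivision_feq K A (pos : vert A -> {ffun vert K -> R}) : subdivision pos ->
  exists X Y T, [/\ pres K X, pres A Y, feq X T & feq Y T].
Proof.
move=> /subdivision_flips[V [eK [eA [T [iK iA fK fA]]]]].
pose io (v : V) := nat_of_ord (enum_rank v).
have ioI : injective io by move=> u v /val_inj/enum_rank_inj.
exists (imc io (imS eK)), (imc io (imS eA)), (imc io T); split.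
- by exists (io \o eK); split; [apply: inj_comp|rewrite imc_imS].
- by exists (io \o eA); split; [apply: inj_comp|rewrite imc_imS].
- exact: imc_feq.
- exact: imc_feq.
Qed.

(** The flips run from L to a common subdivision and from there to K; in each of the two steps they
    pass through a regular triangulation. This turns spheres defined by homeomorphism into spheres
    generated by flips. *)
Lemma pl_Sph j K L X Y : pl_homeomorphic R K L -> pres K X -> pres L Y -> Sph j Y -> Sph j X.
Proof.
move=> /pl_common[A [pK [pL [sK sL]]]] pX pY SY.
have tr C C' Z Z' : pres C Z -> pres C Z' -> Sph j Z -> C = C' -> Sph j Z'.
  by move=> h1 h2 SZ _; have [f fI ->] := pres_map h1 h2; apply: Sph_map.
have [X1 [Y1 [T1 [pX1 pY1 f1 g1]]]] := subdivision_feq sK.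
have [X2 [Y2 [T2 [pX2 pY2 f2 g2]]]] := subdivision_feq sL.
have S1 : Sph j X2 := tr _ _ _ _ pY pX2 SY (erefl L).
have S2 := feq_SphV g2 (pres_cpx pY2) (feq_Sph f2 S1).
have S3 : Sph j Y1 := tr _ _ _ _ pY2 pY1 S2 (erefl A).
have S4 := feq_SphV f1 (pres_cpx pX1) (feq_Sph g1 S3).
exact: tr pX1 pX S4 (erefl K).
Qed.
End PartA.

Lemma flip_fresh A p X s : iscpx X -> ~ X [fset p] ->
  flip A [fset p] X s <-> ~~ (A `<=` s) /\ X (s `\ p `|` (if p \in s then A else fset0)).
Proof.
move=> cX Xp; have pX t : X t -> p \notin t by move=> Xt; apply/negP => pt; apply: Xp; apply: cpx_vert pt.
split=> [[[Xs As]|[ps As Xs]]|[As Xs]].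
- by split; rewrite // (negbTE (pX _ Xs)) fsetU0 mem_fsetD1 // pX.
- by rewrite (_ : p \in s) // -fsub1set.
- have [ps|ps] := boolP (p \in s); [right|left]; rewrite (fsub1set, As) ?ps.
    by move: Xs; rewrite ps.
  by move: Xs; rewrite (negbTE ps) fsetU0 mem_fsetD1.
Qed.

(** The renaming is the transposition of a and p, where p is not a vertex of X. *)
Lemma flip_rename a p X : iscpx X -> ~ X [fset p] ->
  exists2 f, injective f & flip [fset a] [fset p] X = mapc f X.
Proof.
move=> cX Xp; have pX t : X t -> p \notin t by move=> Xt; apply/negP => pt; apply: Xp; apply: cpx_vert pt.
exists (fun x => if x == a then p else if x == p then a else x).
  by move=> x y; case: eqP => ?; case: eqP => ?; (try case: eqP => ?); (try case: eqP => ?); lia.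
set f := (fun x : nat => _).
have fa (t : fs) : p \notin t -> a \in t -> f @` t = p |` (t `\ a).
  move=> pt at_; apply/fsetP => x; rewrite !inE; apply/imfsetP/idP => [[y /= yt ->]|].
    rewrite /f; case: (eqVneq y a) => [_|ya]; first by rewrite eqxx.
    case: (eqVneq y p) => [yp|_]; first by move: yt; rewrite yp (negbTE pt).
    by rewrite ya yt orbT.
  case/orP => [/eqP->|/andP[xa xt]]; first by exists a => //; rewrite /f eqxx.
  exists x => //; rewrite /f (negbTE xa); case: (eqVneq x p) => // xp.
  by move: xt; rewrite xp (negbTE pt).
have fna (t : fs) : p \notin t -> a \notin t -> f @` t = t.
  move=> pt at_; rewrite -[RHS]imfset_id.
  apply: eq_in_imfset => // x /= xt; rewrite /f.
  case: (eqVneq x a) => [xa|_]; first by rewrite xa (negbTE at_) in xt.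
  by case: (eqVneq x p) => [xp|_] //; rewrite xp (negbTE pt) in xt.
apply: cpx_ext => s; split.
  rewrite flip_fresh //= fsub1set => -[as_]; case: ifP => ps Xs.
    exists (s `\ p `|` [fset a]) => //; rewrite fa ?pX //; last by rewrite !inE eqxx orbT.
    fsd.
  rewrite fsetU0 mem_fsetD1 ?ps // in Xs; exists s => //; by rewrite fna ?ps.
case=> t Xt ->; have pt := pX _ Xt; have [at_|nat_] := boolP (a \in t); last first.
  by rewrite fna //; left; rewrite fsub1set.
rewrite fa //; have [pa|pa] := eqVneq p a; first by rewrite -pa (negbTE pt) in at_.
apply/flip_fresh => //; rewrite fsub1set !inE eqxx (eq_sym a) (negbTE pa) /=; split=> //.
by congr (X _): Xt; rewrite eqxx /=; fsd.
Qed.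

Lemma in_star (C : complex) (A : {set vert C}) s v :
  (v \in star_carr A s) = (Some v \in s) || (None \in s) && (v \in A).
Proof. by rewrite inE. Qed.

(** * Flips are piecewise-linear homeomorphisms *)

Section PL.
Variable R : realType.

Lemma pl_star C D X A p : pres C X -> X A -> A != fset0 -> ~ X [fset p] ->
  pres D (flip A [fset p] X) -> pl_homeomorphic R C D.
Proof.
move=> pC XA A0 Xp pD; have cX := pres_cpx pC.
(* Starring a single vertex only renames it; [star_complex] covers simplices with at least two
   vertices. *)
have [c1|c1] := leqP #|` A| 1.
  have /cardfs1P[a Aa] : #|` A| == 1 by rewrite eqn_leq c1 cardfs_gt0.
  rewrite Aa in pD; have [f fI E] := flip_rename a cX Xp; rewrite E in pD.
  by apply: (pl_iso R); apply: pres_isom pD; apply: pres_mapc.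
have [g [gI EX]] := pC; move: XA; rewrite EX => -[A' XA' EA].
have A0' : A' != set0 by rewrite -(img_eq0 gI) -EA.
have AC : A' \in C by case: XA' => // E; rewrite E eqxx in A0'.
have A1' : (1 < #|A'|)%N by rewrite -(card_img gI) -EA.
have gp v : g v != p.
  apply/eqP => E; apply: Xp; rewrite EX -E; exists [set v]; first exact: XK1.
  by rewrite img1.
have cst : common R C (star_complex A0' A1' AC).
  exists (star_complex A0' A1' AC), (star_pos R A'), (fun u => dirac R u).
  split; first exact: star_subdivision.
  apply: (@dirac_subdivision R _ _ id); first by exists id.
  by apply/setP => s; apply/imsetP/idP => [[t tK ->]|sK]; [rewrite imset_id|exists s; rewrite ?imset_id].
apply: pl_trans (common_pl cst) (pl_iso R _); apply: pres_isom pD.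
pose h (u : option (vert C)) := if u is Some v then g v else p.
have hI : injective h.
  move=> [u|] [v|] //= => [/gI->//|E|E]; by [have := gp u; rewrite E eqxx|have := gp v; rewrite -E eqxx].
exists h; split=> //.
have key (t : {set option (vert C)}) : flip A [fset p] X (img h t) <-> (t = set0 \/ t \in star_simplices A').
  rewrite flip_fresh //.
  have -> : (A `<=` img h t) = [forall v in A', Some v \in t].
    apply/fsubsetP/forall_inP => H.
      move=> v vA; have := H (g v); rewrite EA mem_img // => /(_ vA).
      by rewrite (mem_img hI t (Some v)).
    by move=> x; rewrite EA => /imgP[v vA ->]; rewrite (mem_img hI t (Some v)) H.
  have -> : (img h t `\ p `|` (if p \in img h t then A else fset0)) = img g (star_carr A' t).
    apply/fsetP => x; rewrite in_fsetU (mem_img hI t None); apply/idP/imgP.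
      case/orP; first rewrite in_fsetD1 => /andP[xp /imgP[[v|] vt E]].
      - by exists v; rewrite // in_star vt.
      - by rewrite E eqxx in xp.
      - case: ifP => // Nt; rewrite EA => /imgP[v vA ->]; exists v => //.
        by rewrite in_star Nt vA orbT.
    case=> v; rewrite in_star => /orP[vt ->|/andP[-> vA] ->].
      by rewrite in_fsetD1 gp (mem_img hI t (Some v)) vt.
    by rewrite EA mem_img // vA orbT.
  rewrite [in X _]EX; rewrite imc_in // inE.
  have c0 : (star_carr A' t == set0) = (t == set0).
    apply/idP/idP => [/eqP E|/eqP ->]; last first.
      by apply/eqP/setP => v; rewrite !inE.
    apply/eqP/setP => u; rewrite [RHS]inE; apply/negP => ut.
    have /set0Pn[v vA] := A0'.
    case: u ut => [w|] ut.
      by have : w \in star_carr A' t; [rewrite inE ut|rewrite E inE].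
    by have : v \in star_carr A' t; [rewrite inE ut vA orbT|rewrite E inE].
  split=> [[nA [/eqP|Cc]]|[E|/and3P[t0 nA Cc]]].
  - by rewrite c0 => /eqP; left.
  - have [->|t0] := eqVneq t set0; first by left.
    by right; rewrite nA.
  - split; last by left; apply/eqP; rewrite c0 E.
    rewrite E; by have /set0Pn[v vA] := A0'; apply/forall_inPn; exists v => //; rewrite inE.
  - by split=> //; right.
apply: cpx_ext => s; split=> [Fs|[t Xt ->]]; last exact/key.
have [t _ Et] : exists2 t : {set option (vert C)}, t \subset setT & s = img h t.
  apply: img_preim; apply/fsubsetP => x xs.
  have [->|xp] := eqVneq x p; first by rewrite (mem_img hI _ None).
  have : X (s `\ p) by move: Fs; rewrite flip_fresh // => -[_ Xs]; apply: (cpx_sub cX Xs); apply: fsubsetUl.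
  rewrite EX => -[u _ E]; have : x \in s `\ p by rewrite in_fsetD1 xp.
  by rewrite E => /imgP[v _ ->]; rewrite (mem_img hI _ (Some v)) inE.
by exists t => //; apply/key; rewrite -Et.
Qed.

(** Starring A before the flip and starring B after it both replace the star by p * dA * dB * M. *)
Lemma flip_star A B X p : iscpx X -> flip_ok A B X -> ~ X [fset p] -> p \notin A -> p \notin B ->
  flip A [fset p] X = flip B [fset p] (flip A B X).
Proof.
move=> cX ok Xp pA pB; have pX t : X t -> p \notin t by move=> Xt; apply/negP => pt; apply: Xp; apply: cpx_vert pt.
have dAB := flip_dis ok.
have cY := iscpx_flip cX ok.
have Yp : ~ flip A B X [fset p].
  case=> [[]//|[Bp _ _]]; have /fset0Pn[b bB] := flip_B0 ok.
  by have := fsubsetP Bp _ bB; rewrite inE => /eqP E; rewrite -E bB in pB.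
apply: cpx_ext => s; split.
  case=> [[Xs As]|[ps As Xs]].
    by left; split; [left|exact: (flip_nB cX ok Xs)].
  have nB := flip_nB cX ok Xs.
  have nBs : ~~ (B `<=` s).
    by apply: contra nB => Bs; fsd.
  right; split=> //; right; split; first exact: fsubsetUr.
    have [a aA as_] := nsubP As; apply: (nsub_in aA); rewrite !inE (negbTE as_) /= andbF /=.
    by apply/negP => aB; have := fdisjointP dAB a aA; rewrite aB.
  by apply: (cpx_sub cX Xs); fsd.
case=> [[[[Xs As]|[Bs _ _]] nB]|[ps nB]]; first by left.
  by rewrite Bs in nB.
case=> [[Xs _]|[_ As Xs]].
  by have := flip_nB cX ok Xs; rewrite fsubsetUr.
have nAs : ~~ (A `<=` s).
  have [a aA] := nsubP As; rewrite !inE negb_or => /andP[/nandP h aB].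
  apply: (nsub_in aA); case: h => // /negPn/eqP E.
  by rewrite -E aA in pA.
right; split=> //.
have [b bB bs] := nsubP nB.
have : X ((s `\ p) `|` A).
  apply: (flip_up cX ok bB); first by rewrite !inE negb_and bs orbT.
  by apply: (cpx_sub cX Xs); fsd.
by [].
Qed.

Lemma pl_flip A B X C D : flip_ok A B X -> pres C X -> pres D (flip A B X) -> pl_homeomorphic R C D.
Proof.
move=> ok pC pD; have cX := pres_cpx pC; have cY := pres_cpx pD.
have [n1 H1] := cpx_fin cX; have [n2 H2] := cpx_fin cY.
have okY := flip_okC cX ok.
pose p := maxn n1 n2.
have Xp t : X t -> p \notin t.
  by move=> Xt; apply/negP => /(H1 _ _ Xt); rewrite ltnNge leq_maxl.
have Yp t : flip A B X t -> p \notin t.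
  by move=> Xt; apply/negP => /(H2 _ _ Xt); rewrite ltnNge leq_maxr.
have Xp1 : ~ X [fset p] by move/Xp; rewrite inE eqxx.
have Yp1 : ~ flip A B X [fset p] by move/Yp; rewrite inE eqxx.
have pA := Xp _ (flip_A ok); have pB := Yp _ (flip_A okY).
have E := flip_star cX ok Xp1 pA pB.
have okZ : flip_ok A [fset p] X.
  split; [exact: flip_A0 ok| |by rewrite fdisjointX1|exact: flip_A ok|by []|].
    by apply/fset0Pn; exists p; rewrite inE.
  move=> s b Xs As; rewrite inE => /eqP ->; apply: (cpx_sub cX Xs); fsd.
have [Z pZ] := pres_exists (iscpx_flip cX okZ).
apply: pl_trans (pl_star pC (flip_A ok) (flip_A0 ok) Xp1 pZ) _; apply: pl_sym.
by rewrite E in pZ; apply: (pl_star pD (flip_A okY) (flip_B0 ok) Yp1 pZ).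
Qed.
End PL.

Lemma pres_link C X g (v : vert C) : pres_by X g -> pres_by (C:=link v) (lk [fset g v] X) (g \o val).
Proof.
move=> [gI EX]; have gvI : injective (g \o val : link_vert v -> nat) by apply: inj_comp => //; apply: val_inj.
split=> //.
have gE (t : {set link_vert v}) : img (g \o val) t `|` [fset g v] = img g (v |: val @: t).
  rewrite imgU // img1 // fsetUC; congr (_ `|` _); exact: (img_comp val g t).
have vN (u : link_vert v) : val u != v by have /andP[] := valP u.
apply: cpx_ext => s; split; last first.
  case=> t Xt ->; split.
    rewrite fdisjointX1; apply/imgP => -[u _ /gI E]; have := vN u; by rewrite -E eqxx.
  rewrite EX gE; exists (v |: val @: t) => //; right.
  case: Xt => [->|]; first by rewrite imset0 setU0 simplices1.
  by rewrite inE => /andP[].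
rewrite {1}EX => -[dis [u Xu Eu]].
have vu : v \in u by rewrite -(mem_img gI) -Eu !inE eqxx orbT.
have uC := XKin vu Xu.
pose t := [set w : link_vert v | val w \in u].
have Es : s = img (g \o val) t.
  apply/fsetP => x; apply/idP/imgP => [xs|[w]]; last first.
    rewrite inE => wu ->; have : g (val w) \in s `|` [fset g v] by rewrite Eu mem_img.
    rewrite in_fsetU in_fset1 => /orP[//|/eqP/gI E]; have := vN w; by rewrite E eqxx.
  have : x \in s `|` [fset g v] by rewrite in_fsetU xs.
  rewrite Eu => /imgP[y yu Ey].
  have yv : y != v.
    apply/eqP => E; move: dis; rewrite fdisjointX1 => /negP; apply.
    by rewrite -E -Ey.
  have yP : (y != v) && ([set v; y] \in simplices C).
    rewrite yv /=; apply: simplices_sub uC _ _.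
      by apply/subsetP => z; rewrite !inE => /orP[]/eqP->.
    by apply/set0Pn; exists v; rewrite !inE eqxx.
  by exists (exist _ y yP) => //; rewrite inE.
exists t => //; have [->|t0] := eqVneq t set0; first by left.
right; rewrite inE t0 /= (_ : v |: _ = u) //.
by apply: (img_inj gI); rewrite -Eu -gE -Es.
Qed.

Lemma pres_bd n (t : fs) : #|` t| = n.+2 -> pres (bd_simplex n) (bd t).
Proof.
move=> ct; pose g (i : 'I_n.+2) := nth 0%N t i.
have gI : injective g.
  move=> i j /eqP; rewrite nth_uniq ?fset_uniq // ?[size _]ct //.
  by move/eqP/val_inj.
have gT : img g setT = t.
  apply/fsetP => x; apply/imgP/idP => [[i _ ->]|xt]; first by rewrite mem_nth // [size _]ct.
  have xi : (index x t < n.+2)%N by rewrite -ct index_mem.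
  by exists (Ordinal xi) => //; rewrite /g /= nth_index.
have img_t u : (img g u == t) = (u == setT) by rewrite -gT (inj_eq (img_inj gI)).
exists g; split=> //; apply: cpx_ext => s; split.
  case=> st nts; have [u _ Eu] : exists2 u : {set 'I_n.+2}, u \subset setT & s = img g u.
    by apply: img_preim; rewrite gT.
  exists u => //; have [->|u0] := eqVneq u set0; first by left.
  right; rewrite inE u0 /= -img_t -Eu; apply: contra nts => /eqP ->.
  exact: fsubset_refl.
case=> u Xu ->; rewrite /bd -gT !img_sub // subsetT subTset; split=> //.
case: Xu => [->|]; last by rewrite inE => /andP[].
by apply/eqP => /setP/(_ ord0); rewrite !inE.
Qed.

(** * Spheres and singular manifolds on both sides *)

Section Manifold.
Variable R : realType.

(** The index shifts by one because [Sph] counts the vertices of a facet. *)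
Lemma Sph_pl n D Y : Sph n.+1 Y -> pres D Y -> pl_homeomorphic R D (bd_simplex n).
Proof.
move En : n.+1 => j S; elim: S En D => {j Y} [j t ct|j A B K SK IH ok] En D pD.
  by apply: (pl_iso R); apply: pres_isom pD (pres_bd _); rewrite ct -En.
have [D0 p0] := pres_exists (Sph_cpx SK).
exact: pl_trans (pl_sym (pl_flip R ok p0 pD)) (IH En _ p0).
Qed.

Lemma pl_bd_Sph n D Y : pl_homeomorphic R D (bd_simplex n) -> pres D Y -> Sph n.+1 Y.
Proof.
move=> h pD; pose t : fs := [fset nat_of_ord i | i : 'I_n.+2].
have ct : #|` t| = n.+2 by rewrite card_imfset ?size_enum_ord //=; exact: val_inj.
by apply: (pl_Sph h pD (pres_bd ct)); apply: Sph_bd.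
Qed.

(** The link of u in the link of v is the link of the edge {v, u}, and every edge arises in this
    way. *)
Lemma sing4_manifold C X : pres C X -> sing4 X <-> singular_manifold R 4 C.
Proof.
move=> [g pg]; have [gI EX] := pg.
have pl2 v (u : vert (link v)) : pres (link u) (lk [fset g v; g (val u)] X).
  exists ((g \o val) \o val); have /(pres_link u) := pres_link v pg.
  have uv : val u != v by have /andP[] := valP u.
  by rewrite /= lk_lk // fdisjointX1 inE (inj_eq gI).
have X2 v (u : vert (link v)) : #|` [fset g v; g (val u)]| = 2 /\ X [fset g v; g (val u)].
  have /andP[uv vuC] := valP u; split.
    by rewrite cardfs2 (inj_eq gI) eq_sym uv.
  by rewrite EX; exists [set v; val u]; [right|rewrite imgU // !img1].
split=> [[_ H] v u|H].
  by have [c2 Xe] := X2 v u; apply: Sph_pl (pl2 v u); apply: H.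
split; first by apply: pres_cpx; exists g.
move=> e ce Xe; move: (Xe); rewrite {1}EX => -[t Xt Et].
have /cards2P[v [u [vu Eu]]] : #|t| == 2 by rewrite -(card_img gI) -Et ce.
have vt : v \in t by rewrite Eu !inE eqxx.
have uP : (u != v) && ([set v; u] \in simplices C) by rewrite eq_sym vu -Eu (XKin vt Xt).
have := pl_bd_Sph (H v (exist _ u uP)) (pl2 _ _).
by rewrite /= Et Eu imgU // !img1.
Qed.
End Manifold.

Lemma move_flip n p q C D : bistellar_move n p q C D ->
  exists X A B, [/\ pres C X, flip_ok A B X & pres D (flip A B X)].
Proof.
move=> /move_flipS[U [f [f' [A [B [fI fI' ok E]]]]]].
pose io (v : U) := nat_of_ord (enum_rank v).
have ioI : injective io by move=> u v /val_inj/enum_rank_inj.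
exists (imc io (imS f)), (img io A), (img io B); split; last 1 first.
- rewrite -imc_flip // (_ : flipS _ _ _ = imS f'); last by apply/predeqP.
  by exists (io \o f'); split; [apply: inj_comp|rewrite imc_imS].
- by exists (io \o f); split; [apply: inj_comp|rewrite imc_imS].
- exact: imc_flip_ok.
Qed.

Lemma flip_move n X A B C D : pres C X -> flip_ok A B X -> pres D (flip A B X) ->
  (#|` B| + #|` A| = n.+2)%N -> (forall s, X s -> A `<=` s -> s `<=` A `|` B) ->
  bistellar_move n #|` B| #|` A| C D.
Proof.
move=> pC ok pD c near; have cX := pres_cpx pC; have cY := pres_cpx pD.
have [n1 H1] := cpx_fin cX; have [n2 H2] := cpx_fin cY.
pose M := maxn n1 n2.
have XM s x : X s -> x \in s -> (x < M.+1)%N.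
  by move=> Xs xs; have := H1 _ _ Xs xs; rewrite /M; lia.
have YM s x : flip A B X s -> x \in s -> (x < M.+1)%N.
  by move=> Xs xs; have := H2 _ _ Xs xs; rewrite /M; lia.
have io s : (forall x, x \in s -> (x < M.+1)%N) -> exists s' : {set 'I_M.+1}, s = img val s'.
  move=> sM; exists [set i | val i \in s]; apply/fsetP => x; apply/idP/imgP => [xs|[i]].
    by exists (Ordinal (sM _ xs)); rewrite ?inE.
  by rewrite inE => ? ->.
have [A' EA] := io A (XM _ ^~ (flip_A ok)); have [B' EB] := io B (YM _ ^~ (flip_A (flip_okC cX ok))).
have vI : injective (val : 'I_M.+1 -> nat) by apply: val_inj.
have plc E Z : pres E Z -> (forall s x, Z s -> x \in s -> (x < M.+1)%N) ->
    exists2 f : vert E -> 'I_M.+1, injective f & Z = imc val (imS f).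
  move=> [g [gI EZ]] ZM; have gM v : (g v < M.+1)%N.
    apply: (ZM [fset g v]); last by rewrite inE.
    by rewrite EZ; exists [set v]; [exact: XK1|rewrite img1].
  exists (fun v => Ordinal (gM v)); first by move=> u v [/gI].
  by rewrite imc_imS EZ; congr imc.
have [f fI EX] := plc _ _ pC XM; have [f' fI' EY] := plc _ _ pD YM.
rewrite EA EB !card_img //; rewrite EA EB EX in ok EY near.
rewrite EA EB !card_img // in c.
apply: (flipS_move fI fI') => //.
- exact: imc_flip_okV ok.
- by move=> s Ts As; have := near (img val s); rewrite -imgU // !img_sub //; apply=> //; apply/imc_in.
- move=> s; rewrite -(imc_in vI) imc_flip // EY; exact: imc_in.
Qed.

Lemma bst_map f X Y : injective f -> bst X Y -> bst (mapc f X) (mapc f Y).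
Proof.
move=> fI; elim=> {X Y} [X|A B X Y cX cX' ok c near _ IH]; first exact: bst_refl.
apply: (@bst_step (f @` A) (f @` B)); rewrite -?mapc_flip //; try exact: sing4_map.
- exact: flip_ok_map.
- by rewrite !card_imfset.
- by move=> s [t Xt ->]; rewrite -imfsetU !im_sub //; apply: near.
Qed.

Section Main.
Variable R : realType.

Lemma bst_equiv X Y C D : bst X Y -> pres C X -> pres D Y -> bistellar_equivalent R 4 C D.
Proof.
move=> H; elim: H C => {X Y} [X|A B X Y cX cX' ok c near _ IH] C pC pD.
  by apply: bistellar_iso; apply: pres_isom pC pD.
have [E pE] := pres_exists (iscpx_flip (pres_cpx pC) ok).
apply: (@bistellar_step R 4 #|` B| #|` A| C E).
- exact/(sing4_manifold R pC).
- exact/(sing4_manifold R pE).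
- by apply: (flip_move pC ok pE) => //; rewrite addnC.
- exact: IH.
Qed.

(** Being singular passes along the flips from K to the regular triangulation and backwards to A, so
    both sequences of flips consist of singular manifolds and become chains of bistellar moves. *)
Lemma subdivision_bst K A (pos : vert A -> {ffun vert K -> R}) : subdivision pos ->
  singular_manifold R 4 K -> exists X Y, [/\ pres K X, pres A Y & bst X Y].
Proof.
move=> /subdivision_feq[X [Y [T [pX pY fX fY]]]] sK; exists X, Y; split=> //.
have cX : sing4 X by apply/(sing4_manifold R pX).
have [cT bX] := feq_bst fX cX.
have [_ bY] := feq_bst fY (feq_sing4 fY (pres_cpx pY) cT).
exact: bst_trans bX (bst_sym bY).
Qed.
End Main.

Theorem theorem7 (R : realType) (K K' : complex) :
  singular_manifold R 4 K -> singular_manifold R 4 K' ->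
  (pl_homeomorphic R K K' <-> bistellar_equivalent R 4 K K').
Proof.
move=> sK sK'; split=> [/pl_common[A [p [p' [sp sp']]]]|].
  have [X [Y [pX pY bXY]]] := subdivision_bst sp sK.
  have [X' [Y' [pX' pY' bXY']]] := subdivision_bst sp' sK'.
  (* The common subdivision A has been placed twice, once for each sequence of moves; the first
     sequence is renamed to fit the second. *)
  have [f fI E] := pres_map pY pY'.
  have := bst_map fI bXY; rewrite -E => b.
  exact: bst_equiv (bst_trans b (bst_sym bXY')) (pres_mapc fI pX) pX'.
elim=> {K K' sK sK'} [K K' i|p q K K' K'' _ _ m _ IH]; first exact: pl_iso.
have [X [A [B [pK ok pK']]]] := move_flip m.
exact: pl_trans (pl_flip R ok pK pK') IH.
Qed.
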